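(* For every $\epsilon\in(0,1/2]$ and every integer $d\geq1$, there exist positive constants $c_3=c_3(d,\epsilon)$ and $C_3=C_3(d,\epsilon)$ such that, if $r=r(n)\in[C_3(\log n/n)^{1/d},c_3]$, then asymptotically almost surely $G_d(n,r)$ satisfies the following property: for every integer $L\in[c_3^{-1},2n/3]$, every $(1/2+\epsilon)$-subgraph $H\subseteq G_d(n,r)$ and every vertex $v$ of $G_d(n,r)$, there is a cycle of length $L$ in $H$ containing $v$.
   Context: The random geometric graph $G_d(n,r)$ has vertex set $[n]$; each vertex $i$ is assigned a position $X_i$, where $X_1,\dots,X_n$ are independent uniform random points in $[0,1]^d$, and $ij$ is an edge iff $\lVert X_i-X_j\rVert\le r$ (Euclidean norm). For $\alpha\in[0,1]$, an $\alpha$-subgraph of $G$ is a subgraph $H\subseteq G$ with $V(H)=V(G)$ and $d_H(v)\geq\alpha d_G(v)$ for all $v$. A.a.s. means with probability tending to $1$ as $n\to\infty$; $\log$ is the natural logarithm. The length of a cycle is its number of edges. *)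

(* Defs.v *)
From HB Require Import structures.
From mathcomp Require Import all_boot all_order all_algebra.
From mathcomp Require Import all_classical all_reals all_analysis.

Set Implicit Arguments.
Unset Strict Implicit.
Unset Printing Implicit Defensive.

Import Order.TTheory GRing.Theory Num.Theory.
Import numFieldNormedType.Exports.

Local Open Scope classical_set_scope.
Local Open Scope ring_scope.

(* Points of R^d are d-tuples of reals, with the product sigma-algebra. *)
Notation rpoint R d := (d.-tuple (measurableTypeR R)).

Section uniform_cube.
Context (R : realType).

Definition cons_point (d : nat) (x : measurableTypeR R * rpoint R d) :
  rpoint R d.+1 := [tuple of x.1 :: x.2].

Lemma measurable_cons_point (d : nat) : measurable_fun [set: _] (@cons_point d).
Proof. exact: measurable_cons. Qed.

HB.instance Definition _ (d : nat) :=
  isMeasurableFun.Build _ _ _ _ (@cons_point d) (@measurable_cons_point d).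

(* The uniform probability on [0,1]^d, i.e. the d-fold product of the uniform
   probability on [0,1]: the library only has binary products of measures, so
   the product on (d+1)-tuples is transported from R * R^d. *)
Fixpoint uniform_cube (d : nat) : probability (rpoint R d) R :=
  match d with
  | 0 => \d_ [tuple]
  | d'.+1 => distribution (uniform_prob (@ltr01 R) \x uniform_cube d')%E
                          (@cons_point d')
  end.

End uniform_cube.

Definition mutually_independent (R : realType) (disp disp' : measure_display)
    (T : measurableType disp) (T' : measurableType disp') (P : probability T R)
    (I : finType) (X : I -> {RV P >-> T'}) : Prop :=
  forall (J : {set I}) (A : I -> set T'), (forall i, measurable (A i)) ->
    P (\bigcap_(i in [set` J]) (X i @^-1` A i)) =
    (\prod_(i in J) P (X i @^-1` A i))%E.

Definition independent_uniform_points (R : realType) (disp : measure_display)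
    (T : measurableType disp) (P : probability T R) (n d : nat)
    (X : 'I_n -> {RV P >-> rpoint R d}) : Prop :=
  mutually_independent X /\
  forall i A, measurable A -> distribution P (X i) A = uniform_cube R d A.

Definition euclidean_dist (R : realType) (d : nat) (x y : rpoint R d) : R :=
  Num.sqrt (\sum_(k < d) ((tnth x k : R) - (tnth y k : R)) ^+ 2).

(* Simple graphs on a vertex type V are given by their adjacency relation. *)
Definition geometric_graph (R : realType) (n d : nat) (x : 'I_n -> rpoint R d)
    (r : R) : rel 'I_n :=
  fun i j => (i != j) && (euclidean_dist (x i) (x j) <= r).

Definition degree (V : finType) (G : rel V) (v : V) : nat := #|[set u | G v u]|.

(* H is spanning because it lives on the same vertex type as G. *)
Definition alpha_subgraph (R : realType) (V : finType) (alpha : R)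
    (G H : rel V) : Prop :=
  [/\ symmetric H, subrel H G &
      forall v, alpha * (degree G v)%:R <= (degree H v)%:R].

(* c lists the vertices of a cycle in cyclic order, so its length is size c. *)
Definition is_cycle (V : finType) (G : rel V) (c : seq V) : bool :=
  [&& (2 < size c)%N, cycle G c & uniq c].

(* Main.v *)
(* Cut the cube into cells of side 1/S with S of order 1/r, so that adjacency
   in the graph is decided by lattice distance up to a thin shell of cells, and
   group the cells into blocks of T^d cells.  The only random input is that by
   Chernoff every cell holds (1 +- eta) n / S^d vertices; the rest is
   deterministic.

   Inside blocks almost every vertex keeps more than half of the common maximal
   degree, so Hall's theorem in the bipartite double cover gives matchings of
   size > 2n/3 there.  Deleting many of them one after the other produces a
   digraph W inside H of small maximal degree with (2/3 + c) n edges per unit of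
   degree.  A random colouring with M colours splits all neighbourhoods of W
   evenly; the edges of W and of its transpose between consecutive colours
   0, 1, ..., K-1 then carry a nearly conserved flow, which yields (2/3 + c) n/M
   disjoint paths with K vertices, each inside one block.  The colour K provides
   anchors and the remaining colours a reserve: vertices of adjacent cells have
   many common H-neighbours, so vertices in nearby blocks are joined through the
   reserve by links with exactly 6T + 1 + e internal vertices, for any small e.
   A closed tour of anchors through neighbouring blocks, starting at v and
   detouring through the K-paths, is linked greedily; the number of visited
   blocks, the number of inserted paths, and e are adjusted to the length L. *)
Require Import Defs.
From HB Require Import structures.
From mathcomp Require Import all_boot all_order all_algebra.
From mathcomp Require Import zify ring lra.

Set Implicit Arguments.
Unset Strict Implicit.
Unset Printing Implicit Defensive.

Import Order.TTheory GRing.Theory Num.Theory.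

(** * Hall's theorem with deficiency *)

(** As [H] may depend on the points, the random event speaks of cell counts only, and the colouring
    is chosen afterwards for the given [H]. The 2/3 stems from the double cover: a set violating
    Hall's condition may be taken independent; if it has [x] elements of degree above half the
    maximum, it has at least about [x / 2] neighbours, all outside it, so its deficiency is at most
    about a third of all vertices. One matching is too sparse for a random colouring to split its
    neighbourhoods evenly; hence about [eps * D / 8] arc-disjoint ones are superposed, where [D]
    bounds all degrees. Their union [W] may be unbalanced as a digraph, but [W] plus its transpose
    offers each vertex nearly the same weight towards every colour, so what enters from one layer
    can leave to the next. Near the faces of the cube degrees may fall far below [D] and Hall's
    argument fails; links only compare neighbouring cells, whose neighbourhoods almost agree, and
    thus reach every vertex. Greedy linking succeeds, however many links there are, because only
    links from nearby blocks can collide. *)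

Section Hall.
Variables A B : finType.

Definition nbhd (N : A -> {set B}) (S : {set A}) : {set B} :=
  \bigcup_(a in S) N a.

Lemma mem_nbhd (N : A -> {set B}) (S : {set A}) a b : a \in S -> b \in N a -> b \in nbhd N S.
Proof. by move=> aS bN; apply/bigcupP; exists a. Qed.

(* Rado's argument: a vertex with two neighbours can lose one of the two edges
   without violating Hall's condition, so one reduces to degree at most 1. *)
Lemma hall_deficiency (X : {set A}) (N : A -> {set B}) (k : nat) :
  (forall S : {set A}, S \subset X -> #|S| <= #|nbhd N S| + k) ->
  exists f : A -> option B,
   [/\ forall a b, f a = Some b -> (a \in X) && (b \in N a),
       forall a a' b, f a = Some b -> f a' = Some b -> a = a' &
       #|X| <= #|[set a | f a]| + k].
Proof.
have [s] := ubnP (\sum_(a in X) #|N a|); elim: s N => // s IH N les hallN.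
case: (boolP [exists a in X, 1 < #|N a|]) => [/existsP[a /andP[aX]]|].
  move=> /card_gt1P[b1 [b2 [b1N b2N b12]]].
  pose N' b := fun x => if x == a then N a :\ b else N x.
  have N'S b x : N' b x \subset N x.
    by rewrite /N'; case: eqP => [->|_] //; exact: subD1set.
  have N'na b x : x != a -> N' b x = N x by rewrite /N' => /negbTE ->.
  have N'sum b : b \in N a -> \sum_(x in X) #|N' b x| < s.
    move=> bN; rewrite (bigD1 a) //= {1}/N' eqxx.
    rewrite (bigD1 a) //= in les.
    rewrite (eq_bigr (fun x => #|N x|)); last by move=> x /andP[_ /N'na ->].
    by rewrite (cardsD1 b) bN in les; lia.
  have conc b : b \in N a ->
      (forall S : {set A}, S \subset X -> #|S| <= #|nbhd (N' b) S| + k) ->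
      exists f : A -> option B,
   [/\ forall a b, f a = Some b -> (a \in X) && (b \in N a),
       forall a a' b, f a = Some b -> f a' = Some b -> a = a' &
       #|X| <= #|[set a | f a]| + k].
    move=> bN hb; have [f [f1 f2 f3]] := IH _ (N'sum _ bN) hb.
    exists f; split=> // x y /f1/andP[-> /=]; exact: (subsetP (N'S b x)).
  case: (boolP [forall S : {set A}, (S \subset X) ==> (#|S| <= #|nbhd (N' b1) S| + k)]).
    by move/forallP => h; apply: (conc b1) => // S; apply/implyP.
  case: (boolP [forall S : {set A}, (S \subset X) ==> (#|S| <= #|nbhd (N' b2) S| + k)]).
    by move/forallP => h _; apply: (conc b2) => // S; apply/implyP.
  rewrite !negb_forall => /existsP[S2]; rewrite negb_imply -ltnNge => /andP[S2X lt2].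
  move=> /existsP[S1]; rewrite negb_imply -ltnNge => /andP[S1X lt1].
  have aS b (S : {set A}) : S \subset X -> #|nbhd (N' b) S| + k < #|S| -> a \in S.
    move=> SX; apply: contraLR => aS; rewrite -leqNgt.
    suff -> : nbhd (N' b) S = nbhd N S by exact: hallN.
    apply: eq_bigr => x xS; apply: N'na; apply: contraNneq aS => <-; exact: xS.
  have a1 := aS _ _ S1X lt1; have a2 := aS _ _ S2X lt2.
  (* Submodularity: the union keeps all its neighbours, because each of [b1], [b2] survives through
     the other set, and the intersection loses only [a]. Adding the two Hall inequalities
     contradicts the two failures. *)
  have hU : nbhd N (S1 :|: S2) \subset nbhd (N' b1) S1 :|: nbhd (N' b2) S2.
    apply/subsetP => y /bigcupP[x xS yN]; rewrite inE.
    have [xa|xna] := eqVneq x a; last first.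
      move: xS; rewrite inE => /orP[] xS; apply/orP; [left|right].
        by apply: (mem_nbhd xS); rewrite N'na.
      by apply: (mem_nbhd xS); rewrite N'na.
    subst x; have [yb1|yb1] := eqVneq y b1; apply/orP; [right|left].
      by apply: (mem_nbhd a2); rewrite /N' eqxx in_setD1 yN andbT yb1.
    by apply: (mem_nbhd a1); rewrite /N' eqxx in_setD1 yN andbT.
  have hI : nbhd N ((S1 :&: S2) :\ a) \subset nbhd (N' b1) S1 :&: nbhd (N' b2) S2.
    apply/subsetP => y /bigcupP[x]; rewrite in_setD1 inE => /andP[xa /andP[x1 x2]] yN.
    by rewrite inE (mem_nbhd x1) ?(mem_nbhd x2) ?N'na.
  have := subset_leq_card hU; have := subset_leq_card hI.
  have := hallN (S1 :|: S2); rewrite subUset S1X S2X => /(_ isT).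
  have := hallN ((S1 :&: S2) :\ a).
  have -> : (S1 :&: S2) :\ a \subset X.
    by apply: subset_trans (subD1set _ _) _; apply: subset_trans (subsetIl _ _) _.
  move=> /(_ isT).
  have := cardsD1 a (S1 :&: S2); rewrite inE a1 a2 /=.
  have := cardsUI S1 S2; have := cardsUI (nbhd (N' b1) S1) (nbhd (N' b2) S2).
  lia.
rewrite negb_exists => /forallP le1.
have N1 a b b' : a \in X -> b \in N a -> b' \in N a -> b = b'.
  move=> aX bN b'N; have := le1 a; rewrite aX /= -leqNgt => h.
  by apply: (card_le1_eqP h).
(* With all degrees in [X] at most 1 the graph is a union of stars centred in [B]; one leaf per
   centre gives a matching of size [#|nbhd N X|]. *)
pose rep b := [pick a in X | b \in N a].
pose f a := if [pick b in N a] is Some b then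
              if rep b == Some a then Some b else None else None.
have fP a b : f a = Some b -> rep b = Some a /\ b \in N a.
  by rewrite /f; case: pickP => // b' b'N; case: eqP => // rb [<-].
have repP a b : rep b = Some a -> a \in X /\ b \in N a.
  by rewrite /rep; case: pickP => // x /andP[xX bN] [<-].
exists f; split.
- by move=> a b /fP[/repP[aX _] bN]; rewrite aX.
- by move=> a a' b /fP[ra _] /fP[ra' _]; move: ra; rewrite ra' => -[].
- apply: leq_trans (hallN X (subxx _)) _; rewrite leq_add2r.
  rewrite -(card_imset _ Some_inj); apply: leq_trans (leq_imset_card f _).
  apply: subset_leq_card; apply/subsetP => _ /imsetP[b /bigcupP[a aX bN] ->].
  have [a' ra'] : exists a', rep b = Some a'.
    by rewrite /rep; case: pickP => [a' _|/(_ a)]; [exists a'|rewrite aX bN].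
  have [a'X bN'] := repP _ _ ra'.
  suff fa' : f a' = Some b by apply/imsetP; exists a'; rewrite ?inE fa'.
  rewrite /f; case: pickP => [b' b'N|/(_ b)]; last by rewrite bN'.
  by rewrite (N1 a' b' b) // ra' eqxx.
Qed.

(* A fractional matching of total weight |X| - k, restricted to S, shows that
   Hall's condition holds for S with deficiency k. *)
Lemma fractional_matching (R : realFieldType) (X : {set A}) (N : A -> {set B})
    (w : A -> B -> R) (k : nat) :
  (forall a b, 0 <= w a b)%R ->
  (forall a b, a \in X -> w a b != 0%R -> b \in N a) ->
  (forall a, a \in X -> \sum_b w a b <= 1)%R ->
  (forall b, \sum_(a in X) w a b <= 1)%R ->
  (#|X|%:R <= (\sum_(a in X) \sum_b w a b) + k%:R)%R ->
  exists f : A -> option B,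
   [/\ forall a b, f a = Some b -> (a \in X) && (b \in N a),
       forall a a' b, f a = Some b -> f a' = Some b -> a = a' &
       #|X| <= #|[set a | f a]| + k].
Proof.
move=> w0 wN wr wc wt; apply: hall_deficiency => S SX.
rewrite -(ler_nat R) natrD.
have sumS : (\sum_(a in S) \sum_b w a b <= #|nbhd N S|%:R)%R.
  rewrite exchange_big /= (bigID (fun b => b \in nbhd N S)) /=.
  rewrite [X in (_ + X)%R]big1 ?addr0; last first.
    move=> b bN; apply: big1 => a aS; apply/eqP; apply: contraNT bN => wab.
    by apply: (mem_nbhd aS); apply: wN => //; exact: (subsetP SX).
  rewrite -sumr_const; apply: ler_sum => b _; apply: le_trans (wc b).
  rewrite [leRHS](bigID (fun a => a \in S)) /=.
  rewrite [X in (_ <= X + _)%R](eq_bigl (fun a => a \in S)); last first.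
    by move=> a; case aS: (a \in S); rewrite ?andbF ?andbT // (subsetP SX).
  by rewrite lerDl sumr_ge0.
have sumD : (\sum_(a in X :\: S) \sum_b w a b <= #|X :\: S|%:R)%R.
  rewrite -sumr_const; apply: ler_sum => a; rewrite inE => /andP[_ aX].
  exact: wr.
have e1 : (\sum_(a in X) \sum_b w a b =
   \sum_(a in S) \sum_b w a b + \sum_(a in X :\: S) \sum_b w a b)%R.
  rewrite (big_setID S) /=; congr (_ + _)%R; apply: eq_bigl => a.
  by rewrite inE; case aS: (a \in S); rewrite ?andbF ?andbT // (subsetP SX).
have e2 : (#|X|%:R = #|S|%:R + #|X :\: S|%:R :> R)%R.
  by rewrite -natrD -(cardsID S X) (setIidPr SX).
move: wt; rewrite e1 e2; lra.
Qed.
End Hall.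

(** * Disjoint paths through colour layers *)

Lemma uniq_flatten_map (T U : eqType) (g : T -> seq U) (s : seq T) :
  uniq s -> (forall x, x \in s -> uniq (g x)) ->
  (forall x y z, x \in s -> y \in s -> z \in g x -> z \in g y -> x = y) ->
  uniq (flatten (map g s)).
Proof.
elim: s => //= x s IH /andP[xs us] ug dg; rewrite cat_uniq ug ?mem_head //=.
rewrite IH //; first last.
- by move=> a b z a_s b_s; apply: dg; rewrite inE ?a_s ?b_s orbT.
- by move=> a a_s; apply: ug; rewrite inE a_s orbT.
rewrite andbT; apply/hasPn => z /flatten_mapP[y ys zy].
apply/negP => zx; move/negP: xs; apply.
by rewrite (dg x y z) // ?mem_head // inE ys orbT.
Qed.

Section LayeredPaths.
Variables (V : finType) (H : rel V) (chi : V -> nat) (k : nat).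

(* A vertex matched to itself is a vertex that no path uses. *)
Definition layer_nbhd (a : V) : {set V} :=
  [set b | ((chi b == (chi a).+1) && H a b) || ((a == b) && (0 < chi a))].

(** Iterating [f] from colour 0 climbs one colour per step. A loop is never entered, since [f] is
    injective and a looped vertex is its own preimage. Trajectories that stop early end at distinct
    unmatched vertices, so at most [def] of them fail. *)
Lemma layered_paths_of_matching (f : V -> option V) (def : nat) :
  (forall a b, f a = Some b ->
     (a \in [set a | chi a < k]) && (b \in layer_nbhd a)) ->
  (forall a a' b, f a = Some b -> f a' = Some b -> a = a') ->
  #|[set a | chi a < k]| <= #|[set a | f a]| + def ->
  exists Ps : seq (seq V),
    [/\ #|[set a | chi a == 0]| <= size Ps + def,
        forall P, P \in Ps -> [/\ size P = k.+1, sorted H P &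
                               forall x, x \in P -> chi x <= k] &
        uniq (flatten Ps)].
Proof.
move=> fP finj card_f.
(* Unmatched vertices are fixed, so that an interrupted trajectory stays where it stops. *)
pose F a := odflt a (f a).
have FS a b : f a = Some b -> F a = b by rewrite /F => ->.
have FN a : f a = None -> F a = a by rewrite /F => ->.
pose it i u := iter i F u.
have inv i u : chi u = 0 -> chi (it i u) <= i /\
    (f (it i u) = None \/ chi (it i u) = i /\ f (it i u) <> Some (it i u)).
  move=> u0; elim: i => [|i [le_i IH]].
    rewrite /it /= u0; split=> //; right; split=> // fu.
    by have := fP _ _ fu; rewrite !inE u0 ltnn andbF orbF; case: eqP; rewrite ?u0 ?andbF.
  rewrite /it iterS -/(it i u); case fi: (f (it i u)) => [b|]; last first.
    by rewrite FN //; split; [exact: leqW|left].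
  rewrite (FS _ _ fi); case: IH => [|[ci nloop]]; first by rewrite fi.
  have /andP[_] := fP _ _ fi; rewrite inE => /orP[/andP[/eqP cb _]|/andP[/eqP ab c0]].
    rewrite cb ci; split=> //; right; split=> // fb.
    by apply: nloop; rewrite (finj _ _ _ fi fb) fb.
  by case: nloop; rewrite fi ab.
have step i u b : chi u = 0 -> f (it i u) = Some b -> chi b = (chi (it i u)).+1 /\ H (it i u) b.
  move=> u0 fi; have [_ [|[ci nloop]]] := inv i u u0; first by rewrite fi.
  have /andP[_] := fP _ _ fi; rewrite inE => /orP[/andP[/eqP -> ->]//|/andP[/eqP ab _]].
  by case: nloop; rewrite fi ab.
have it_inj i u u' : chi u = 0 -> chi u' = 0 -> it i u = it i u' -> u = u'.
  move=> u0 u'0; elim: i => // i IH; rewrite /it !iterS -!/(it i _).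
  wlog le : u u' u0 u'0 IH / f (it i u) -> f (it i u').
    move=> W; case fi: (f (it i u)) => [b|]; case fi': (f (it i u')) => [b'|].
    - by apply: W; rewrite // fi'.
    - by move=> e; apply/esym; apply: W; rewrite // ?fi' // => /esym /IH.
    - by apply: W; rewrite // fi'.
    - by apply: W; rewrite // fi.
  case fi': (f (it i u')) => [b'|]; case fi: (f (it i u)) => [b|].
  - rewrite (FS _ _ fi) (FS _ _ fi') => bb'; apply: IH.
    by apply: finj fi _; rewrite fi' bb'.
  (* The trajectory that has stopped has colour at most [i], while the other one has just reached
     [i + 1]. *)
  - rewrite (FS _ _ fi') (FN _ fi) => e.
    have [ci' _] := step _ _ _ u'0 fi'.
    have [_ [|[ci _]]] := inv i u' u'0; first by rewrite fi'.
    have [] := inv i u u0; rewrite e ci' ci; lia.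
  - by move: le; rewrite fi fi' => /(_ isT).
  - by rewrite !FN.
pose V0 := [set a | chi a == 0].
pose good := [set u in V0 | chi (it k u) == k].
have V0E u : (u \in V0) = (chi u == 0) by rewrite inE.
have goodE u : (u \in good) = (chi u == 0) && (chi (it k u) == k).
  by rewrite inE V0E.
have chiV0 u : u \in V0 -> chi u = 0 by rewrite inE => /eqP.
have bad_end u : u \in V0 -> u \notin good ->
   (it k u \in [set a | chi a < k]) && (f (it k u) == None).
  move=> uV; have u0 := chiV0 _ uV; rewrite goodE u0 /= => ck.
  have [le_k [->|[ce _]]] := inv k u u0; last by rewrite ce eqxx in ck.
  by rewrite inE ltn_neqAle ck le_k.
have cbad : #|V0 :\: good| <= def.
  have : #|[set a | chi a < k]| = #|[set a | chi a < k] :&: [set a | f a]| +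
       #|[set a | chi a < k] :\: [set a | f a]| by rewrite cardsID.
  have : #|[set a | f a]| <= #|[set a | chi a < k] :&: [set a | f a]|.
    apply: subset_leq_card; apply/subsetP => a; rewrite inE => fa.
    rewrite inE [X in _ && X]inE fa andbT.
    by case fa': (f a) fa => [b|//] _; have /andP[] := fP _ _ fa'.
  suff : #|V0 :\: good| <= #|[set a | chi a < k] :\: [set a | f a]| by lia.
  rewrite -(card_in_imset (f := it k)); last first.
    move=> u u'; rewrite !in_setD !V0E => /andP[_ /eqP u0] /andP[_ /eqP u'0].
    exact: it_inj.
  apply: subset_leq_card; apply/subsetP => _ /imsetP[u + ->].
  rewrite in_setD => /andP[ug uV]; have /andP[xk /eqP fk] := bad_end _ uV ug.
  by rewrite inE xk andbT inE fk.
have chi_it u i : u \in good -> i <= k -> chi (it i u) = i.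
  rewrite goodE => /andP[/eqP u0 /eqP ck] le_ik.
  have [// _ [fN|[//]]] := inv i u u0.
  have : it k u = it i u.
    rewrite /it -(subnK le_ik) iterD -/(it i u).
    by elim: (k - i) => //= m ->; rewrite FN.
  by move=> e; have [] := inv i u u0; rewrite -e ck; lia.
exists [seq traject F u k.+1 | u <- enum good]; split.
- rewrite size_map -cardE; have := cardsID good V0.
  have -> : V0 :&: good = good.
    by apply/setIidPr/subsetP => u; rewrite goodE V0E => /andP[].
  by move=> <-; rewrite leq_add2l.
- move=> _ /mapP[u + ->]; rewrite mem_enum => ug; split.
  + by rewrite size_traject.
  + apply/(pathP u) => i; rewrite size_traject => ltik.
    have u0 : chi u = 0 by move: ug; rewrite goodE => /andP[/eqP].
    have -> : nth u (u :: traject F (F u) k) i = it i u.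
      by apply: (nth_traject F (n := k.+1)); rewrite ltnS ltnW.
    have -> : nth u (traject F (F u) k) i = it i.+1 u.
      by rewrite (set_nth_default (F u)) ?size_traject // (nth_traject F ltik) /it -iterSr.
    have := chi_it u i.+1 ug ltik; rewrite {1}/it iterS -/(it i u).
    case fi: (f (it i u)) => [b|]; last by rewrite FN // (chi_it _ _ ug (ltnW ltik)); lia.
    by rewrite /it [iter i.+1 _ _]iterS -/(it i u) (FS _ _ fi) => _; have [] := step _ _ _ u0 fi.
  + move=> x /trajectP[i ltik ->]; rewrite -/(it i u) (chi_it _ _ ug) //.
- apply: uniq_flatten_map; first exact: enum_uniq.
  + move=> u; rewrite mem_enum => ug; apply/(uniqP u) => i j.
    rewrite !inE size_traject => lti ltj.
    rewrite (nth_traject F lti) (nth_traject F ltj) -!/(it _ _) => e.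
    by rewrite -(chi_it u i) // -(chi_it u j) // e.
  + move=> u u' x; rewrite !mem_enum => ug u'g /trajectP[i lti ->] /trajectP[j ltj].
    rewrite -!/(it _ _) => e; have ij : i = j.
      by rewrite -(chi_it u i) // -(chi_it u' j) // e.
    rewrite -ij in e; apply: it_inj e.
    * by move: ug; rewrite goodE => /andP[/eqP].
    * by move: u'g; rewrite goodE => /andP[/eqP].
Qed.
End LayeredPaths.

Section LayeredFlow.
Variables (R : realFieldType) (V : finType) (H W : rel V) (chi : V -> nat).
Variables (k M : nat) (Delta delta : R).
Local Open Scope ring_scope.

Let wout (u : V) (i : nat) : R := \sum_v (W u v && (chi v == i))%:R.
Let win (v : V) (i : nat) : R := \sum_u (W u v && (chi u == i))%:R.
Let dout (u : V) : R := \sum_v (W u v)%:R.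
Let din (v : V) : R := \sum_u (W u v)%:R.
Let weight : R := \sum_u dout u.

(* The weight (W + W^T) / L between consecutive layers is a flow which is
   conserved up to 4 delta / L at each vertex; the defect is absorbed by the
   loops. *)
Lemma layered_flow (p : nat) :
  symmetric H -> subrel W H -> (k < M)%N -> (0 < k)%N ->
  0 < Delta -> 0 <= delta ->
  (forall u, dout u <= Delta) -> (forall u, din u <= Delta) ->
  (forall u i, (i < M)%N -> `|wout u i - dout u / M%:R| <= delta) ->
  (forall u i, (i < M)%N -> `|win u i - din u / M%:R| <= delta) ->
  p%:R * (2 * (Delta / M%:R + delta)) <=
    2 * weight / M%:R ^+ 2 - 8 * delta * #|V|%:R ->
  exists Ps : seq (seq V),
    [/\ (p <= size Ps)%N,
        forall P, P \in Ps -> [/\ size P = k.+1, sorted H P &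
                               forall x, x \in P -> (chi x <= k)%N] &
        uniq (flatten Ps)].
Proof.
move=> Hsym WH ltkM k0 D0 d0 doutD dinD woutP winP ple.
have M0 : 0 < M%:R :> R by rewrite ltr0n; apply: leq_ltn_trans ltkM.
have M1 : M%:R^-1 <= 1 :> R.
  by rewrite invf_le1 // ler1n; apply: leq_ltn_trans ltkM.
(* At most this much weight, out and in together, joins a vertex to one colour; dividing by it
   yields a fractional matching. *)
pose L := 2 * (Delta / M%:R + delta).
have L0 : 0 < L.
  have := divr_gt0 D0 M0; rewrite /L; lra.
have wout0 u i : 0 <= wout u i by apply: sumr_ge0 => v _; rewrite ler0n.
have win0 u i : 0 <= win u i by apply: sumr_ge0 => v _; rewrite ler0n.
pose out a := (wout a (chi a).+1 + win a (chi a).+1) / L.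
pose inn a := if (0 < chi a)%N then (wout a (chi a).-1 + win a (chi a).-1) / L else 0.
have tot_le1 a i : (i < M)%N -> (wout a i + win a i) / L <= 1.
  move=> iM; rewrite ler_pdivrMr // mul1r /L.
  have := woutP a i iM; have := winP a i iM; rewrite !ler_norml.
  have : dout a / M%:R <= Delta / M%:R by rewrite ler_pM2r ?invr_gt0.
  have : din a / M%:R <= Delta / M%:R by rewrite ler_pM2r ?invr_gt0.
  lra.
have out0 a : 0 <= out a by rewrite divr_ge0 ?addr_ge0 // ltW.
have inn0 a : 0 <= inn a.
  by rewrite /inn; case: ifP => // _; rewrite divr_ge0 ?addr_ge0 // ltW.
have out1 a : (chi a < k)%N -> out a <= 1.
  by move=> ak; apply: tot_le1; apply: leq_ltn_trans ltkM.
have inn1 a : (chi a <= k)%N -> inn a <= 1.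
  move=> ak; rewrite /inn; case: ifP => [a0|_]; last exact: ler01.
  by apply: tot_le1; lia.
(* The loop receives what both the row and the column still allow. Colour 0 gets none: its vertices
   are the starts of the paths. *)
pose lam a := if (0 < chi a)%N then 1 - Num.max (out a) (inn a) else 0.
pose fl a b : R := (chi b == (chi a).+1)%:R * ((W a b)%:R + (W b a)%:R) / L.
pose w a b := if (chi a < k)%N && (chi b <= k)%N
              then fl a b + (a == b)%:R * lam a else 0.
have fl0 a b : 0 <= fl a b.
  apply: divr_ge0; last exact: ltW.
  by apply: mulr_ge0; [|apply: addr_ge0]; rewrite ler0n.
have eL0 : 0 <= 4 * delta / L.
  by apply: divr_ge0; [apply: mulr_ge0|exact: ltW].
have lam0 a : (chi a < k)%N -> 0 <= lam a.
  move=> ak; rewrite /lam; case: ifP => // _; rewrite subr_ge0 ge_max.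
  by rewrite out1 // inn1 // ltnW.
pose X := [set a | (chi a < k)%N].
have sumfl a : \sum_b fl a b = out a.
  rewrite /fl /out -mulr_suml; congr (_ / L).
  rewrite /wout /win -big_split /=; apply: eq_bigr => b _.
  by case: (chi b == _); case: (W a b); case: (W b a); rewrite /= ?mul0r ?mul1r ?addr0 ?add0r.
have row a : (chi a < k)%N -> \sum_b w a b = out a + lam a.
  move=> ak; rewrite -sumfl.
  have -> : lam a = \sum_b (a == b)%:R * lam a.
    rewrite (bigD1 a) //= eqxx mul1r big1 ?addr0 // => b.
    by rewrite eq_sym => /negbTE ->; rewrite mul0r.
  rewrite -big_split /=; apply: eq_bigr => b _; rewrite /w ak /=.
  case: leqP => // kb; rewrite /fl; case: eqP => [cb|_]; first by exfalso; move: cb ak kb; clear; lia.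
  by case: eqP => [ab|_]; [exfalso; rewrite ab in ak; lia|rewrite !mul0r addr0].
have col b : \sum_(a in X) w a b <= (if (chi b <= k)%N then 1 else 0).
  case: leqP => kb; last first.
    by rewrite big1 // => a _; rewrite /w [(chi b <= k)%N]leqNgt kb andbF.
  have le1 : \sum_(a in X) w a b <= inn b + (if (chi b < k)%N then lam b else 0).
    have -> : inn b = \sum_a fl a b.
      rewrite /inn; case: ifP => [b0|bn].
        rewrite /fl -mulr_suml; congr (_ / L).
        rewrite /wout /win -big_split /=; apply: eq_bigr => a _.
        have -> : (chi b == (chi a).+1) = (chi a == (chi b).-1).
          by move: b0; clear; lia.
        by case: (chi a == _); case: (W a b); case: (W b a);
           rewrite /= ?mul0r ?mul1r ?addr0 ?add0r.
      rewrite big1 // => a _; rewrite /fl.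
      by case: eqP => [cb|_]; [exfalso; lia|rewrite !mul0r].
    have -> : (if (chi b < k)%N then lam b else 0) =
        \sum_(a in X) (a == b)%:R * lam a.
      case: ifP => bk.
        rewrite (bigD1 b) ?inE //= eqxx mul1r big1 ?addr0 // => a /andP[_ /negbTE ->].
        by rewrite mul0r.
      rewrite big1 // => a; rewrite inE => ak; case: eqP => [ab|_]; last by rewrite mul0r.
      by rewrite ab bk in ak.
    apply: (@le_trans _ _ (\sum_(a in X) (fl a b + (a == b)%:R * lam a))).
      apply: ler_sum => a; rewrite inE => ak; rewrite /w ak kb /=; exact: lexx.
    rewrite big_split /= lerD2r [leRHS](bigID (fun a => a \in X)) /= lerDl.
    by apply: sumr_ge0.
  apply: le_trans le1 _; have := inn1 b kb; case: ifP => bk; last by rewrite addr0.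
  rewrite /lam; case: ifP => [b0 _|_]; last by rewrite addr0.
  have : inn b <= Num.max (out b) (inn b) by rewrite le_max lexx orbT.
  lra.
pose V0 := [set a | chi a == 0%N].
have V0X : V0 \subset X by apply/subsetP => a; rewrite !inE => /eqP ->.
have W1 i u : (i < M)%N -> dout u / M%:R - delta <= wout u i.
  by move=> iM; have := woutP u i iM; rewrite ler_norml; lra.
have W2 i u : (i < M)%N -> din u / M%:R - delta <= win u i.
  by move=> iM; have := winP u i iM; rewrite ler_norml; lra.
have weightE : weight = \sum_v din v by rewrite /weight /dout exchange_big.
have cV0 : #|V0|%:R <= #|V|%:R :> R by rewrite ler_nat max_card.
have sumc (c : R) : \sum_(v : V) c = c * #|V|%:R by rewrite sumr_const mulr_natr.
(* Summed over heads: each vertex receives from colour 0 its share [din v / M], up to [delta]. *)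
have d0V : \sum_(u in V0) dout u >= weight / M%:R - delta * #|V|%:R.
  have -> : \sum_(u in V0) dout u = \sum_v win v 0.
    rewrite /dout /win exchange_big /=; apply: eq_bigr => v _.
    rewrite big_mkcond /=; apply: eq_bigr => u _; rewrite inE.
    by case: (chi u == 0%N); rewrite ?andbT ?andbF.
  rewrite weightE mulr_suml -sumc -sumrB; apply: ler_sum => v _; apply: W2.
  by apply: ltn_trans ltkM.
have d0V' : \sum_(u in V0) din u >= weight / M%:R - delta * #|V|%:R.
  have -> : \sum_(u in V0) din u = \sum_v wout v 0.
    rewrite /din /wout exchange_big /=; apply: eq_bigr => v _.
    rewrite big_mkcond /=; apply: eq_bigr => u _; rewrite inE.
    by case: (chi u == 0%N); rewrite ?andbT ?andbF.
  rewrite mulr_suml -sumc -sumrB; apply: ler_sum => v _; apply: W1.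
  by apply: ltn_trans ltkM.
have outV0 : (2 * weight / M%:R ^+ 2 - 4 * delta * #|V|%:R) / L <= \sum_(a in V0) out a.
  have -> : \sum_(a in V0) out a = (\sum_(a in V0) (wout a 1 + win a 1)) / L.
    by rewrite mulr_suml; apply: eq_bigr => a; rewrite inE /out => /eqP ->.
  rewrite ler_pM2r ?invr_gt0 //.
  apply: (@le_trans _ _ (\sum_(a in V0) ((dout a + din a) / M%:R - 2 * delta))).
    rewrite sumrB -mulr_suml big_split /= sumr_const -[2 * delta *+ _]mulr_natr.
    have h1 := lerD d0V d0V'.
    have := h1; rewrite -(ler_pM2r (x := M%:R^-1)) ?invr_gt0 //.
    have h2 : delta * #|V|%:R * M%:R^-1 <= delta * #|V|%:R by rewrite ler_piMr // mulr_ge0.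
    have h3 : delta * #|V0|%:R <= delta * #|V|%:R by rewrite ler_wpM2l.
    have -> : 2 * weight / M%:R ^+ 2 = 2 * (weight / M%:R / M%:R) by field; lra.
    rewrite !mulrDl; lra.
  apply: ler_sum => a _; rewrite mulrDl.
  have := W1 1%N a (leq_ltn_trans k0 ltkM); have := W2 1%N a (leq_ltn_trans k0 ltkM); lra.
(* Both [inn] and [out] estimate [(dout a + din a) / M / L]; their difference collects four errors
   [delta], and the loop fills the larger one up to 1. *)
have dif a : a \in X -> (0 < chi a)%N -> 1 - 4 * delta / L <= out a + lam a.
  rewrite inE => ak a0; rewrite /lam a0.
  have : `|inn a - out a| <= 4 * delta / L.
    rewrite /inn a0 /out -mulrBl normrM [`|L^-1|]gtr0_norm ?invr_gt0 //.
    rewrite ler_pM2r ?invr_gt0 //.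
    have := woutP a (chi a).+1 (leq_ltn_trans ak ltkM).
    have := winP a (chi a).+1 (leq_ltn_trans ak ltkM).
    have am := leq_ltn_trans (leq_pred _) (ltn_trans ak ltkM).
    have := woutP a _ am; have := winP a _ am.
    rewrite !ler_norml; lra.
  by rewrite ler_norml; case: (leP (out a) (inn a)); lra.
(* Half of the loss [8 * delta] is spent on the flow out of colour 0, half on the loops. *)
have pV0 : (p%:R <= \sum_(a in V0) out a - 4 * delta / L * #|V|%:R).
  move: ple; rewrite -/L -ler_pdivlMr //.
  have -> : (2 * weight / M%:R ^+ 2 - 8 * delta * #|V|%:R) / L =
   (2 * weight / M%:R ^+ 2 - 4 * delta * #|V|%:R) / L - 4 * delta / L * #|V|%:R.
    by field; rewrite !lt0r_neq0.
  by lra.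
have e0 : 0 <= 4 * delta / L * #|V|%:R.
  by rewrite mulr_ge0.
have p_le : (p <= #|V0|)%N.
  rewrite -(ler_nat R); apply: le_trans pV0 _.
  apply: (@le_trans _ _ (\sum_(a in V0) out a)); first by lra.
  rewrite -sumr_const; apply: ler_sum => a; rewrite inE => /eqP a0.
  by apply: out1; rewrite a0.
(* With deficiency [#|V0| - p] that many starts may fail, and [p] paths remain. *)
have [|||||f [f1 f2 f3]] := @fractional_matching _ _ R X (layer_nbhd H chi) w (#|V0| - p).
- move=> a b; rewrite /w; case: ifP => // /andP[ak _].
  by apply: addr_ge0; [exact: fl0|apply: mulr_ge0; [exact: ler0n|exact: lam0]].
- move=> a b; rewrite inE => ak; rewrite /w ak /=; case: leqP => [bk|_]; last by rewrite eqxx.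
  apply: contraNT; rewrite inE negb_or => /andP[n1 n2].
  have -> : fl a b = 0.
    rewrite /fl; case: eqP n1 => [_|_] /=; last by rewrite !mul0r.
    move=> nH; have -> : W a b = false by apply: contraNF nH; exact: WH.
    have -> : W b a = false by apply: contraNF nH; rewrite Hsym; exact: WH.
    by rewrite /= addr0 mulr0 mul0r.
  rewrite add0r; case: eqP n2 => [_ /=|_ _]; last by rewrite mul0r.
  by rewrite /lam => /negbTE ->; rewrite mulr0.
- move=> a; rewrite inE => ak; rewrite row // /lam; case: ifP => [a0|_].
    have : out a <= Num.max (out a) (inn a) by rewrite le_max lexx.
    lra.
  by rewrite addr0 out1.
- by move=> b; apply: le_trans (col b) _; case: ifP.
- rewrite natrB //.
  have -> : #|X|%:R = #|V0|%:R + #|X :\: V0|%:R :> R.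
    by rewrite -natrD -(cardsID V0 X) (setIidPr V0X).
  have -> : \sum_(a in X) \sum_b w a b =
     \sum_(a in V0) out a + \sum_(a in X :\: V0) (out a + lam a).
    rewrite (big_setID V0) /= (setIidPr V0X); congr (_ + _).
      apply: eq_bigr => a; rewrite inE => /eqP a0.
      by rewrite row ?a0 // /lam a0 addr0.
    by apply: eq_bigr => a; rewrite in_setD [a \in X]inE => /andP[_ ak]; rewrite row.
  have : \sum_(a in X :\: V0) (1 - 4 * delta / L) <= \sum_(a in X :\: V0) (out a + lam a).
    apply: ler_sum => a; rewrite in_setD => /andP[a0 aX]; apply: dif => //.
    by rewrite inE in a0; rewrite lt0n.
  rewrite sumr_const -[(1 - 4 * delta / L) *+ _]mulr_natr mulrBl mul1r.
  have : 4 * delta / L * #|X :\: V0|%:R <= 4 * delta / L * #|V|%:R.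
    by apply: ler_wpM2l => //; rewrite ler_nat; exact: max_card.
  lra.
have [Ps [P1 P2 P3]] := layered_paths_of_matching f1 f2 f3.
exists Ps; split=> //; move: P1 p_le; rewrite -/V0; clear; lia.
Qed.
End LayeredFlow.

(** * Edge-disjoint matchings of the double cover *)

Lemma card_set_sum (R : realFieldType) (V : finType) (P : pred V) :
  (#|[set v | P v]|%:R = \sum_v (P v)%:R :> R)%R.
Proof.
rewrite -sum1_card natr_sum big_mkcond /=.
by apply: eq_bigr => v _; rewrite inE; case: (P v).
Qed.

Section MatchingRounds.
Variables (R : realFieldType) (V : finType) (eps D : R) (Gd : {set V}) (k : nat).
Local Open Scope ring_scope.
Hypotheses (eps0 : 0 < eps) (eps1 : eps <= 1 / 2) (D0 : 0 < D).
Hypothesis badGd : #|~: Gd|%:R <= eps / 40 * #|V|%:R.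
Hypothesis kV : #|V|%:R * (1 / 3 - 3 * eps / 20) <= k%:R.

Let nb (K : rel V) (u : V) : {set V} := [set v | K u v].

(* S0 = S minus N(S) is independent, has the same deficiency as S, and
   |N(S0)| >= (1/2 + eps/4)|S0| up to the exceptional vertices; hence the
   deficiency is below n/3. *)
Lemma double_cover_hall (K : rel V) (S : {set V}) :
  symmetric K -> (forall u, #|nb K u|%:R <= D) ->
  (forall u, u \in Gd -> (1 / 2 + eps / 4) * D <= #|nb K u|%:R) ->
  (#|S| <= #|nbhd (nb K) S| + k)%N.
Proof.
move=> Ksym degK degG; have [eps0' eps1' D0'] := And3 eps0 eps1 D0.
pose NS := nbhd (nb K) S; pose S0 := S :\: NS; pose N0 := nbhd (nb K) S0.
have N0NS : N0 \subset NS.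
  apply/subsetP => b /bigcupP[a]; rewrite in_setD => /andP[_ aS] ab.
  exact: mem_nbhd ab.
have N0S b : b \in N0 -> b \notin S.
  move=> /bigcupP[a]; rewrite in_setD => /andP[aN aS]; rewrite inE => ab.
  by apply: contra aN => bS; apply: (mem_nbhd bS); rewrite inE Ksym.
have c1 : (#|S| = #|S :&: NS| + #|S0|)%N by rewrite cardsID.
have c2 : (#|S :&: NS| + #|N0| <= #|NS|)%N.
  rewrite -cardsUI; have -> : (S :&: NS) :&: N0 = set0.
    apply/setP => b; rewrite !in_setI in_set0; apply/negP => /andP[/andP[bS _] /N0S].
    by rewrite bS.
  by rewrite cards0 addn0 subset_leq_card // subUset subsetIr.
have c3 : (#|S0| + #|N0| <= #|V|)%N.
  rewrite -cardsUI; have -> : S0 :&: N0 = set0.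
    apply/setP => b; rewrite in_setI in_set0; apply/negP => /andP[bS /N0S].
    by move: bS; rewrite in_setD => /andP[_ ->].
  by rewrite cards0 addn0 max_card.
(* [up] and [lo] count the edges between [S0] and [N0] from both ends. *)
have up : \sum_(a in S0) #|nb K a|%:R <= #|N0|%:R * D :> R.
  rewrite (eq_bigr (fun a => \sum_b (K a b)%:R)); last by move=> a _; rewrite card_set_sum.
  rewrite exchange_big /= (bigID (fun b => b \in N0)) /=.
  rewrite [X in _ + X]big1 ?addr0; last first.
    move=> b bN; apply: big1 => a aS; case ab: (K a b) => //.
    by case/negP: bN; apply: (mem_nbhd aS); rewrite inE.
  rewrite mulrC mulr_natr -sumr_const; apply: ler_sum => b _; apply: le_trans (degK b).
  rewrite card_set_sum; under eq_bigr do rewrite Ksym.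
  by rewrite [leRHS](bigID (fun a => a \in S0)) /= lerDl sumr_ge0.
have lo : (1 / 2 + eps / 4) * D * (#|S0|%:R - #|~: Gd|%:R) <= \sum_(a in S0) #|nb K a|%:R.
  have cG : (#|S0| <= #|S0 :&: Gd| + #|~: Gd|)%N.
    rewrite -(cardsID Gd S0) leq_add2l subset_leq_card //.
    by apply/subsetP => x; rewrite in_setD in_setC => /andP[].
  have a0 : 0 <= (1 / 2 + eps / 4) * D by rewrite mulr_ge0 //; lra.
  apply: (@le_trans _ _ ((1 / 2 + eps / 4) * D * #|S0 :&: Gd|%:R)).
    by apply: ler_wpM2l => //; rewrite lerBlDr -natrD ler_nat.
  rewrite (big_setID Gd) /= mulr_natr -sumr_const; apply: ler_wpDr; first exact: sumr_ge0.
  by apply: ler_sum => a; rewrite in_setI => /andP[_]; exact: degG.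
have ineq : (1 / 2 + eps / 4) * (#|S0|%:R - #|~: Gd|%:R) <= #|N0|%:R.
  rewrite -(ler_pM2r D0); apply: le_trans up; apply: le_trans lo; lra.
have c3' : #|S0|%:R + #|N0|%:R <= #|V|%:R :> R by rewrite -natrD ler_nat.
have x0 : 0 <= #|V|%:R :> R by [].
(* Up to terms in [eps] and the exceptional vertices: [y >= x / 2] and [x + y <= n] force
   [x - y <= n / 3]. *)
have fin : #|S0|%:R - #|N0|%:R <= #|V|%:R * (1 / 3 - 3 * eps / 20).
  move: ineq c3' badGd x0 eps0 eps1.
  move: (#|S0|%:R : R) (#|N0|%:R : R) (#|V|%:R : R) (#|~: Gd|%:R : R).
  clear => x y n b ineq c bad n0 e0 e1.
  rewrite -(@ler_pM2l _ (3 / 2 + eps / 4)); last by lra.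
  have h1 : (3 / 2 + eps / 4) * (x - y) <= (1 / 2 - eps / 4) * n + 2 * ((1 / 2 + eps / 4) * b).
    have : (1 / 2 - eps / 4) * (x + y) <= (1 / 2 - eps / 4) * n.
      by apply: ler_wpM2l => //; lra.
    lra.
  have h2 : (1 / 2 + eps / 4) * b <= (1 / 2 + eps / 4) * (eps / 40 * n).
    by apply: ler_wpM2l => //; lra.
  have h3 : 0 <= n * (eps * (1 / 12 - eps / 20)).
    by rewrite mulr_ge0 // mulr_ge0; lra.
  lra.
suff : (#|S0| <= #|N0| + k)%N by move: c1 c2; rewrite -/NS; clear; lia.
rewrite -(ler_nat R) natrD; by apply: (le_trans _ (lerD (lexx _) kV)); rewrite -lerBlDl.
Qed.

(** Each round applies Hall's theorem to what is left of [H]. Arcs are removed in both directions to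
    keep the rest symmetric, so after [j] rounds a vertex has lost at most [2 * j] edges; the
    hypothesis on [Gd] leaves room for [Delta] rounds. *)
Lemma matching_rounds (H : rel V) (Delta j : nat) :
  symmetric H -> (forall u, #|nb H u|%:R <= D) ->
  (forall u, u \in Gd -> (1 / 2 + eps / 4) * D + 2 * Delta%:R <= #|nb H u|%:R) ->
  (j <= Delta)%N ->
  exists W : rel V,
    [/\ subrel W H,
        forall u, (#|[set v | W u v]| <= j)%N,
        forall v, (#|[set u | W u v]| <= j)%N &
        (j * (#|V| - k) <= \sum_u #|[set v | W u v]|)%N].
Proof.
move=> Hsym degH degG; elim: j => [_|j IH ltj].
  exists (fun _ _ => false); split=> //.
  - by move=> u; rewrite leqn0 cards_eq0; apply/eqP/setP => v; rewrite !inE.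
  - by move=> u; rewrite leqn0 cards_eq0; apply/eqP/setP => v; rewrite !inE.
have [W [WH Wo Wi Ws]] := IH (ltnW ltj).
pose K a b := [&& H a b, ~~ W a b & ~~ W b a].
have Ksym : symmetric K by move=> a b; rewrite /K Hsym [~~ W a b && _]andbC.
have KH u : nb K u \subset nb H u by apply/subsetP => v; rewrite !inE => /andP[].
have degK u : #|nb K u|%:R <= D.
  by apply: le_trans (degH u); rewrite ler_nat subset_leq_card.
have degKG u : u \in Gd -> (1 / 2 + eps / 4) * D <= #|nb K u|%:R.
  move=> /degG dg.
  have : (#|nb H u| <= #|nb K u| + (j + j))%N.
    apply: leq_trans (leq_add (leqnn _) (leq_add (Wo u) (Wi u))).
    apply: leq_trans (leq_add (leqnn _) (leq_card_setU _ _)).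
    apply: leq_trans (leq_card_setU _ _); apply: subset_leq_card.
    apply/subsetP => v; rewrite !inE /K => ->.
    by case: (W u v); case: (W v u).
  rewrite -(ler_nat R) !natrD.
  have : j%:R <= Delta%:R :> R by rewrite ler_nat ltnW.
  by move: dg; lra.
have hall (S : {set V}) : S \subset setT -> (#|S| <= #|nbhd (nb K) S| + k)%N.
  by move=> _; apply: double_cover_hall.
have [f [f1 f2 f3]] := hall_deficiency hall.
have fK a b : f a = Some b -> K a b by move=> /f1/andP[_]; rewrite inE.
exists (fun a b => W a b || (f a == Some b)); split.
- by move=> a b /orP[/WH//|/eqP/fK/and3P[]].
- move=> u; apply: (@leq_trans (#|[set v | W u v]| + #|[set v | f u == Some v]|)).
    apply: leq_trans (leq_card_setU _ _); apply: subset_leq_card.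
    by apply/subsetP => v; rewrite !inE.
  rewrite -addn1; apply: leq_add => //.
  by apply/card_le1_eqP => a b; rewrite !inE => /eqP -> /eqP[->].
- move=> u; apply: (@leq_trans (#|[set v | W v u]| + #|[set v | f v == Some u]|)).
    apply: leq_trans (leq_card_setU _ _); apply: subset_leq_card.
    by apply/subsetP => v; rewrite !inE.
  rewrite -addn1; apply: leq_add => //.
  by apply/card_le1_eqP => a b; rewrite !inE => /eqP fa /eqP fb; exact: f2 fb fa.
(* The new matching lies in [K], hence outside [W], so the out-degrees add up exactly. *)
- have out u : #|[set v | W u v || (f u == Some v)]| = (#|[set v | W u v]| + f u)%N.
    case fu: (f u) => [b|] /=.
      rewrite addn1 -(add1n #|_|) (cardsD1 b) inE eqxx orbT; congr (1 + _)%N.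
      apply: eq_card => v; rewrite !inE; have [->|vb] /= := eqVneq v b.
        by have /and3P[_ /negbTE -> _] := fK _ _ fu.
      have -> : (Some b == Some v) = false by apply: contraNF vb => /eqP[->].
      by rewrite orbF.
    by rewrite addn0; apply: eq_card => v; rewrite !inE orbF.
  rewrite (eq_bigr _ (fun u _ => out u)) big_split /= mulSn addnC leq_add //.
  have -> : (\sum_u f u = #|[set a | f a]|)%N.
    by rewrite -sum1_card [RHS]big_mkcond /=; apply: eq_bigr => a _; rewrite inE; case: (f a).
  by rewrite leq_subLR addnC -cardsT.
Qed.
End MatchingRounds.

(** * Cycles from tours, paths and links *)

Lemma perm_flatten_cat (T S : eqType) (f g : S -> seq T) (s : seq S) :
  perm_eq (flatten [seq f x ++ g x | x <- s])
          (flatten (map f s) ++ flatten (map g s)).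
Proof.
apply/permP => a; elim: s => //= x s IH.
rewrite !count_cat IH !count_cat; clear; lia.
Qed.

Lemma card_set_mem_seq (T : finType) (s : seq T) : #|[set x | x \in s]| <= size s.
Proof. by rewrite cardsE; exact: card_size. Qed.

Section Tour.
Variables (V B : finType) (beta : V -> B) (near : rel B).
Hypotheses (near_refl : reflexive near) (near_sym : symmetric near).

Let vnear (x y : V) := near (beta x) (beta y).

Lemma path_beta x x' s : beta x = beta x' -> path vnear x s -> path vnear x' s.
Proof. by move=> e; case: s => //= y s; rewrite /vnear e. Qed.

(* Each new block is visited by a detour x, y, x' from a visited neighbouring
   block, so a block occurs at most once more than it has neighbours. *)
Lemma block_tour (avail : B -> {set V}) (g0 : nat) (v : V) (t : nat) :
  (forall b x, x \in avail b -> beta x = b) ->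
  (forall b, v \notin avail b) ->
  (forall b, #|[set b' | near b b']| <= g0) ->
  (forall b, g0 < #|avail b|) ->
  (forall A : {set B}, A != set0 -> A != setT ->
     exists a b, [/\ a \in A, b \notin A & near a b]) ->
  0 < t <= #|B| ->
  exists s : seq V,
    [/\ uniq s, v \in s, (forall x, x \in s -> x = v \/ x \in avail (beta x)),
        size s = t.*2.-1 & cycle vnear s] /\
    (#|[set b | has (fun x => beta x == b) s]| = t /\
     forall b, count (fun x => beta x == b) s <= g0.+1).
Proof.
move=> availb vavail neardeg availg conn.
(* Counting visited neighbouring blocks makes the induction work: the block where a detour starts
   gains one anchor and one visited neighbour at once. *)
suff H : 0 < t <= #|B| ->
  exists s : seq V,
    [/\ uniq s, v \in s, (forall x, x \in s -> x = v \/ x \in avail (beta x)),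
        size s = t.*2.-1 & cycle vnear s] /\
    (#|[set b | has (fun x => beta x == b) s]| = t /\
     forall b, count (fun x => beta x == b) s <=
       #|[set b' | near b b' && has (fun x => beta x == b') s]|.+1).
  move=> /H[s [s1 [s2 s3]]]; exists s; split=> //; split=> // b.
  apply: leq_trans (s3 b) _; rewrite ltnS; apply: leq_trans (neardeg b).
  by apply: subset_leq_card; apply/subsetP => b'; rewrite !inE => /andP[].
elim: t => // -[_ _|t IH /andP[_ ltB]].
  exists [:: v]; split; last split.
  - by split; rewrite ?mem_head //= ?/vnear ?near_refl // => x; rewrite inE => /eqP; left.
  - rewrite -(cards1 (beta v)); apply: eq_card => b.
    by rewrite !inE /= orbF eq_sym.
  - by move=> b /=; rewrite addn0; case: (_ == _).
have /IH[s [[us vs sav ss cs] [cvis cnt]]] : 0 < t.+1 <= #|B| by rewrite /= ltnW.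
pose vis := [set b | has (fun x => beta x == b) s].
have visP x : x \in s -> beta x \in vis.
  by move=> xs; rewrite inE; apply/hasP; exists x.
have [||a [b [avis bvis nab]]] := conn vis.
- by apply/set0Pn; exists (beta v); apply: visP.
- by apply: contraTneq ltB => visT; rewrite -cvis -/vis visT cardsT ltnn.
have := avis; rewrite inE => /hasP[x xs /eqP xa].
have [i s' rs] := rot_to xs.
have pe : perm_eq s (x :: s') by rewrite -rs perm_sym perm_rot.
have [y yb] : exists y, y \in avail b.
  by apply/set0Pn; rewrite -card_gt0; apply: leq_ltn_trans (availg b).
have ys : y \notin s.
  by apply: contra bvis => /visP; rewrite (availb _ _ yb).
(* As [b] is a neighbour of [a] not yet visited, [a] holds at most [g0] anchors so far, and a fresh
   one exists. *)
have [x' x'a x's] : exists2 x', x' \in avail a & x' \notin s.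
  apply/exists_inP; apply: contraT; rewrite negb_exists_in => /forall_inP all_in.
  have : #|avail a| <= g0.
    apply: leq_trans (_ : count (fun x => beta x == a) s <= _).
      rewrite -size_filter; apply: leq_trans (card_size _).
      apply: subset_leq_card; apply/subsetP => z za.
      by rewrite mem_filter (availb _ _ za) eqxx; move/negPn: (all_in _ za).
    apply: leq_trans (cnt a) _; apply: leq_trans (neardeg a).
    rewrite [in leqRHS](cardsD1 b) inE nab add1n ltnS; apply: subset_leq_card.
    apply/subsetP => b'; rewrite in_setD1 !inE => /andP[-> hb'].
    by rewrite andbT; apply: contraNneq bvis => <-; rewrite inE.
  by rewrite leqNgt availg.
have yx' : y != x'.
  by apply: contraNneq bvis => e; rewrite -(availb _ _ yb) e (availb _ _ x'a).
exists [:: x, y, x' & s']; split; [split|split].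
- move: us ys x's; rewrite (perm_uniq pe) !(perm_mem pe) /= !inE !negb_or.
  move=> /andP[-> ->] /andP[yx ->] /andP[x'x ->].
  by rewrite yx' eq_sym yx eq_sym x'x.
- by move: vs; rewrite (perm_mem pe) !inE => /orP[->//|->]; rewrite !orbT.
- move=> z; rewrite !inE => /or4P[/eqP->|/eqP->|/eqP->|zs].
  + exact: sav.
  + by right; rewrite (availb _ _ yb).
  + by right; rewrite (availb _ _ x'a).
  + by apply: sav; rewrite (perm_mem pe) inE zs orbT.
- by move: ss; rewrite (perm_size pe) /= => /eqP; rewrite doubleS /= => /eqP ->.
- move: cs; rewrite -(rot_cycle i) rs /= => px.
  rewrite /vnear xa (availb _ _ yb) (availb _ _ x'a) nab near_sym nab /=.
  by apply: path_beta px; rewrite xa (availb _ _ x'a).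
- rewrite -cvis -/vis; have -> : [set b0 | has (fun x0 => beta x0 == b0) [:: x, y, x' & s']] = b |: vis.
    apply/setP => c; rewrite in_setU1 !inE (perm_has _ pe) /=.
    by rewrite (availb _ _ yb) (availb _ _ x'a) xa; case: (a == c); rewrite ?orbT //= eq_sym.
  by rewrite cardsU1 bvis.
- move=> c; have -> : count (fun x => beta x == c) [:: x, y, x' & s'] =
      (b == c) + (a == c) + count (fun x => beta x == c) s.
    rewrite (permP pe) /= (availb _ _ yb) (availb _ _ x'a) xa; clear; lia.
  have visS : forall c', has (fun x => beta x == c') s ->
     has (fun x => beta x == c') [:: x, y, x' & s'].
    by move=> c'; rewrite (perm_has _ pe) /= => /orP[->//|->]; rewrite !orbT.
  have [cb|cb] := eqVneq b c.
    rewrite -cb; have -> : count (fun x => beta x == b) s = 0.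
      by apply/eqP; rewrite -leqn0 leqNgt -has_count; move: bvis; rewrite inE.
    have -> : (a == b) = false by apply: contraNF bvis => /eqP <-.
    by rewrite addn0 addn0.
  have [ca|ca] := eqVneq a c; rewrite /= ?add0n; last first.
    apply: leq_trans (cnt c) _; rewrite ltnS; apply: subset_leq_card.
    by apply/subsetP => b'; rewrite !inE => /andP[-> /visS].
  rewrite add1n ltnS; apply: leq_trans (cnt c) _.
  rewrite [in leqRHS](cardsD1 b) inE -ca nab /= (availb _ _ yb) eqxx orbT add1n ltnS.
  apply: subset_leq_card; apply/subsetP => b'; rewrite in_setD1 !in_set => /andP[-> hb'].
  have := visS _ hb'; rewrite /= (availb _ _ yb) => ->; rewrite !andbT; apply: contraNneq bvis => <-.
  by rewrite in_set.
Qed.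
End Tour.

Section Assembly.
Variables (V B : finType) (H : rel V) (beta : V -> B) (near conf : rel B).
Hypothesis near_refl : reflexive near.

(* A nonempty path of H, given by its first vertex and the others. *)
Let item := (V * seq V)%type.
Let inear (a b : item) := near (beta (last a.1 a.2)) (beta b.1).
Let verts (a : item) := a.1 :: a.2.

(** A path with both ends in one block can be put behind any item ending in that block, because
    [near] is reflexive. The original items are never lost, so the place is still there at each
    insertion. *)
Lemma insert_items (its Qs : seq item) :
  cycle inear its ->
  (forall Q, Q \in Qs -> beta (last Q.1 Q.2) = beta Q.1 /\
     exists2 a, a \in its & beta (last a.1 a.2) = beta Q.1) ->
  exists2 its', perm_eq its' (its ++ Qs) & cycle inear its'.
Proof.
move=> cyc; elim: Qs => [_|Q Qs IH QsP]; first by exists its; rewrite ?cats0.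
have [|its' pe cyc'] := IH.
  by move=> P Ps; apply: QsP; rewrite inE Ps orbT.
have [Qb [a aits ab]] := QsP Q (mem_head _ _).
have a_its' : a \in its' by rewrite (perm_mem pe) mem_cat aits.
have [i s rs] := rot_to a_its'.
have pe' : perm_eq its' (a :: s) by rewrite -rs perm_sym perm_rot.
exists [:: a, Q & s].
  apply/permP => p; have := permP pe p; have := permP pe' p.
  rewrite !count_cat /=; clear; lia.
move: cyc'; rewrite -(rot_cycle i) rs /= => pa.
rewrite {1}/inear ab near_refl /=.
have : beta (last a.1 a.2) = beta (last Q.1 Q.2) by rewrite ab Qb.
by case: (rcons s a) pa => //= y l; rewrite /inear => /andP[h ->] <-; rewrite h.
Qed.

(** The end [y] is separate from the list so that [y = x] closes the cycle: [cycle H (x.1 :: t)] is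
    by definition [path H x.1 (rcons t x.1)]. *)
Lemma join_links (x y : item) (s : seq item) (L : seq (item * item * seq V)) :
  map fst L = zip (x :: s) (rcons s y) ->
  (forall l, l \in L -> path H l.1.1.1 l.1.1.2 /\
     path H (last l.1.1.1 l.1.1.2) (rcons l.2 l.1.2.1)) ->
  exists2 t, flatten [seq verts l.1.1 ++ l.2 | l <- L] = x.1 :: t &
             path H x.1 (rcons t y.1).
Proof.
elim: s x L => [|z s IH] x [|[[a b] q] L] //= [-> ->].
  case: L => // _ /(_ _ (mem_head _ _)) /= [p1 p2].
  by exists (x.2 ++ q); rewrite ?cats0 // rcons_cat cat_path p1.
move=> eL good; have [|t -> pt] := IH z L eL.
  by move=> l lL; apply: good; rewrite inE lL orbT.
have /= [p1 p2] := good _ (mem_head _ _).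
exists ((x.2 ++ q) ++ z.1 :: t) => //.
by rewrite rcons_cat rcons_cons -cat_rcons rcons_cat !cat_path p1 p2 last_cat last_rcons.
Qed.

Variables (Z : {set V}) (reg : B -> {set V}) (N f0 : nat).
Hypothesis reg_conf : forall b b' x, x \in reg b -> x \in reg b' -> conf b b'.
Hypothesis link : forall (u u' : V) (F : {set V}),
  near (beta u) (beta u') -> #|F| <= f0 ->
  exists q : seq V, [/\ size q = N, path H u (rcons q u'), uniq q &
    forall x, x \in q -> [/\ x \in Z, x \notin F & x \in reg (beta u)]].

(** A new link has to avoid [F0] and the earlier links from conflicting blocks; by [reg_conf] the
    others cannot meet its region. Hence the bound [f0] is local and the number of requests is
    unlimited. *)
Lemma greedy_links (F0 : {set V}) (reqs : seq (item * item)) :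
  (forall r, r \in reqs -> inear r.1 r.2) ->
  (forall b, count (fun r : item * item => conf b (beta (last r.1.1 r.1.2))) reqs * N
     + #|F0| <= f0) ->
  exists L : seq (item * item * seq V),
   [/\ map fst L = reqs, uniq (flatten (map snd L)) &
    forall l, l \in L -> [/\ size l.2 = N,
       path H (last l.1.1.1 l.1.1.2) (rcons l.2 l.1.2.1) &
       forall x, x \in l.2 -> [/\ x \in Z, x \notin F0 &
                                 x \in reg (beta (last l.1.1.1 l.1.1.2))]]].
Proof.
elim: reqs => [|r reqs IH] near_reqs cnt; first by exists [::].
have [||L [eL uL LP]] := IH.
- by move=> r' r'r; apply: near_reqs; rewrite inE r'r orbT.
- move=> b; apply: leq_trans (cnt b); rewrite leq_add2r leq_mul2r /=.
  by rewrite leq_addl orbT.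
pose b := beta (last r.1.1 r.1.2).
pose Lb := [seq l <- L | conf b (beta (last l.1.1.1 l.1.1.2))].
pose F := F0 :|: [set x | x \in flatten (map snd Lb)].
have cF : #|F| <= f0.
  apply: leq_trans (leq_card_setU _ _) _; rewrite addnC; apply: leq_trans (cnt b).
  rewrite leq_add2r; apply: leq_trans (card_set_mem_seq _) _.
  have -> : size (flatten (map snd Lb)) = size Lb * N.
    have : forall l, l \in Lb -> size l.2 = N.
      by move=> l; rewrite mem_filter => /andP[_ /LP[]].
    elim: (Lb) => //= l l' IHl h; rewrite size_cat h ?mem_head // IHl //.
    by move=> k kl; apply: h; rewrite inE kl orbT.
  rewrite leq_mul2r; apply/orP; right.
  rewrite size_filter /= -eL count_map; apply: leq_trans (leq_addl _ _).
  exact: leqnn.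
have [q [sq pq uq qP]] := link (near_reqs _ (mem_head _ _)) cF.
exists ((r, q) :: L); split=> /=; first by rewrite eL.
- rewrite cat_uniq uq uL andbT /=; apply/hasPn => x /flatten_mapP[l lL xl].
  apply/negP => xq; have [_ xF xr] := qP _ xq.
  have [_ _ /(_ _ xl)[_ _ xr']] := LP _ lL.
  move/negP: xF; apply; rewrite !inE; apply/orP; right.
  apply/flatten_mapP; exists l => //; rewrite mem_filter lL andbT.
  exact: reg_conf xr xr'.
- move=> l; rewrite inE => /orP[/eqP->|/LP//]; split=> //= x /qP[xZ xF xr].
  by split=> //; move: xF; rewrite inE negb_or => /andP[].
Qed.

Variable E : nat.
Hypothesis special_link : forall (u u' : V) (F : {set V}) (e : nat),
  near (beta u) (beta u') -> #|F| <= f0 -> e <= E ->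
  exists q : seq V, [/\ size q = N + e, path H u (rcons q u'), uniq q &
    forall x, x \in q -> x \in Z /\ x \notin F].

(** The special link comes first and is forbidden to all others, which makes up for its having no
    region. So is [v], the only vertex of the items that may lie in [Z]. *)
Lemma closed_chain (its : seq item) (v : V) (e : nat) :
  cycle inear its -> its != [::] ->
  (forall a, a \in its -> path H a.1 a.2) ->
  uniq (flatten (map verts its)) ->
  (forall x, x \in flatten (map verts its) -> x \in Z -> x = v) ->
  e <= E ->
  (forall b, count (fun a => conf b (beta (last a.1 a.2))) its * N + (N + e).+1 <= f0) ->
  exists c : seq V, [/\ cycle H c, uniq c,
    size c = size (flatten (map verts its)) + size its * N + e &
    {subset flatten (map verts its) <= c}].
Proof.
case: its => [//|x s] cyc _ paths uits itsZ le_e cnt.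
pose reqs := zip (x :: s) (rcons s x).
have reqs1 : [seq r.1 | r <- reqs] = x :: s.
  by apply: unzip1_zip; rewrite size_rcons.
have near_reqs : forall r, r \in reqs -> inear r.1 r.2.
  move: cyc; rewrite /cycle /reqs; move: {2 4}x => y.
  elim: s x {paths uits itsZ cnt reqs reqs1} => [|z s IH] x /=.
    by rewrite andbT => h r; rewrite inE => /eqP ->.
  by move=> /andP[h /IH h'] r; rewrite inE => /orP[/eqP->|/h'].
case reqsE : reqs reqs1 near_reqs => [|r reqs'] //= [rx reqs's] near_reqs.
have [|q0 [sq0 pq0 uq0 q0P]] :=
    special_link (F := [set v]) (near_reqs r (mem_head _ _)) _ le_e.
  rewrite cards1; apply: leq_trans (cnt (beta v)); rewrite addnS; exact: ltn0Sn.
pose F0 := v |: [set y | y \in q0].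
have cF0 : #|F0| <= (N + e).+1.
  rewrite cardsU1 -add1n leq_add ?leq_b1 // -sq0; exact: card_set_mem_seq.
have [||L [eL uL LP]] := @greedy_links F0 reqs'.
- by move=> r' r'r; apply: near_reqs; rewrite inE r'r orbT.
- move=> b; apply: leq_trans (cnt b); apply: leq_add => //.
  rewrite leq_mul2r; apply/orP; right => /=; rewrite -reqs's count_map.
  exact: leq_addl.
pose L0 := (r, q0) :: L.
have LE : [seq l.1.1 | l <- L0] = x :: s.
  by rewrite /= rx -reqs's -eL -map_comp.
have [||t tE pt] := @join_links x x s L0.
- by rewrite /= eL -reqsE.
- move=> l lL; split.
    by apply: paths; rewrite -LE; apply: (map_f (fun l => l.1.1)).
  by move: lL; rewrite inE => /orP[/eqP->//|/LP[]].
have qsZ y : y \in flatten (map snd L0) -> y \in Z /\ y != v.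
  rewrite /= mem_cat => /orP[/q0P[? ?]|/flatten_mapP[l /LP[_ _ h] /h[? yF _]]].
    by split=> //; rewrite -in_set1.
  by split=> //; move: yF; rewrite in_setU1 negb_or => /andP[].
have pe := perm_flatten_cat (fun l : item * item * seq V => verts l.1.1) snd L0.
have eV : flatten [seq verts l.1.1 | l <- L0] = flatten (map verts (x :: s)).
  by rewrite -LE -map_comp.
exists (x.1 :: t); split.
- exact: pt.
- rewrite -tE (perm_uniq pe) cat_uniq eV uits /=; apply/andP; split.
    apply/hasPn => y /qsZ[yZ yv]; apply/negP => /itsZ /(_ yZ) yv'.
    by rewrite yv' eqxx in yv.
  rewrite cat_uniq uq0 uL andbT /=; apply/hasPn => y /flatten_mapP[l /LP[_ _ h] /h[_ yF _]].
  by move: yF; rewrite !inE negb_or => /andP[].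
- rewrite -tE (perm_size pe) size_cat eV -addnA; congr (_ + _).
  have sL : size s = size L by move: (congr1 size LE) => /= []; rewrite !size_map => ->.
  rewrite /= size_cat sq0 sL mulSn.
  have -> : size (flatten (map snd L)) = size L * N.
    elim: L LP {eL uL L0 pt tE LE qsZ pe eV sL} => //= l L IH h.
    rewrite size_cat IH ?mulSn; last by move=> k kL; apply: h; rewrite inE kL orbT.
    by have [-> _ _] := h l (mem_head _ _).
  by rewrite addnAC.
- by move=> y yits; rewrite -tE (perm_mem pe) mem_cat eV yits.
Qed.
End Assembly.

Lemma subseq_flatten (T : eqType) (s1 s2 : seq (seq T)) :
  subseq s1 s2 -> subseq (flatten s1) (flatten s2).
Proof.
elim: s2 s1 => [|y s2 IH] [|x s1] //=; first by rewrite sub0seq.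
by case: eqP => [->|_] /IH h; [exact: cat_subseq|apply: subseq_trans h (suffix_subseq _ _)].
Qed.

Lemma sub_in_count (T : eqType) (a b : pred T) (s : seq T) :
  (forall x, x \in s -> a x -> b x) -> count a s <= count b s.
Proof.
elim: s => //= x s IH ab; apply: leq_add; last first.
  by apply: IH => y ys; apply: ab; rewrite inE ys orbT.
by have := ab x (mem_head _ _); case: (a x) => // ->.
Qed.

Section CycleLengths.
Variables (V B : finType) (H : rel V) (beta : V -> B) (near conf : rel B).
Variables (Z : {set V}) (reg avail : B -> {set V}) (N f0 E g0 g1 q0 K : nat).
Hypotheses (near_refl : reflexive near) (near_sym : symmetric near).
Hypothesis near_deg : forall b, #|[set b' | near b b']| <= g0.
Hypothesis near_conn : forall A : {set B}, A != set0 -> A != setT ->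
  exists a b, [/\ a \in A, b \notin A & near a b].
Hypothesis reg_conf : forall b b' x, x \in reg b -> x \in reg b' -> conf b b'.
Hypothesis conf_deg : forall b, #|[set b' | conf b b']| <= g1.
Hypothesis link : forall (u u' : V) (F : {set V}),
  near (beta u) (beta u') -> #|F| <= f0 ->
  exists q : seq V, [/\ size q = N, path H u (rcons q u'), uniq q &
    forall x, x \in q -> [/\ x \in Z, x \notin F & x \in reg (beta u)]].
Hypothesis special_link : forall (u u' : V) (F : {set V}) (e : nat),
  near (beta u) (beta u') -> #|F| <= f0 -> e <= E ->
  exists q : seq V, [/\ size q = N + e, path H u (rcons q u'), uniq q &
    forall x, x \in q -> x \in Z /\ x \notin F].
Hypothesis avail_beta : forall b x, x \in avail b -> beta x = b.
Hypothesis avail_Z : forall b x, x \in avail b -> x \notin Z.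
Hypothesis avail_card : forall b, g0.+1 < #|avail b|.
Hypothesis K_gt0 : 0 < K.
Hypothesis E_big : K + N <= E /\ (N.+1).*2 <= E.
Hypothesis f0_big : g1 * (q0 + g0.+1) * N + (N + E).+1 <= f0.

(* A tour of t blocks has 2t - 1 anchors, each followed by N linking vertices;
   each inserted path adds K + N vertices; one special link absorbs the
   remainder. *)
Lemma cycle_of_length (Ps : seq (seq V)) (v : V) (L : nat) :
  (forall P, P \in Ps -> [/\ size P = K, sorted H P,
      forall x y, x \in P -> y \in P -> beta x = beta y &
      forall x, x \in P -> x \notin Z /\ forall b, x \notin avail b]) ->
  uniq (flatten Ps) ->
  (forall b, count (fun P => has (fun x => beta x == b) P) Ps <= q0) ->
  N < L -> L <= (#|B|.*2.-1) * N.+1 + (size Ps).-1 * (K + N) ->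
  exists c : seq V, [/\ cycle H c, uniq c, size c = L & v \in c].
Proof.
move=> PsP uPs cPs ltL leL.
(* The tour starts at [v], which may itself be available; hence [avail b] has one vertex more than
   [block_tour] asks for. *)
pose avail' b := avail b :\ v.
have B0 : 0 < #|B| by apply/card_gt0P; exists (beta v).
have tourP t : 0 < t <= #|B| -> exists s : seq V,
    [/\ uniq s, v \in s, (forall x, x \in s -> x = v \/ x \in avail (beta x)),
        size s = t.*2.-1 & cycle (fun x y => near (beta x) (beta y)) s] /\
    (#|[set b | has (fun x => beta x == b) s]| = t /\
     forall b, count (fun x => beta x == b) s <= g0.+1).
  have h1 b x : x \in avail' b -> beta x = b.
    by rewrite in_setD1 => /andP[_ /avail_beta].
  have h2 b : v \notin avail' b by rewrite !inE eqxx.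
  have h3 b : g0 < #|avail' b|.
    have := avail_card b; rewrite (cardsD1 v (avail b)) -/(avail' b).
    by case: (v \in _); rewrite ?add0n ?add1n // => /ltnW.
  move=> tB; have [s [[s1 s2 s3 s4 s5] s6]] :=
      block_tour near_refl near_sym h1 h2 near_deg h3 near_conn tB.
  exists s; split=> //; split=> // x /s3[->|]; first by left.
  by rewrite in_setD1 => /andP[_]; right.
pose verts (a : V * seq V) := a.1 :: a.2.
pose inear (a b : V * seq V) := near (beta (last a.1 a.2)) (beta b.1).
have conf_count (T : eqType) (h : T -> B) (s : seq T) m b :
    (forall b', count (fun a => h a == b') s <= m) ->
    count (fun a => conf b (h a)) s <= g1 * m.
  move=> cm; apply: leq_trans (_ : \sum_(b' in [set b' | conf b b']) m <= _).
    apply: leq_trans (_ : \sum_(b' in [set b' | conf b b'])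
        count (fun a => h a == b') s <= _); last by apply: leq_sum => b' _; exact: cm.
    elim: (s) => [|a l IH] /=; first by rewrite big1.
    rewrite big_split /= leq_add //; case ca: (conf b (h a)) => //.
    by rewrite (bigD1 (h a)) ?inE //= eqxx.
  by rewrite sum_nat_const leq_mul2r conf_deg orbT.
(* Common end of both cases: a tour [s], inserted paths [Qs], and a remainder [e] for the special
   link. *)
have finish (s : seq V) (Qs : seq (seq V)) e :
    uniq s -> v \in s -> (forall x, x \in s -> x = v \/ x \in avail (beta x)) ->
    cycle (fun x y => near (beta x) (beta y)) s ->
    (forall b, count (fun x => beta x == b) s <= g0.+1) ->
    (forall b, count (fun P => has (fun x => beta x == b) P) Qs <= q0) ->
    (forall Q, Q \in Qs -> [/\ Q \in Ps, v \notin Q &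
        forall x, x \in Q -> exists2 y, y \in s & beta y = beta x]) ->
    uniq (flatten Qs) -> e <= E ->
    L = size s * N.+1 + size Qs * (K + N) + e ->
    exists c : seq V, [/\ cycle H c, uniq c, size c = L & v \in c].
  move=> us vs sav cs cnts cntQ QsP uQ eE Lval.
  pose its0 := [seq (x, [::] : seq V) | x <- s].
  pose mk (P : seq V) := (head v P, behead P).
  have mkK Q : Q \in Qs -> verts (mk Q) = Q.
    by move=> /QsP[/PsP[sQ _ _ _] _ _]; case: Q sQ => // sK; move: K_gt0; rewrite -sK.
  have cyc0 : cycle inear its0.
    rewrite /its0; case: (s) cs => // x l; rewrite /= -map_rcons => h.
    by rewrite path_map.
  have vertsE Q : Q \in Qs -> last (mk Q).1 (mk Q).2 \in Q /\ (mk Q).1 \in Q.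
    by move=> /mkK QE; split; rewrite -[X in _ \in X]QE; [exact: mem_last|exact: mem_head].
  have [|its pe cyc] := insert_items near_refl (Qs := map mk Qs) cyc0.
    move=> _ /mapP[Q QQ ->]; have [QPs _ Qs'] := QsP _ QQ.
    have [lQ hQ] := vertsE _ QQ; have [_ _ Qb _] := PsP _ QPs.
    split; first exact: Qb.
    have [y ys yb] := Qs' _ hQ; exists (y, [::]) => //.
    by apply/mapP; exists y.
  have peV : perm_eq (flatten (map verts its)) (s ++ flatten Qs).
    apply: perm_trans (perm_flatten (perm_map verts pe)) _.
    rewrite map_cat flatten_cat.
    have -> : flatten (map verts its0) = s by rewrite /its0 -map_comp; exact: flatten_seq1.
    have -> // : flatten (map verts (map mk Qs)) = flatten Qs.
    by congr flatten; rewrite -map_comp -[RHS]map_id; apply/eq_in_map => Q /mkK.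
  have Qsub x : x \in flatten Qs -> x \notin s.
    move=> /flattenP[Q QQ xQ]; apply/negP => /sav xs.
    have [QPs vQ _] := QsP _ QQ; have [_ _ _ /(_ _ xQ)[_ av]] := PsP _ QPs.
    case: xs => [xv|xa]; first by rewrite -xv xQ in vQ.
    by have := av (beta x); rewrite xa.
  have [||||||c [c1 c2 c3 c4]] :=
    @closed_chain V B H beta near conf Z reg N f0 reg_conf link E special_link its v e cyc.
  - apply: contraTneq vs => its0'; rewrite its0' /= in peV.
    have := perm_mem peV v; rewrite in_nil mem_cat => /esym/negbT.
    by rewrite negb_or => /andP[].
  - move=> a; rewrite (perm_mem pe) mem_cat => /orP[/mapP[x _ ->]//|/mapP[Q QQ ->]].
    have [/PsP[_ sQ _ _] _ _] := QsP _ QQ.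
    by move: sQ; rewrite -{1}(mkK _ QQ).
  - rewrite (perm_uniq peV) cat_uniq us uQ andbT /=.
    by apply/hasPn => x /Qsub.
  - move=> x; rewrite (perm_mem peV) mem_cat => /orP[/sav[//|/avail_Z/negP//]|].
    move=> /flattenP[Q QQ xQ] xZ; have [QPs vQ _] := QsP _ QQ.
    by have [_ _ _ /(_ _ xQ)[/negP]] := PsP _ QPs.
  - exact: eE.
  - move=> b; apply: leq_trans f0_big; rewrite leq_add ?ltnS ?leq_add2l //.
    rewrite leq_mul2r; apply/orP; right.
    apply: (conf_count _ (fun a : V * seq V => beta (last a.1 a.2))) => b'.
    rewrite (permP pe) count_cat addnC leq_add //.
      rewrite count_map; apply: leq_trans (cntQ b'); apply: sub_in_count => Q QQ hb.
      by apply/hasP; exists (last (head v Q) (behead Q)) => //; have [] := vertsE _ QQ.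
    by rewrite count_map; exact: cnts.
  exists c; split=> //.
    rewrite c3 (perm_size peV) size_cat (perm_size pe) size_cat !size_map Lval.
    have -> : size (flatten Qs) = size Qs * K.
      elim: (Qs) QsP => //= Q l IH h; rewrite size_cat IH; last first.
        by move=> Q' Q'l; apply: h; rewrite inE Q'l orbT.
      by have [/PsP[-> _ _ _] _ _] := h Q (mem_head _ _).
    by rewrite mulnS mulnDr mulnDl addnACA.
  by apply: c4; rewrite (perm_mem peV) mem_cat vs.
have [small|big] := ltnP L (#|B|.*2.-1 * N.+1).
  (* Short cycles take no path. Here [t.*2.-1] is the largest odd number up to [L %/ N.+1], so the
     remainder is below [N.+1.*2]. *)
  pose t := (L %/ N.+1).+1./2.
  have tB : 0 < t <= #|B|.
    have q1 : 1 <= L %/ N.+1 by rewrite divn_gt0.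
    move: q1.
    have : L %/ N.+1 < #|B|.*2.-1 by rewrite ltn_divLR.
    rewrite /t; move: (L %/ N.+1) (#|B|); clear; lia.
  have tL : t.*2.-1 * N.+1 <= L.
    apply: leq_trans (leq_trunc_div L N.+1); rewrite leq_mul2r; apply/orP; right.
    have : 1 <= L %/ N.+1 by rewrite divn_gt0.
    by rewrite /t; move: (L %/ N.+1); clear; lia.
  have Lt : L < t.*2.-1 * N.+1 + N.+1.*2.
    apply: leq_trans (ltn_ceil L (ltn0Sn N)) _.
    have : (L %/ N.+1).+1 <= t.*2.-1 + 2 by rewrite /t; move: (L %/ N.+1); clear; lia.
    by rewrite -(leq_pmul2r (ltn0Sn N)) mulnDl [2 * _]mul2n.
  have [s [[s1 s2 s3 s4 s5] [s6 s7]]] := tourP t tB.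
  apply: (finish s [::] (L - t.*2.-1 * N.+1)) => //=.
  - apply: leq_trans (proj2 E_big); move: Lt tL; clear; lia.
  - by rewrite s4 addn0 addnC subnK.
(* Long cycles visit every block, so each path finds an anchor in its own block. *)
have [|s [[s1 s2 s3 s4 s5] [s6 s7]]] := tourP #|B|; first by rewrite B0 /=.
pose rest := L - #|B|.*2.-1 * N.+1.
(* The paths are disjoint, so at most one contains [v]; this is the predecessor in the bound on
   [L]. *)
pose Ps' := [seq P <- Ps | v \notin P].
pose j := rest %/ (K + N).
have KN0 : 0 < K + N by rewrite addn_gt0 K_gt0.
have szPs' : (size Ps).-1 <= size Ps'.
  rewrite size_filter; pose a P := v \in (P : seq V).
  rewrite -[count _ _]/(count (predC a) Ps).
  have := count_predC a Ps.
  have : count a Ps <= 1; last first.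
    by move: (count _ _) (count _ _) (size _); clear; lia.
  have := count_uniq_mem v uPs; rewrite count_flatten => cv.
  have : sumn (map (count_mem v) Ps) <= 1 by rewrite cv leq_b1.
  apply: leq_trans; elim: (Ps) => //= P l IH; apply: leq_add IH.
  by rewrite /a -has_pred1 has_count; case: (count _ P).
have jPs : j <= size Ps'.
  apply: leq_trans szPs'; rewrite /j -(leq_pmul2r KN0).
  apply: leq_trans (leq_trunc_div _ _) _; rewrite /rest leq_subLR; exact: leL.
have subPs Q : Q \in take j Ps' -> Q \in Ps /\ v \notin Q.
  by move=> /mem_take; rewrite mem_filter => /andP[].
apply: (finish s (take j Ps') (rest %% (K + N))) => //.
- move=> b; apply: leq_trans (cPs b).
  apply: leq_count_subseq; apply: subseq_trans (take_subseq _ _) _.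
  exact: filter_subseq.
- move=> Q /subPs[QPs vQ]; split=> // x xQ.
  have : beta x \in [set b | has (fun x => beta x == b) s].
    suff -> : [set b | has (fun x => beta x == b) s] = setT by rewrite inE.
    by apply/eqP; rewrite eqEcard subsetT cardsT s6 /=.
  by rewrite inE => /hasP[y ys /eqP yx]; exists y.
- have uf : subseq (flatten (take j Ps')) (flatten Ps).
    have : subseq (take j Ps') Ps.
      by apply: subseq_trans (take_subseq _ _) (filter_subseq _ _).
    exact: subseq_flatten.
  exact: subseq_uniq uf uPs.
- apply: leq_trans (proj1 E_big); exact: ltnW (ltn_pmod _ KN0).
- rewrite s4 size_takel // -addnA -divn_eq /rest addnC subnK //.
Qed.
End CycleLengths.

(** * Links in the grid of cells *)

Section Grid.
Variables (d m : nat).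
Implicit Types a b c : {ffun 'I_d -> 'I_m}.

(** Sup distance, written with sums to avoid truncated subtraction. *)
Definition close (l : nat) a b : bool :=
  [forall k, (a k <= b k + l) && (b k <= a k + l)].

Lemma closeP l a b :
  reflect (forall k, a k <= b k + l /\ b k <= a k + l) (close l a b).
Proof.
by apply: (iffP forallP) => h k; [move: (h k) => /andP|apply/andP].
Qed.

Lemma close_refl l a : close l a a.
Proof. by apply/closeP => k; rewrite leq_addr. Qed.

Lemma close_sym l a b : close l a b = close l b a.
Proof. by apply: eq_forallb => k; rewrite andbC. Qed.

Lemma close_trans l l' a b c : close l a b -> close l' b c -> close (l + l') a c.
Proof.
move=> /closeP h /closeP h'; apply/closeP => k; move: (h k) (h' k).
clear; lia.
Qed.

Lemma close_mono l l' a b : l <= l' -> close l a b -> close l' a b.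
Proof. by move=> le /closeP h; apply/closeP => k; move: (h k) le; clear; lia. Qed.

Lemma close0 a b : close 0 a b -> a = b.
Proof.
move=> /closeP h; apply/ffunP => k; apply: val_inj => /=; move: (h k).
clear; lia.
Qed.

Lemma close_step l a b : close l.+1 a b -> exists2 c, close 1 a c & close l c b.
Proof.
move=> /closeP h.
pose s k : nat := if a k < b k then (a k).+1 else if b k < a k then (a k).-1 else a k.
have sm k : s k < m.
  rewrite /s; case: (ltnP (a k) (b k)) => [h1|_]; first exact: leq_ltn_trans h1 (ltn_ord _).
  by case: ifP => _; [exact: leq_ltn_trans (leq_pred _) (ltn_ord _)|exact: ltn_ord].
exists [ffun k => Ordinal (sm k)]; apply/closeP => k; rewrite ffunE /= /s.
  by clear; case: (ltnP (a k) (b k)); [|case: (ltnP (b k) (a k))]; lia.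
by move: (h k); clear; case: (ltnP (a k) (b k)); [|case: (ltnP (b k) (a k))]; lia.
Qed.

Lemma close_connected (A : {set {ffun 'I_d -> 'I_m}}) :
  A != set0 -> A != setT -> exists a b, [/\ a \in A, b \notin A & close 1 a b].
Proof.
move=> /set0Pn[a aA] AT.
have [b bA] : exists b, b \notin A.
  apply/existsP; apply: contraR AT; rewrite negb_exists => /forallP h.
  by apply/eqP/setP => b; rewrite inE; apply/negPn/h.
have cl : close m a b.
  apply/closeP => k; split; apply: leq_trans (leq_addl _ _); exact: ltnW (ltn_ord _).
have main l a' : a' \in A -> close l a' b ->
    exists a b, [/\ a \in A, b \notin A & close 1 a b].
  elim: l a' => [|l IH] a' a'A; first by move=> /close0 ab; rewrite -ab a'A in bA.
  move=> /close_step[c ac cb]; case cA: (c \in A); first exact: IH cA cb.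
  by exists a', c; rewrite cA.
exact: main aA cl.
Qed.

Lemma card_close l a : #|[set b | close l a b]| <= (l.*2.+1) ^ d.
Proof.
pose f b : {ffun 'I_d -> 'I_l.*2.+1} := [ffun k => inord (b k + l - a k)].
have finj : {in [set b | close l a b] &, injective f}.
  move=> b b'; rewrite !inE => /closeP h /closeP h' /ffunP e; apply/ffunP => k.
  have := e k; rewrite !ffunE => /(congr1 val) /=.
  move: (h k) (h' k) => h1 h1'.
  rewrite !inordK; [|by move: h1'; clear; lia|by move: h1; clear; lia] => e'.
  by apply: val_inj => /=; move: e' h1 h1'; clear; lia.
rewrite -(card_in_imset finj); apply: leq_trans (max_card _) _.
by rewrite card_ffun !card_ord.
Qed.
End Grid.

Section Links.
Variables (V : finType) (H : rel V) (d S : nat) (cell : V -> {ffun 'I_d -> 'I_S}).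
Variables (Z : {set V}) (cap W : nat).
Hypothesis H_sym : symmetric H.
Hypothesis cell_Z : forall c, cap < #|[set x in Z | cell x == c]|.
Hypothesis common_Z : forall u u', close 1 (cell u) (cell u') ->
  cap < #|[set x in Z | H u x && H u' x]|.
Hypothesis H_close : forall x y, H x y -> close W (cell x) (cell y).

Lemma pick_notin (A F : {set V}) : #|F| < #|A| -> exists2 x, x \in A & x \notin F.
Proof.
move=> lt; apply/exists_inP; apply: contraT; rewrite negb_exists_in => /forall_inP h.
have : #|A| <= #|F| by apply: subset_leq_card; apply/subsetP => x /h /negPn.
by rewrite leqNgt lt.
Qed.

(** A step to an adjacent cell uses two internal vertices, a common neighbour and a vertex of the
    next cell; the last step needs only the common neighbour. Steps may also stand still, so [l]
    only has to be large enough. *)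
Lemma link_odd (l : nat) (u u' : V) (F : {set V}) :
  close l.+1 (cell u) (cell u') -> #|F| + l.*2 <= cap ->
  exists q : seq V, [/\ size q = l.*2.+1, path H u (rcons q u'), uniq q &
    forall x, x \in q -> [/\ x \in Z, x \notin F & close (l + W) (cell u) (cell x)]].
Proof.
elim: l u F => [|l IH] u F cl cF.
  have [|z] := @pick_notin [set x in Z | H u x && H u' x] F.
    by apply: leq_ltn_trans (common_Z cl); rewrite -[#|F|]addn0.
  rewrite !inE => /and3P[zZ uz u'z] zF; exists [:: z]; split=> //=.
    by rewrite uz H_sym u'z.
  by move=> x; rewrite inE => /eqP ->; split=> //; exact: H_close.
have [c uc cu'] := close_step cl.
have cF' : #|F| + 2 + l.*2 <= cap by move: cF; rewrite doubleS; clear; lia.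
have [|u1] := @pick_notin [set x in Z | cell x == c] F.
  by apply: leq_ltn_trans (cell_Z c); move: cF; clear; lia.
rewrite !inE => /andP[u1Z /eqP u1c] u1F.
have [|z] := @pick_notin [set x in Z | H u x && H u1 x] (u1 |: F).
  apply: leq_ltn_trans (common_Z _); last by rewrite u1c.
  by rewrite cardsU1 u1F; move: cF'; clear; lia.
rewrite !inE negb_or => /and3P[zZ uz u1z] /andP[zu1 zF].
have [||q [sq pq uq qP]] := IH u1 (z |: (u1 |: F)).
- by rewrite u1c.
- rewrite !cardsU1 u1F !inE negb_or zu1 zF; move: cF'; clear; lia.
exists [:: z, u1 & q]; split.
- by rewrite /= sq doubleS.
- by rewrite /= uz H_sym u1z.
- rewrite /= uq andbT inE negb_or zu1 /=; apply/andP; split; apply/negP => /qP[_].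
    by rewrite !inE eqxx.
  by rewrite !inE eqxx orbT.
- move=> x; rewrite !inE => /or3P[/eqP->|/eqP->|/qP[xZ xF xc]].
  + by split=> //; apply: close_mono (H_close uz); rewrite leq_addl.
  + by split=> //; rewrite u1c; apply: close_mono uc.
  + move: xF; rewrite !inE !negb_or => /and3P[_ _ xF]; split=> //.
    by rewrite addSn -add1n; apply: close_trans xc; rewrite u1c.
Qed.

(* For even numbers of internal vertices the link runs through an edge xy of H
   with x in the cell of u: the cell-to-cell distance of x and y is irrelevant. *)
Lemma link_any (T e : nat) (u u' : V) (F : {set V}) :
  0 < T -> W <= T ->
  close T.*2 (cell u) (cell u') -> #|F| + (6 * T + 1 + e) <= cap ->
  exists q : seq V, [/\ size q = 6 * T + 1 + e, path H u (rcons q u'), uniq q &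
    forall x, x \in q -> [/\ x \in Z, x \notin F &
      e = 0 -> close (4 * T) (cell u) (cell x)]].
Proof.
move=> T0 WT cl cF; case eo: (odd e); last first.
  have e2 : e./2.*2 = e by rewrite -[RHS]odd_double_half eo.
  (* The cells are at most [2 * T] apart; [3 * T] steps are provided because for odd [e] the walk
     starts up to [W <= T] away from [u]. This is the origin of [6 * T + 1]. *)
  have [||q [sq pq uq qP]] := @link_odd (3 * T + e./2) u u' F.
  - by apply: close_mono cl; clear; lia.
  - by move: cF; rewrite -{1}e2; clear; lia.
  exists q; split=> //; first by rewrite sq -{2}e2; clear; lia.
  move=> x /qP[xZ xF xc]; split=> // e0; apply: close_mono xc.
  by rewrite e0; move: WT; clear; lia.
have e2 : e = e./2.*2.+1 by rewrite -[LHS]odd_double_half eo.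
set h := e./2 in e2; have {}cF : #|F| + (6 * T + 2 + h.*2) <= cap.
  by move: cF; rewrite e2; clear; lia.
have [|x] := @pick_notin [set x in Z | cell x == cell u] F.
  by apply: leq_ltn_trans (cell_Z _); move: cF; clear; lia.
rewrite !inE => /andP[xZ /eqP xu] xF.
have cF1 : #|x |: F| <= #|F|.+1 by rewrite cardsU1; case: (_ \notin _).
have cl1 : close 1 (cell u) (cell x) by rewrite xu close_refl.
have [|z] := @pick_notin [set y in Z | H u y && H x y] (x |: F).
  by apply: leq_ltn_trans (common_Z cl1); move: cF cF1; clear; lia.
rewrite !inE negb_or => /and3P[zZ uz xz] /andP[zx zF].
have cF2 : #|z |: (x |: F)| <= #|F|.+2 by rewrite cardsU1; move: cF1; case: (_ \notin _); clear; lia.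
have [|y] := @pick_notin [set y in Z | H x y && H x y] (z |: (x |: F)).
  apply: leq_ltn_trans (common_Z _); first by move: cF cF2 T0; clear; lia.
  exact: close_refl.
rewrite !inE andbb !negb_or => /andP[yZ xy] /and3P[yz yx yF].
(* Together with [z], [x], [y] this walk has [6 * T + 2 + h.*2] internal vertices, which is
   [6 * T + 1 + e]. *)
have [||q [sq pq uq qP]] := @link_odd (3 * T + h).-1 y u' (y |: (z |: (x |: F))).
- apply: (@close_mono _ _ (W + T.*2)); first by move: WT T0; clear; lia.
  by apply: close_trans cl; rewrite -xu close_sym; exact: H_close.
- rewrite cardsU1; move: cF cF2 T0; case: (_ \notin _); clear; lia.
exists [:: z, x, y & q]; split.
- by rewrite /= sq e2; move: T0; clear; lia.
- by rewrite /= uz H_sym xz xy.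
- rewrite /= uq andbT !inE !negb_or zx [z == y]eq_sym yz [x == y]eq_sym yx /=.
  by apply/and3P; split; apply/negP => /qP[_]; rewrite !inE eqxx ?orbT.
- move=> w wq; suff [? ?] : w \in Z /\ w \notin F by split=> // e0; rewrite e0 in eo.
  move: wq; rewrite !inE => /or4P[/eqP->|/eqP->|/eqP->|/qP[wZ wF _]] //.
  by split=> //; move: wF; rewrite !inE !negb_or => /and4P[].
Qed.
End Links.

(** * Lattice points in balls and shells *)

Definition absdiff (m n : nat) : nat := (m - n) + (n - m).

Lemma card_fibers (T U : finType) (A : {set T}) (f : T -> U) (m : nat) :
  (forall y, #|[set x in A | f x == y]| <= m) -> #|A| <= #|f @: A| * m.
Proof.
move=> fib; rewrite -sum1_card (partition_big_imset f) /=.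
rewrite -sum_nat_const; apply: leq_sum => y _; apply: leq_trans (fib y).
by rewrite -sum1_card; apply: eq_leq; apply: eq_bigl => x; rewrite inE.
Qed.

Lemma card_clustered (T : finType) (A : {set T}) (f : T -> nat) (w : nat) :
  {in A &, injective f} -> (forall x y, x \in A -> y \in A -> f x <= f y + w) ->
  #|A| <= w.+1.
Proof.
move=> finj fw; have [->|[x0 x0A]] := set_0Vmem A; first by rewrite cards0.
case: (arg_minnP f x0A) => x xA xmin.
pose g y : 'I_w.+1 := inord (f y - f x).
have gE y : y \in A -> g y = f y - f x :> nat.
  by move=> yA; rewrite inordK // ltnS leq_subLR addnC; rewrite addnC; apply: fw.
have ginj : {in A &, injective g}.
  move=> y z yA zA /(congr1 val) /=; rewrite !gE // => e; apply: finj => //.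
  by rewrite -(subnK (xmin _ yA)) -(subnK (xmin _ zA)) e.
by rewrite -(card_in_imset ginj) -[leqRHS]card_ord; exact: max_card.
Qed.

Lemma card_coord (d m : nat) (k : 'I_d) (P : {set 'I_m}) :
  #|[set g : {ffun 'I_d -> 'I_m} | g k \in P]| * m <= #|P| * m ^ d.
Proof.
pose A := [set g : {ffun 'I_d -> 'I_m} | g k \in P].
pose f (gi : {ffun 'I_d -> 'I_m} * 'I_m) :=
  (gi.1 k, [ffun j => if j == k then gi.2 else gi.1 j]).
have finj : {in setX A [set: 'I_m] &, injective f}.
  move=> [g i] [g' i'] _ _ [e1 /ffunP e2]; congr pair.
    apply/ffunP => j; have := e2 j; rewrite !ffunE /=.
    by case: eqP => [->|].
  by have := e2 k; rewrite !ffunE eqxx.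
have e1 : #|setX A [set: 'I_m]| = #|A| * m by rewrite cardsX cardsT card_ord.
have e2 : #|setX P [set: {ffun 'I_d -> 'I_m}]| = #|P| * m ^ d.
  by rewrite cardsX cardsT card_ffun !card_ord.
rewrite -/A -e1 -e2 -(card_in_imset finj).
apply: subset_leq_card; apply/subsetP => _ /imsetP[[g i] + ->].
by rewrite !inE /= => /andP[-> _].
Qed.

Section Lattice.
Variables (d S : nat).
Notation cellT := {ffun 'I_d -> 'I_S}.
Implicit Types a b c : cellT.

(** Squared Euclidean distance of cell indices, which stays in [nat]. *)
Definition qdist a c : nat := \sum_k absdiff (a k) (c k) ^ 2.

Lemma qdist_close (Y W : nat) a c : Y <= W ^ 2 -> qdist a c <= Y -> close W a c.
Proof.
move=> YW qY; apply/closeP => k.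
have : absdiff (a k) (c k) <= W.
  rewrite -(leq_exp2r _ _ (isT : 0 < 2)); apply: leq_trans (leq_trans qY YW).
  by rewrite /qdist (bigD1 k) //= leq_addr.
by rewrite /absdiff; clear; lia.
Qed.

Lemma qdist_step (W : nat) a b c : close 1 a b -> close W a c ->
  qdist b c <= qdist a c + d * (2 * W + 1).
Proof.
move=> /closeP ab /closeP ac.
apply: leq_trans (_ : \sum_(k < d) (absdiff (a k) (c k) ^ 2 + (2 * W + 1)) <= _).
  apply: leq_sum => k _; move: (ab k) (ac k).
  have : absdiff (b k) (c k) <= absdiff (a k) (c k) + absdiff (a k) (b k).
    by rewrite /absdiff; clear; lia.
  rewrite -!mulnn; rewrite /absdiff; move: (nat_of_ord _) (nat_of_ord _) (nat_of_ord _).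
  clear => x y z; nia.
by rewrite big_split /= sum_nat_const card_ord.
Qed.

(** Even at a corner of the cube one orthant remains: each coordinate moves by up to [h] in a
    direction that has room, as [2 * h < S]. *)
Lemma ball_card_lower (h X : nat) a : 2 * h < S -> d * h ^ 2 <= X ->
  h.+1 ^ d <= #|[set c | qdist a c <= X]|.
Proof.
move=> hS hX.
pose s (g : {ffun 'I_d -> 'I_h.+1}) k := if a k + h < S then a k + g k else a k - g k.
have gh (g : {ffun 'I_d -> 'I_h.+1}) k : g k <= h by rewrite -ltnS.
have sS g k : s g k < S.
  rewrite /s; case: ifP => [|_]; last exact: leq_ltn_trans (leq_subr _ _) (ltn_ord _).
  by apply: leq_ltn_trans; rewrite leq_add2l.
pose f g : cellT := [ffun k => Ordinal (sS g k)].
have finj : injective f.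
  move=> g g' /ffunP e; apply/ffunP => k; apply: val_inj => /=.
  have := congr1 val (e k); rewrite !ffunE /= /s; move: (gh g k) (gh g' k) hS (ltn_ord (a k)).
  by case: ifP; clear; lia.
have -> : h.+1 ^ d = #|{ffun 'I_d -> 'I_h.+1}| by rewrite card_ffun !card_ord.
rewrite -(card_imset _ finj); apply: subset_leq_card.
apply/subsetP => _ /imsetP[g _ ->]; rewrite inE; apply: leq_trans hX.
rewrite -[d in d * _]card_ord -sum_nat_const; apply: leq_sum => k _.
rewrite leq_exp2r // /f ffunE /= /absdiff /s; move: (gh g k).
by case: ifP; clear; lia.
Qed.

(** The translation taking [b] to [a] sends the ball around [b], possibly cut by the cube, into the
    ball around [a], which is not cut. *)
Lemma ball_card_translate (W Y : nat) a b : Y <= W ^ 2 ->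
  (forall k, W <= a k /\ a k + W < S) ->
  #|[set c | qdist b c <= Y]| <= #|[set c | qdist a c <= Y]|.
Proof.
move=> YW aW.
(* The default [a k] is never taken on the ball, where the translated index is in range. *)
pose f c : cellT := [ffun k => insubd (a k) (c k + a k - b k)].
have fE c k : qdist b c <= Y -> f c k = c k + a k - b k :> nat.
  move=> /(qdist_close YW)/closeP /(_ k) bc; rewrite ffunE val_insubd.
  by case: ifP => // /negbT; move: bc (aW k); clear; lia.
have finj : {in [set c | qdist b c <= Y] &, injective f}.
  move=> c c'; rewrite !inE => cY c'Y /ffunP e; apply/ffunP => k; apply: val_inj => /=.
  have := congr1 (@nat_of_ord _) (e k); rewrite !fE //.
  have /closeP/(_ k) := qdist_close YW cY; have /closeP/(_ k) := qdist_close YW c'Y.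
  by move: (aW k); clear; lia.
rewrite -(card_in_imset finj); apply: subset_leq_card.
apply/subsetP => _ /imsetP[c + ->]; rewrite !inE => cY; apply: leq_trans (cY).
apply: eq_leq; apply: eq_bigr => k _; rewrite fE //.
suff -> : absdiff (a k) (c k + a k - b k) = absdiff (b k) (c k) by [].
have /closeP/(_ k) := qdist_close YW cY.
move: (aW k); rewrite /absdiff.
by move: (nat_of_ord (a k)) (nat_of_ord (b k)) (nat_of_ord (c k)); clear; lia.
Qed.

(* A point of the shell has a coordinate at distance at least m0 from the
   centre, and on a line in that direction the squared distance grows with
   slope at least 2 m0, so each half-line meets the shell in w + 1 points. *)
Lemma shell_card (X Y W m0 w : nat) a :
  0 < d -> Y <= W ^ 2 -> d * m0 ^ 2 <= X -> 0 < m0 -> Y <= X + 2 * m0 * w ->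
  #|[set c | X <= qdist a c <= Y]| * (2 * W).+1 <=
    d * (2 * w.+1) * (2 * W).+1 ^ d.
Proof.
move=> d0 YW mX m00 YX.
pose Sh k := [set c | (X <= qdist a c <= Y) && (m0 <= absdiff (a k) (c k))].
have cover : [set c | X <= qdist a c <= Y] \subset \bigcup_k Sh k.
  apply/subsetP => c; rewrite inE => /andP[Xc cY].
  suff [k mk] : exists k, m0 <= absdiff (a k) (c k).
    by apply/bigcupP; exists k => //; rewrite inE Xc cY.
  apply/existsP; apply: contraT; rewrite negb_exists => /forallP small.
  suff : qdist a c + d <= d * m0 ^ 2 by move: mX Xc d0; clear; lia.
  have <- : \sum_(k < d) m0 ^ 2 = d * m0 ^ 2 by rewrite sum_nat_const card_ord.
  have {1}<- : \sum_(k < d) 1 = d by rewrite sum_nat_const card_ord muln1.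
  rewrite -big_split /=.
  apply: leq_sum => k _; move: (small k); rewrite -ltnNge -!mulnn; clear.
  by move: (absdiff _ _) => x; nia.
have Shk k : #|Sh k| * (2 * W).+1 <= (2 * w.+1) * (2 * W).+1 ^ d.
  (* Forgetting the coordinate [k] makes the fibres lines in that direction; the other coordinates
     are stored relative to [a] in a window of [2 * W + 1] values. *)
  pose f c : {ffun 'I_d -> 'I_(2 * W).+1} :=
    [ffun j => if j == k then ord0 else inord (c j + W - a j)].
  have cim : #|f @: Sh k| * (2 * W).+1 <= (2 * W).+1 ^ d.
    have := card_coord k [set ord0 : 'I_(2 * W).+1]; rewrite cards1 mul1n.
    apply: leq_trans; rewrite leq_mul2r; apply/orP; right.
    apply: subset_leq_card; apply/subsetP => _ /imsetP[c _ ->].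
    by rewrite !inE ffunE eqxx.
  suff cfib : #|Sh k| <= #|f @: Sh k| * (2 * w.+1).
    apply: leq_trans (_ : #|f @: Sh k| * (2 * w.+1) * (2 * W).+1 <= _).
      by rewrite leq_mul2r cfib orbT.
    by rewrite mulnAC [leqRHS]mulnC leq_mul2r cim orbT.
  apply: card_fibers => y.
  set F := [set c in Sh k | f c == y].
  have FP c : c \in F -> [/\ X <= qdist a c, qdist a c <= Y, m0 <= absdiff (a k) (c k) & f c = y].
    by rewrite !inE => /andP[/andP[/andP[? ?] ?] /eqP ?].
  have off c c' j : c \in F -> c' \in F -> j != k -> c j = c' j.
    move=> /FP[_ cY _ fc] /FP[_ c'Y _ fc'] jk; apply: val_inj => /=.
    have /ffunP/(_ j) : f c = f c' by rewrite fc fc'.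
    rewrite !ffunE (negbTE jk) => /(congr1 val) /=.
    have /closeP/(_ j) := qdist_close YW cY; have /closeP/(_ j) := qdist_close YW c'Y.
    move=> h1 h2; rewrite !inordK; [|by move: h1; clear; lia|by move: h2; clear; lia].
    by move: h1 h2; clear; lia.
  have kinj : {in F &, injective (fun c => nat_of_ord (c k))}.
    move=> c c' cF c'F /= e; apply/ffunP => j; have [->|jk] := eqVneq j k.
      exact: val_inj.
    exact: off.
  have sq c c' : c \in F -> c' \in F ->
      absdiff (a k) (c k) ^ 2 <= absdiff (a k) (c' k) ^ 2 + 2 * m0 * w.
    move=> cF c'F; have [_ cY _ _] := FP _ cF; have [Xc' _ _ _] := FP _ c'F.
    move: cY Xc'; rewrite /qdist (bigD1 k) //= [in X <= _](bigD1 k) //=.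
    rewrite [\sum_(i | i != k) absdiff (a i) (c' i) ^ 2](eq_bigr (fun i => absdiff (a i) (c i) ^ 2)).
      move: YX; move: (2 * m0 * w) (\sum_(_ | _) _) => p q.
      by move: (absdiff (a k) (c k) ^ 2) (absdiff (a k) (c' k) ^ 2); clear; lia.
    by move=> j jk; rewrite (off _ _ _ cF c'F jk).
  (* The two half-lines, on each of which the distance to [a k] is monotone. *)
  pose U := [set c : cellT | a k <= c k].
  rewrite -(cardsID U F) mul2n -addnn; apply: leq_add.
    apply: (@card_clustered _ _ (fun c => nat_of_ord (c k))).
      by move=> c c' /setIP[cF _] /setIP[c'F _]; exact: kinj.
    move=> c c' /setIP[cF cU] /setIP[c'F c'U]; move: cU c'U; rewrite !inE.
    have := sq c c' cF c'F; have [_ _ + _] := FP _ c'F; rewrite /absdiff -!mulnn.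
    move: (nat_of_ord _) (nat_of_ord _) (nat_of_ord _) m00; clear => x y' z m00 h1 h2 h3 h4.
    by rewrite leqNgt; apply/negP => h5; nia.
  apply: (@card_clustered _ _ (fun c => nat_of_ord (c k))).
    by move=> c c' /setDP[cF _] /setDP[c'F _]; exact: kinj.
  move=> c c' /setDP[cF cU] /setDP[c'F c'U]; move: cU c'U; rewrite !inE -!ltnNge.
  have := sq c' c c'F cF; have [_ _ + _] := FP _ cF; rewrite /absdiff -!mulnn.
  move: (nat_of_ord _) (nat_of_ord _) (nat_of_ord _) m00; clear => x y' z m00 h1 h2 h3 h4.
  by rewrite leqNgt; apply/negP => h5; nia.
apply: leq_trans (_ : (\sum_k #|Sh k|) * (2 * W).+1 <= _).
  rewrite leq_mul2r; apply/orP; right; apply: leq_trans (subset_leq_card cover) _.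
  by elim/big_rec2: _ => [|i n A _ le_n]; [rewrite cards0|
     apply: leq_trans (leq_card_setU _ _) _; rewrite leq_add2l].
rewrite big_distrl /= -[X in X * (2 * w.+1)]card_ord -mulnA -sum_nat_const.
by apply: leq_sum => k _; exact: Shk.
Qed.
End Lattice.

(** * Blocks of cells *)

Lemma leq_near_div (T l x y : nat) : 0 < T ->
  x %/ T <= y %/ T + l -> x <= y + l.+1 * T.
Proof.
move=> T0; have := divn_eq x T; have := divn_eq y T; have := ltn_pmod x T0.
by move: (x %/ T) (y %/ T) (x %% T) (y %% T); clear; nia.
Qed.

Lemma leq_div_near (T l x y : nat) : 0 < T ->
  x <= y + l * T -> x %/ T <= y %/ T + l.
Proof.
move=> T0 le; apply: leq_trans (leq_div2r T le) _.
by rewrite addnC divnMDl // addnC.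
Qed.

Lemma deep_div_le (T W x y : nat) : x %% T + W < T -> y <= x + W -> y %/ T <= x %/ T.
Proof.
move=> h1 h2; have T0 : 0 < T by apply: leq_ltn_trans h1.
have := divn_eq x T; have := divn_eq y T.
move: h1 h2; move: (x %/ T) (y %/ T) (x %% T) (y %% T); clear => q q' m m' *.
by rewrite leqNgt; apply/negP => lt; nia.
Qed.

Lemma deep_le_div (T W x y : nat) : 0 < T -> W <= x %% T -> x <= y + W -> x %/ T <= y %/ T.
Proof.
move=> T0 h1 h2; have := divn_eq x T; have := divn_eq y T; have := ltn_pmod y T0.
move: h1 h2; move: (x %/ T) (y %/ T) (x %% T) (y %% T); clear => q q' m m' *.
by rewrite leqNgt; apply/negP => lt; nia.
Qed.

Section Blocks.
Variables (d Bn T : nat).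
Notation S := (Bn * T).
Notation cellT := {ffun 'I_d -> 'I_S}.
Notation blockT := {ffun 'I_d -> 'I_Bn}.
Implicit Types a c : cellT.

Lemma block_side_gt0 (x : 'I_S) : 0 < T.
Proof.
have : 0 < S := leq_ltn_trans (leq0n _) (ltn_ord x).
by rewrite muln_gt0 => /andP[].
Qed.

Lemma ltn_block (x : 'I_S) : x %/ T < Bn.
Proof. by rewrite ltn_divLR ?ltn_ord // block_side_gt0. Qed.

Definition block a : blockT := [ffun k => Ordinal (ltn_block (a k))].

Lemma block_near a c : close 1 (block a) (block c) -> close (2 * T) a c.
Proof.
move=> /closeP h; apply/closeP => k; have := h k; rewrite !ffunE /=.
have T0 := block_side_gt0 (a k).
by move=> [h1 h2]; split; apply: leq_near_div.
Qed.

Lemma block_close l a c : close (l * T) a c -> close l (block a) (block c).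
Proof.
move=> /closeP h; apply/closeP => k; have := h k; rewrite !ffunE /=.
have T0 := block_side_gt0 (a k).
by move=> [h1 h2]; split; apply: leq_div_near.
Qed.

Variable W : nat.
(** So far from the faces of its block that an edge, which spans at most [W] cells in each
    direction, cannot leave the block. *)
Definition deep a := [forall k, (W <= a k %% T) && (a k %% T + W < T)].

Lemma deep_block a c : deep a -> close W a c -> block a = block c.
Proof.
move=> /forallP da /closeP h; apply/ffunP => k; apply: val_inj; rewrite !ffunE /=.
have T0 := block_side_gt0 (a k); have /andP[h1 h2] := da k; have [h3 h4] := h k.
apply/eqP; rewrite eqn_leq (deep_le_div T0 h1) //=.
exact: deep_div_le h2 h4.
Qed.

Lemma deep_inside a : deep a -> forall k, W <= a k /\ a k + W < S.
Proof.
move=> /forallP da k; have /andP[h1 h2] := da k; split.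
  by apply: leq_trans h1 (leq_mod _ _).
have := ltn_block (a k); have := divn_eq (a k) T; move: h2.
by move: (a k %/ T) (a k %% T) (nat_of_ord (a k)); clear; nia.
Qed.

(** In each of the [d] directions at most [2 * W] of the [T] residues are shallow; the bound is
    cross-multiplied. *)
Lemma card_not_deep : 0 < Bn -> 0 < T ->
  #|[set a | ~~ deep a]| * T <= d * (2 * W) * S ^ d.
Proof.
move=> B0 T0; pose P := [set x : 'I_S | ~~ ((W <= x %% T) && (x %% T + W < T))].
have cP : #|P| <= Bn * (2 * W).
  case: (posnP W) => [W0|W0].
    rewrite [P](_ : _ = set0) ?cards0 //; apply/setP => x; rewrite !inE W0 /= addn0.
    by rewrite ltn_pmod.
  have lt0 : 0 < 2 * W by move: W0; clear; lia.
  pose code (x : 'I_S) := if x %% T < W then x %% T else W + (T.-1 - x %% T).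
  have codeP x : x \in P -> code x < 2 * W.
    rewrite inE /code; move: (x %% T) (ltn_pmod x T0) => x'; clear.
    by case: (ltnP x' W) => /=; lia.
  pose f (x : 'I_S) : 'I_Bn * 'I_(2 * W) :=
    (Ordinal (ltn_block x), insubd (Ordinal lt0) (code x)).
  have finj : {in P &, injective f}.
    move=> x y xP yP [e1 /(congr1 val)]; rewrite !val_insubd !codeP // => e2.
    apply: val_inj; rewrite /= (divn_eq x T) (divn_eq y T) e1; congr (_ + _).
    move: e2 xP yP; rewrite !inE /code.
    move: (x %% T) (y %% T) (ltn_pmod x T0) (ltn_pmod y T0) => x' y'; clear.
    by case: (ltnP x' W); case: (ltnP y' W) => /=; lia.
  rewrite -(card_in_imset finj); apply: leq_trans (max_card _) _.
  by rewrite card_prod !card_ord.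
have sub : [set a | ~~ deep a] \subset \bigcup_k [set a : cellT | a k \in P].
  apply/subsetP => a; rewrite inE negb_forall => /existsP[k hk].
  by apply/bigcupP; exists k => //; rewrite !inE.
have ck k : #|[set a : cellT | a k \in P]| * T <= 2 * W * S ^ d.
  rewrite -(leq_pmul2l B0) mulnCA [leqRHS]mulnA; apply: leq_trans (card_coord k P) _.
  by rewrite leq_mul2r cP orbT.
apply: leq_trans (_ : (\sum_k #|[set a : cellT | a k \in P]|) * T <= _).
  rewrite leq_mul2r; apply/orP; right; apply: leq_trans (subset_leq_card sub) _.
  by elim/big_rec2: _ => [|i n A _ le_n]; [rewrite cards0|
     apply: leq_trans (leq_card_setU _ _) _; rewrite leq_add2l].
rewrite big_distrl /= -[X in X * (2 * W)]card_ord -mulnA -sum_nat_const.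
by apply: leq_sum => k _; exact: ck.
Qed.
End Blocks.

(** * Degrees and common neighbours *)

Section CellGraph.
Variables (R : realFieldType) (d Bn T W X X' Y h : nat).
Variables (V : finType) (cell : V -> {ffun 'I_d -> 'I_(Bn * T)}).
Variables (G H : rel V) (mu eta eps sigma : R).
Local Open Scope ring_scope.
Local Notation cellT := {ffun 'I_d -> 'I_(Bn * T)}.

Hypothesis eta01 : 0 <= eta <= 1.
Hypothesis mu0 : 0 <= mu.
Hypothesis cellP : forall c, (1 - eta) * mu <= #|[set v | cell v == c]|%:R <= (1 + eta) * mu.
Hypothesis G_near : forall u v, u != v -> (qdist (cell u) (cell v) <= X)%N -> G u v.
Hypothesis G_far : forall u v, G u v -> (qdist (cell u) (cell v) <= Y)%N.
Hypothesis YW : (Y <= W ^ 2)%N.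
Hypothesis X'X : (X' + d * (2 * W + 1) <= X.+1)%N.
Hypothesis shellP : forall a : cellT, #|[set c | X' <= qdist a c <= Y]%N|%:R <= sigma.
Hypothesis ballP : forall a : cellT, (h.+1 ^ d <= #|[set c | qdist a c <= X]%N|)%N.

Lemma card_preim_cells (A : {set cellT}) :
  (1 - eta) * mu * #|A|%:R <= #|[set v | cell v \in A]|%:R <= (1 + eta) * mu * #|A|%:R.
Proof.
have -> : #|[set v | cell v \in A]|%:R = \sum_(c in A) #|[set v | cell v == c]|%:R :> R.
  rewrite -natr_sum; congr (_%:R); rewrite -sum1_card (partition_big cell (mem A)) /=.
    apply: eq_bigr => c cA; rewrite -sum1_card; apply: eq_bigl => v.
    by rewrite !inE; case: eqP => [->|]; rewrite ?cA // andbF.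
  by move=> v; rewrite inE.
rewrite -[_ * _ * _ <= _]/(_ * _%:R <= _) !mulr_natr -!sumr_const.
by apply/andP; split; apply: ler_sum => c _; case/andP: (cellP c).
Qed.

Let NG u : {set V} := [set v | G u v].
Let NH u : {set V} := [set v | H u v].
Definition ball_max : nat := \max_(a : cellT) #|[set c | qdist a c <= Y]%N|.
Local Notation D := ((1 + eta) * mu * ball_max%:R).

Lemma cell_deg_le u : #|NG u|%:R <= D.
Proof.
have /andP[e0 _] := eta01.
have /andP[_ up] := card_preim_cells [set c | qdist (cell u) c <= Y]%N.
apply: le_trans (le_trans up _).
  rewrite ler_nat; apply: subset_leq_card; apply/subsetP => v.
  by rewrite !inE => /G_far.
rewrite ler_wpM2l ?mulr_ge0 ?addr_ge0 // ler_nat.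
exact: (leq_bigmax (F := fun a : cellT => #|[set c | qdist a c <= Y]%N|)).
Qed.

Lemma cell_deg_ge_ball u : (1 - eta) * mu * #|[set c | qdist (cell u) c <= X]%N|%:R - 1 <= #|NG u|%:R.
Proof.
have /andP[+ _] := card_preim_cells [set c | qdist (cell u) c <= X]%N.
set A := [set v | cell v \in _]; suff cA : (#|A| <= #|NG u| + 1)%N.
  have : #|A|%:R <= #|NG u|%:R + 1 :> R by rewrite natr1 -addn1 ler_nat.
  lra.
rewrite (cardsD1 u) addnC; apply: leq_add; last exact: leq_b1.
apply: subset_leq_card; apply/subsetP => v; rewrite !inE => /andP[vu vX].
by apply: G_near => //; rewrite eq_sym.
Qed.

Lemma cell_deg_ge u : (1 - eta) * mu * (h.+1 ^ d)%:R - 1 <= #|NG u|%:R.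
Proof.
apply: le_trans (cell_deg_ge_ball u); rewrite lerB // ler_wpM2l ?ler_nat //.
by have /andP[_ e1] := eta01; rewrite mulr_ge0 // subr_ge0.
Qed.

(** No ball is larger than the one around a deep cell, and passing from [Y] to [X] loses only a
    shell; the 1 is the vertex [u] itself. *)
Lemma cell_deg_deep u : deep W (cell u) ->
  (1 - eta) * mu * (ball_max%:R - sigma) - 1 <= #|NG u|%:R.
Proof.
move=> du; apply: le_trans (cell_deg_ge_ball u); rewrite lerB // ler_wpM2l //.
  by have /andP[_ e1] := eta01; rewrite mulr_ge0 // subr_ge0.
rewrite lerBlDr; apply: le_trans (lerD (lexx _) (shellP (cell u))).
rewrite -natrD ler_nat; apply: leq_trans (_ : #|[set c | qdist (cell u) c <= Y]%N| <= _)%N.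
  apply/bigmax_leqP => b _; exact: (@ball_card_translate _ _ W Y (cell u) b YW (deep_inside du)).
apply: leq_trans (leq_card_setU _ _); apply: subset_leq_card; apply/subsetP => c.
rewrite !inE => cY; rewrite cY andbT; case: leqP => //= Xc.
by move: X'X Xc; clear; lia.
Qed.

(** A vertex other than [u] that is adjacent to [u'] but not to [u] is beyond [X] from the cell of
    [u], hence by [X'X] at least [X'] from that of [u']: it lies in a shell. *)
Lemma cell_deg_diff u u' : close 1 (cell u) (cell u') ->
  #|NG u' :\: NG u|%:R <= (1 + eta) * mu * sigma + 1.
Proof.
move=> cl; have /andP[e0 e1] := eta01.
pose A := [set c | X' <= qdist (cell u') c <= Y]%N.
have cA : (#|NG u' :\: NG u| <= #|[set v | cell v \in A]| + 1)%N.
  rewrite (cardsD1 u) addnC; apply: leq_add; last exact: leq_b1.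
  apply: subset_leq_card; apply/subsetP => v; rewrite !inE => /and3P[vu nuv u'v].
  have vY := G_far u'v; rewrite vY andbT.
  have := @qdist_step _ _ W (cell u') (cell u) (cell v); rewrite close_sym => /(_ cl).
  move=> /(_ (qdist_close YW vY)).
  have : (X < qdist (cell u) (cell v))%N.
    by rewrite ltnNge; apply: contra nuv => /G_near; apply; rewrite eq_sym.
  by move: X'X; clear; lia.
have /andP[_ up] := card_preim_cells A.
have : #|NG u' :\: NG u|%:R <= #|[set v | cell v \in A]|%:R + 1 :> R.
  by rewrite natr1 -addn1 ler_nat.
have : (1 + eta) * mu * #|A|%:R <= (1 + eta) * mu * sigma.
  by apply: ler_wpM2l; [rewrite mulr_ge0 // addr_ge0|exact: shellP].
lra.
Qed.

Hypothesis HG : subrel H G.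
Hypothesis H_deg : forall v, (1 / 2 + eps) * #|NG v|%:R <= #|NH v|%:R.
Hypothesis eps01 : 0 < eps <= 1 / 2.

(** Both [H]-neighbourhoods fill more than half of nearly the same set, so they share about
    [2 * eps] of it. Only local degrees enter, hence this also holds next to the faces of the
    cube. *)
Lemma cell_common u u' : close 1 (cell u) (cell u') ->
  2 * eps * ((1 - eta) * mu * (h.+1 ^ d)%:R - 1) - 2 * ((1 + eta) * mu * sigma + 1) <=
  #|[set x | H u x && H u' x]|%:R.
Proof.
move=> cl; have cl' : close 1 (cell u') (cell u) by rewrite close_sym.
have d1 := cell_deg_diff cl; have d2 := cell_deg_diff cl'.
have /andP[ep0 ep1] := eps01.
have h1 : (#|NH u| + #|NH u'| <= #|[set x | H u x && H u' x]| + #|NG u| + #|NG u' :\: NG u|)%N.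
  rewrite -cardsUI addnC -addnA; apply: leq_add.
    by apply: subset_leq_card; apply/subsetP => v; rewrite !inE.
  apply: leq_trans (leq_card_setU _ _); apply: subset_leq_card; apply/subsetP => v.
  by rewrite !inE => /orP[/HG->//|/HG->]; rewrite andbT orbN.
have h2 : (#|NG u| <= #|NG u'| + #|NG u :\: NG u'|)%N.
  rewrite -(cardsID (NG u') (NG u)) leq_add2r subset_leq_card //.
  by apply: subsetIr.
have h3 : (1 / 2 + eps) * #|NG u|%:R <= (1 / 2 + eps) * (#|NG u'|%:R + #|NG u :\: NG u'|%:R) :> R.
  by rewrite ler_wpM2l -?natrD ?ler_nat //; lra.
move: h1; rewrite -(ler_nat R) !natrD => h1.
have h4 := H_deg u; have h5 := H_deg u'; have h6 := cell_deg_ge u.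
have h7 : eps * #|NG u|%:R >= eps * ((1 - eta) * mu * (h.+1 ^ d)%:R - 1).
  by rewrite ler_wpM2l // ltW.
have h8 : (1 / 2 + eps) * #|NG u :\: NG u'|%:R <= 1 * #|NG u :\: NG u'|%:R :> R.
  by rewrite ler_wpM2r //; lra.
lra.
Qed.

Lemma card_shallow : (0 < Bn)%N -> (0 < T)%N -> mu * ((Bn * T) ^ d)%:R = #|V|%:R ->
  #|[set v | ~~ deep W (cell v)]|%:R * T%:R <= (1 + eta) * (d * (2 * W))%:R * #|V|%:R.
Proof.
move=> B0 T0 muV; have /andP[e0 _] := eta01.
have /andP[_ up] := card_preim_cells [set a : cellT | ~~ deep W a].
have -> : [set v | ~~ deep W (cell v)] = [set v | cell v \in [set a : cellT | ~~ deep W a]].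
  by apply/setP => v; rewrite !inE.
apply: (@le_trans _ _ ((1 + eta) * mu * #|[set a : cellT | ~~ deep W a]|%:R * T%:R)).
  by rewrite ler_wpM2r.
have := card_not_deep d W B0 T0; rewrite -(ler_nat R) !natrM => h1.
rewrite -muV -!mulrA ler_wpM2l ?addr_ge0 //.
rewrite [leRHS](_ : _ = mu * (d%:R * (2 * W%:R) * ((Bn * T) ^ d)%:R)); last by ring.
by rewrite ler_wpM2l.
Qed.
End CellGraph.

Section BlockCells.
Variables (d Bn T : nat).
Hypothesis T0 : 0 < T.

Lemma block_surj (b : {ffun 'I_d -> 'I_Bn}) :
  exists a : {ffun 'I_d -> 'I_(Bn * T)}, block a = b.
Proof.
have lt k : b k * T < Bn * T by rewrite ltn_pmul2r.
exists [ffun k => Ordinal (lt k)]; apply/ffunP => k; apply: val_inj.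
by rewrite !ffunE /= mulnK.
Qed.

Lemma card_block (b : {ffun 'I_d -> 'I_Bn}) :
  #|[set a : {ffun 'I_d -> 'I_(Bn * T)} | block a == b]| <= T ^ d.
Proof.
pose f (a : {ffun 'I_d -> 'I_(Bn * T)}) : {ffun 'I_d -> 'I_T} :=
  [ffun k => Ordinal (ltn_pmod (a k) T0)].
have finj : {in [set a : {ffun 'I_d -> 'I_(Bn * T)} | block a == b] &, injective f}.
  move=> a a'; rewrite !inE => /eqP <- /eqP /ffunP e /ffunP e'.
  apply/ffunP => k; apply: val_inj; rewrite /= (divn_eq (a k) T) (divn_eq (a' k) T).
  have := e k; have := e' k; rewrite !ffunE => /(congr1 val) /= -> /(congr1 val) /= ->.
  by [].
by rewrite -(card_in_imset finj); apply: leq_trans (max_card _) _; rewrite card_ffun !card_ord.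
Qed.
End BlockCells.

Lemma path_const (V : eqType) (B : eqType) (e : rel V) (f : V -> B) (x : V) (s : seq V) :
  (forall u v, e u v -> f u = f v) -> path e x s -> forall y, y \in x :: s -> f y = f x.
Proof.
move=> ef; elim: s x => [|z s IH] x /=; first by move=> _ y; rewrite inE => /eqP ->.
move=> /andP[/ef fx /IH h] y; rewrite inE => /orP[/eqP->//|/h ->].
exact/esym.
Qed.

(** This is [layered_flow] with the error [t * (D / M)] of the colouring. Per unit of [Delta] the
    weight is at least [2 / 3 + eps / 8] of [#|V|], and only [2 / 3 + eps / 16] is asked for; the
    difference covers the errors. *)
Lemma colored_paths (R : realFieldType) (V : finType) (H W : rel V) (M K Delta kd p : nat)
    (g : V -> 'I_M) (eps D t : R) :
  (0 < eps <= 1 / 2)%R -> symmetric H -> subrel W H -> 1 < K <= M -> 0 < Delta ->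
  (forall u, #|[set v | W u v]| <= Delta) -> (forall v, #|[set u | W u v]| <= Delta) ->
  Delta * (#|V| - kd) <= \sum_u #|[set v | W u v]| ->
  (kd%:R <= #|V|%:R * (1 / 3 - 3 * eps / 20) + 1)%R ->
  (40 / eps <= #|V|%:R)%R -> (0 <= D)%R -> (0 <= t)%R ->
  (t * D <= eps / (1000 * M%:R) * Delta%:R)%R ->
  (p%:R * M%:R <= (2 / 3 + eps / 16) * #|V|%:R)%R ->
  (forall u c, `|#|[set v in [set v | W u v] | g v == c]|%:R -
      #|[set v | W u v]|%:R / M%:R| <= t * (D / M%:R))%R ->
  (forall u c, `|#|[set v in [set v | W v u] | g v == c]|%:R -
      #|[set v | W v u]|%:R / M%:R| <= t * (D / M%:R))%R ->
  exists Ps : seq (seq V),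
    [/\ p <= size Ps,
        forall P, P \in Ps -> [/\ size P = K, sorted H P &
                               forall x, x \in P -> g x < K] &
        uniq (flatten Ps)].
Proof.
move=> /andP[e0 e1] Hsym WH /andP[K1 KM] Delta0 Wo Wi Ws kdP nbig D0 t0 tD pM devo devi.
have M0 : (0 < M%:R :> R)%R by rewrite ltr0n; apply: leq_trans KM; apply: ltnW.
have M1 : (1 <= M%:R :> R)%R by rewrite ler1n -(ltr0n R).
have dl0 : (0 < Delta%:R :> R)%R by rewrite ltr0n.
have toset (P Q : pred V) :
  (#|[set v in [set v | P v] | Q v]|%:R = \sum_v (P v && Q v)%:R :> R)%R.
  by rewrite -card_set_sum; congr (_%:R)%R; apply: eq_card => v; rewrite !inE.
pose DR : R := (Delta%:R)%R; pose dev : R := (t * (D / M%:R))%R.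
have [|||||||||Ps [P1 P2 P3]] :=
  @layered_flow R V H W (fun v => g v) K.-1 M DR dev p Hsym WH; rewrite /DR /dev.
- by rewrite prednK // ltnW.
- by rewrite -ltnS prednK // ltnW.
- exact: dl0.
- by rewrite mulr_ge0 // divr_ge0 // ltW.
- by move=> u; rewrite -card_set_sum ler_nat.
- by move=> u; rewrite -card_set_sum ler_nat.
- move=> u i iM; have := devo u (Ordinal iM); rewrite toset card_set_sum.
  by rewrite /=; congr (`|_ - _| <= _)%R; apply: eq_bigr => v _.
- move=> u i iM; have := devi u (Ordinal iM); rewrite toset card_set_sum.
  by rewrite /=; congr (`|_ - _| <= _)%R; apply: eq_bigr => v _.
- set w := (\sum_u _)%R.
  have wE : (Delta%:R * (#|V|%:R - kd%:R) <= w)%R.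
    have -> : (w = (\sum_u #|[set v | W u v]|)%:R)%R.
      by rewrite natr_sum; apply: eq_bigr => u _; rewrite card_set_sum.
    apply: le_trans (_ : (Delta * (#|V| - kd))%:R <= _)%R; last by rewrite ler_nat.
    rewrite natrM ler_wpM2l // lerBlDr -natrD ler_nat; clear; lia.
  have n0 : (0 <= #|V|%:R :> R)%R by [].
  have n1 : (40 <= #|V|%:R * eps)%R by rewrite -ler_pdivrMr.
  (* The deficiency leaves [2 / 3 + 3 * eps / 20], and rounding [kd] costs 1, at most [eps / 40] of
     [#|V|]. *)
  have w2 : (Delta%:R * (#|V|%:R * (2 / 3 + eps / 8)) <= w)%R.
    by apply: le_trans wE; apply: ler_wpM2l; [exact: ltW|lra].
  have tau0 : (eps / (1000 * M%:R) <= eps / 1000)%R.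
    rewrite ler_pM2l // lef_pV2 ?posrE; lra.
  have dM : (t * (D / M%:R) * M%:R = t * D)%R by field; rewrite lt0r_neq0.
  rewrite -(ler_pM2r (exprn_gt0 2 M0)).
  have -> : ((2 * w / M%:R ^+ 2 - 8 * (t * (D / M%:R)) * #|V|%:R) * M%:R ^+ 2 =
     2 * w - 8 * (t * D) * M%:R * #|V|%:R)%R by field; rewrite lt0r_neq0.
  have -> : (p%:R * (2 * (Delta%:R / M%:R + t * (D / M%:R))) * M%:R ^+ 2 =
     2 * (p%:R * M%:R) * (Delta%:R + t * D))%R by field; rewrite lt0r_neq0.
  have a1 : (p%:R * M%:R * (Delta%:R + t * D) <=
     (2 / 3 + eps / 16) * #|V|%:R * (Delta%:R * (1 + eps / 1000)))%R.
    apply: ler_pM => //; first by rewrite mulr_ge0.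
      by rewrite addr_ge0 // mulr_ge0.
    have : (eps / (1000 * M%:R) * Delta%:R <= eps / 1000 * Delta%:R)%R by rewrite ler_wpM2r.
    lra.
  have a2 : (t * D * M%:R * #|V|%:R <= eps / 1000 * Delta%:R * #|V|%:R)%R.
    rewrite ler_wpM2r //; apply: le_trans (_ : eps / (1000 * M%:R) * Delta%:R * M%:R <= _)%R.
      by rewrite ler_wpM2r // ltW.
    by rewrite le_eqVlt; apply/orP; left; apply/eqP; field; rewrite lt0r_neq0.
  have a3 : (0 <= eps * (Delta%:R * #|V|%:R))%R by apply: mulr_ge0; [exact: ltW|exact: mulr_ge0].
  have a4 : (0 <= (1 / 2 - eps) * (eps * (Delta%:R * #|V|%:R)))%R.
    by apply: mulr_ge0; [lra|].
  move: w2 a1 a2 a3 a4; clear; lra.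
exists Ps; split=> // P /P2[sP sortP chiP]; split=> //.
  by rewrite sP prednK // ltnW.
by move=> x /chiP; rewrite -[K in X in _ -> X]prednK ?ltnS // ltnW.
Qed.

From mathcomp Require Import reals sequences exp.

(** * Chernoff bounds for random colourings *)

Lemma leq_card_bigcup (I T : finType) (F : I -> {set T}) :
  #|\bigcup_i F i| <= \sum_i #|F i|.
Proof.
elim/big_rec2: _ => [|i n A _ le_n]; first by rewrite cards0.
by apply: leq_trans (leq_card_setU _ _) _; rewrite leq_add2l.
Qed.

Section Chernoff.
Variable R : realType.
Local Open Scope ring_scope.

(** Compare with [1 / (1 - x)]; negative [x] is allowed, so one bound serves both tails. *)
Lemma expR_le_quadratic (x : R) : x <= 1 / 2 -> expR x <= 1 + x + 2 * x ^+ 2.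
Proof.
move=> x2; have x1 : 0 < 1 - x by lra.
have h : expR x * (1 - x) <= 1.
  have := expR_ge1Dx (- x); rewrite expRN => h.
  rewrite -(ler_pM2l (expR_gt0 x)) mulfV ?lt0r_neq0 ?expR_gt0 // in h.
rewrite -(ler_pM2r x1); apply: le_trans h _.
have : 0 <= x ^+ 2 * (1 - 2 * x) by rewrite mulr_ge0 ?sqr_ge0 //; lra.
lra.
Qed.

Variables (I C : finType).
Hypothesis C0 : (0 < #|C|)%N.

(** The moment generating function of a binomial law in counting form: summed over all colourings,
    the exponential factors over [I]. *)
Lemma card_color_mgf (A : {set I}) (c : C) (l : R) : l <= 1 / 2 ->
  \sum_(g : {ffun I -> C}) expR (l * #|[set i in A | g i == c]|%:R) <=
  #|C|%:R ^+ #|I| * expR ((l + 2 * l ^+ 2) * (#|A|%:R / #|C|%:R)).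
Proof.
move=> l2; set M : R := #|C|%:R.
have M0 : 0 < M by rewrite ltr0n.
pose F i c' := if (i \in A) && (c' == c) then expR l else 1.
have -> : \sum_(g : {ffun I -> C}) expR (l * #|[set i in A | g i == c]|%:R) =
    \prod_i \sum_c' F i c'.
  rewrite bigA_distr_bigA; apply: eq_bigr => g _.
  rewrite /F -big_mkcond /= expRM_natr -prodr_const.
  by apply: eq_bigl => i; rewrite inE.
have sumF i : \sum_c' F i c' = if i \in A then expR l + (M - 1) else M.
  rewrite /F; case: (i \in A) => /=; last by rewrite sumr_const.
  rewrite (bigD1 c) //= eqxx; congr (_ + _).
  rewrite (eq_bigr (fun=> 1)); last by move=> c' /negbTE ->.
  have -> : M = #|[pred x | x != c]|.+1%:R.
    rewrite /M (cardD1 c) inE add1n; congr (_.+1%:R); apply: eq_card => x.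
    by rewrite !inE andbT.
  by rewrite sumr_const mulrSr addrK.
rewrite (eq_bigr _ (fun i _ => sumF i)).
have le1 i : (if i \in A then expR l + (M - 1) else M) <=
   M * (if i \in A then expR ((l + 2 * l ^+ 2) / M) else 1).
  case: (i \in A); last by rewrite mulr1.
  apply: le_trans (_ : M * (1 + (l + 2 * l ^+ 2) / M) <= _); last first.
    by apply: ler_wpM2l; [exact: ltW|exact: expR_ge1Dx].
  have := expR_le_quadratic l2.
  have -> : M * (1 + (l + 2 * l ^+ 2) / M) = M + (l + 2 * l ^+ 2) by field; rewrite lt0r_neq0.
  lra.
apply: le_trans (_ : \prod_i (M * (if i \in A then expR ((l + 2 * l ^+ 2) / M) else 1)) <= _).
  apply: ler_prod => i _; rewrite le1 andbT; case: ifP => _; last exact: ltW.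
  have : 1 <= M by rewrite ler1n.
  have := expR_gt0 l; lra.
rewrite big_split /= prodr_const -big_mkcond /= prodr_const cardT -cardE.
by rewrite -expRM_natr -mulrA [M^-1 * _]mulrC.
Qed.

Lemma card_color_tail (A : {set I}) (c : C) (l s : R) : l <= 1 / 2 ->
  #|[set g : {ffun I -> C} |
      s < l * (#|[set i in A | g i == c]|%:R - #|A|%:R / #|C|%:R)]|%:R <=
  #|C|%:R ^+ #|I| * expR (2 * l ^+ 2 * (#|A|%:R / #|C|%:R) - s).
Proof.
move=> l2; set a := #|A|%:R / _.
have := card_color_mgf A c l2; rewrite -/a => mgf.
rewrite -(ler_pM2r (expR_gt0 (l * a + s))) -[leRHS]mulrA -expRD.
have -> : 2 * l ^+ 2 * a - s + (l * a + s) = (l + 2 * l ^+ 2) * a by ring.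
apply: le_trans mgf.
rewrite -sum1_card natr_sum mulr_suml [leRHS](bigID (fun g => g \in
  [set g : {ffun I -> C} | s < l * (#|[set i in A | g i == c]|%:R - a)])) /=.
apply: ler_wpDr; first by apply: sumr_ge0 => g _; exact: expR_ge0.
by apply: ler_sum => g; rewrite inE mul1r ler_expR => h; apply: ltW; lra.
Qed.

Lemma card_color_deviation (A : {set I}) (c : C) (m t : R) :
  #|A|%:R / #|C|%:R <= m -> 0 <= t -> t <= 1 ->
  #|[set g : {ffun I -> C} |
      t * m < `|#|[set i in A | g i == c]|%:R - #|A|%:R / #|C|%:R|]|%:R <=
  #|C|%:R ^+ #|I| * (2 * expR (- (t ^+ 2 * m / 8))).
Proof.
move=> am t0 t1; set a := #|A|%:R / _.
(* For [t = 0] the bound is trivial; otherwise the strict deviation may be multiplied by [t]. *)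
have [->|tn0] := eqVneq t 0.
  rewrite expr0n /= !mul0r oppr0 expR0 mulr1 -natrX -natrM ler_nat.
  by apply: leq_trans (max_card _) _; rewrite card_ffun leq_pmulr.
have tp : 0 < t by rewrite lt_neqAle eq_sym tn0.
have a0 : 0 <= a by rewrite divr_ge0.
(* With [l] equal to [t / 4] or its opposite and this threshold, the exponent is at most [2 * l ^+ 2
   * m - t ^+ 2 * m / 4 = - (t ^+ 2 * m / 8)]. *)
pose T (l : R) := [set g : {ffun I -> C} |
  t ^+ 2 * m / 4 < l * (#|[set i in A | g i == c]|%:R - a)].
have cT l : l ^+ 2 = t ^+ 2 / 16 -> l <= 1 / 2 ->
   #|T l|%:R <= #|C|%:R ^+ #|I| * expR (- (t ^+ 2 * m / 8)).
  move=> l2 l1; apply: le_trans (card_color_tail A c _ l1) _.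
  rewrite -/a ler_wpM2l ?exprn_ge0 // ler_expR l2.
  have : t ^+ 2 * a <= t ^+ 2 * m by rewrite ler_wpM2l ?sqr_ge0.
  lra.
apply: le_trans (_ : (#|T (t / 4)| + #|T (- (t / 4))|)%:R <= _).
  rewrite ler_nat; apply: leq_trans (leq_card_setU _ _).
  apply: subset_leq_card; apply/subsetP => g; rewrite !inE -/a.
  rewrite ltr_normr => /orP[] h; apply/orP; [left|right].
    have : t * (t * m) < t * (#|[set i in A | g i == c]|%:R - a) by rewrite ltr_pM2l.
    lra.
  have : t * (t * m) < t * - (#|[set i in A | g i == c]|%:R - a) by rewrite ltr_pM2l.
  lra.
have h1 : #|T (t / 4)|%:R <= #|C|%:R ^+ #|I| * expR (- (t ^+ 2 * m / 8)).
  by apply: cT; [field|lra].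
have h2 : #|T (- (t / 4))|%:R <= #|C|%:R ^+ #|I| * expR (- (t ^+ 2 * m / 8)).
  by apply: cT; [field|lra].
by rewrite natrD mulrCA mulr_natl mulr2n lerD.
Qed.

(** A union bound in which [amax] sets one absolute error for all sets. It serves twice: to colour
    the vertices for a given [H], and to count the placements of random points in cells. *)
Lemma bad_colorings (J : finType) (As : J -> {set I}) (amax t : R) :
  (forall j, #|As j|%:R <= amax) -> 0 <= t -> t <= 1 ->
  #|[set g : {ffun I -> C} | [exists j, [exists c,
      t * (amax / #|C|%:R) <
      `|#|[set i in As j | g i == c]|%:R - #|As j|%:R / #|C|%:R|]]]|%:R <=
  #|C|%:R ^+ #|I| *
    (#|J|%:R * #|C|%:R * (2 * expR (- (t ^+ 2 * (amax / #|C|%:R) / 8)))).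
Proof.
move=> Aamax t0 t1; pose Bad j c := [set g : {ffun I -> C} |
   t * (amax / #|C|%:R) <
      `|#|[set i in As j | g i == c]|%:R - #|As j|%:R / #|C|%:R|].
apply: (@le_trans _ _ (\sum_j \sum_c #|Bad j c|)%:R).
  rewrite ler_nat; apply: leq_trans (_ : #|\bigcup_j \bigcup_c Bad j c| <= _)%N.
    apply: subset_leq_card; apply/subsetP => g; rewrite inE.
    move=> /existsP[j /existsP[c h]]; apply/bigcupP; exists j => //.
    by apply/bigcupP; exists c => //; rewrite inE.
  apply: leq_trans (leq_card_bigcup _) _; apply: leq_sum => j _.
  exact: leq_card_bigcup.
rewrite natr_sum; under eq_bigr do rewrite natr_sum.
apply: (@le_trans _ _ (\sum_(j : J) \sum_(c : C)
  #|C|%:R ^+ #|I| * (2 * expR (- (t ^+ 2 * (amax / #|C|%:R) / 8))))).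
  apply: ler_sum => j _; apply: ler_sum => c _; apply: card_color_deviation => //.
  by rewrite ler_pM2r ?invr_gt0 ?ltr0n.
under eq_bigr do rewrite sumr_const.
rewrite sumr_const -[_ *+ #|J|]mulr_natr -[_ *+ #|C|]mulr_natr; lra.
Qed.

Lemma exists_coloring (J : finType) (As : J -> {set I}) (amax t : R) :
  (forall j, #|As j|%:R <= amax) -> 0 <= t -> t <= 1 ->
  #|J|%:R * #|C|%:R * (2 * expR (- (t ^+ 2 * (amax / #|C|%:R) / 8))) < 1 ->
  exists g : I -> C, forall j c,
      `|#|[set i in As j | g i == c]|%:R - #|As j|%:R / #|C|%:R| <=
        t * (amax / #|C|%:R).
Proof.
move=> Aamax t0 t1 small; have := bad_colorings Aamax t0 t1.
set B := [set g | _] => cB.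
have : (#|B| < #|{: {ffun I -> C}}|)%N.
  rewrite card_ffun -(ltr_nat R); apply: le_lt_trans cB _.
  by rewrite natrX gtr_pMr // exprn_gt0 // ltr0n.
case: (pickP [pred g | g \notin B]) => [g /= gB _|noB].
  exists g => j c; rewrite leNgt; apply: contra gB => h; rewrite inE.
  by apply/existsP; exists j; apply/existsP; exists c.
suff -> : B = setT by rewrite cardsT ltnn.
by apply/setP => g; rewrite [RHS]inE; move: (noB g) => /= /negbFE.
Qed.
End Chernoff.

(** * Cycles when all cells have the right size *)

Lemma exists_nat_floor (R : realType) (x : R) : (0 <= x)%R ->
  exists k : nat, (k%:R <= x /\ x < k%:R + 1)%R.
Proof.
by move=> /truncn_itv/andP[h1 h2]; exists (Num.truncn x); rewrite natr1.
Qed.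

(** The uneven cells and the shell cost about [3 * eps / 40] of the degree, which leaves [H] a
    margin of [eps / 2] over half the maximal degree; half of this margin pays for the [2 * delta]
    edges used up by matchings. *)
Lemma deep_degree_bound (R : realFieldType) (eps eta mu bm sigma gdeg hdeg delta : R) :
  (0 < eps)%R -> (eps <= 1 / 2)%R -> (0 <= eta)%R -> (eta <= eps / 40)%R -> (0 <= mu)%R ->
  (1 <= bm)%R -> (sigma <= eta * bm)%R -> (40 / eps <= mu * bm)%R ->
  ((1 - eta) * mu * (bm - sigma) - 1 <= gdeg)%R -> ((1 / 2 + eps) * gdeg <= hdeg)%R ->
  (delta <= eps * ((1 + eta) * mu * bm) / 8)%R ->
  ((1 / 2 + eps / 4) * ((1 + eta) * mu * bm) + 2 * delta <= hdeg)%R.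
Proof.
move=> e0 e1 eta0 eta1 mu0 bm1 sb big gd hd dl.
pose a := (mu * bm)%R.
have ea : (40 <= eps * a)%R by move: big; rewrite ler_pdivrMr // mulrC.
have a0 : (0 <= a)%R by rewrite mulr_ge0 //; lra.
have gd2 : ((1 - 3 * eps / 40) * a <= gdeg)%R.
  have h1 : ((1 - eta) * mu * (bm - eta * bm) <= (1 - eta) * mu * (bm - sigma))%R.
    by apply: ler_wpM2l; [apply: mulr_ge0 => //; lra|lra].
  have h2 : (eta * a <= eps / 40 * a)%R by rewrite ler_wpM2r.
  have h3 : (0 <= eta * eta * a)%R by rewrite mulr_ge0 // mulr_ge0.
  move: h1 h2 h3 gd ea; rewrite /a; clear; lra.
have hd2 : ((1 / 2 + eps) * ((1 - 3 * eps / 40) * a) <= hdeg)%R.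
  by apply: le_trans hd; apply: ler_wpM2l; [lra|].
have h4 : ((1 / 2 + eps / 2) * ((1 + eta) * mu * bm) <= (1 / 2 + eps / 2) * ((1 + eps / 40) * a))%R.
  by apply: ler_wpM2l; [lra|rewrite -mulrA -/a; apply: ler_wpM2r => //; lra].
have h5 : (0 <= (1 / 2 - eps) * (eps * a))%R.
  by apply: mulr_ge0; [lra|apply: mulr_ge0; [exact: ltW|]].
move: hd2 h4 h5 dl ea; clear; lra.
Qed.

(* The colours below K carry the paths, K the anchors, and the r0 last ones the
   reserve.  X and Y are the squared lattice distances that force, respectively
   are forced by, adjacency in G; W bounds the reach of an edge; sigma bounds a
   shell; cap is the number of reserve vertices a link may avoid, p the number
   of paths, and q0 the number of paths per block. *)
Lemma cycles_from_cells (R : realType) (d Bn T W X X' Y h K r0 cap q0 p : nat)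
    (V : finType) (cell : V -> {ffun 'I_d -> 'I_(Bn * T)}) (G H : rel V)
    (mu eta eps sigma t : R) :
  let n : R := (#|V|%:R)%R in
  let M := (K + r0).+1 in
  let N := 6 * T + 1 in
  let E := K + N.+1.*2 in
  (0 < eps <= 1 / 2)%R -> (0 <= eta <= eps / 40)%R -> (0 < mu)%R ->
  0 < Bn -> 0 < T -> W <= T -> 1 < K ->
  (mu * ((Bn * T) ^ d)%:R = n)%R ->
  (forall c, (1 - eta) * mu <= #|[set v | cell v == c]|%:R <= (1 + eta) * mu)%R ->
  (forall u v, u != v -> qdist (cell u) (cell v) <= X -> G u v) ->
  (forall u v, G u v -> qdist (cell u) (cell v) <= Y) ->
  X <= Y -> Y <= W ^ 2 -> X' + d * (2 * W + 1) <= X.+1 ->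
  (forall a : {ffun 'I_d -> 'I_(Bn * T)},
     #|[set c | X' <= qdist a c <= Y]%N|%:R <= sigma)%R ->
  (forall a : {ffun 'I_d -> 'I_(Bn * T)}, h.+1 ^ d <= #|[set c | qdist a c <= X]|) ->
  symmetric H -> subrel H G ->
  (forall v, (1 / 2 + eps) * #|[set w | G v w]|%:R <= #|[set w | H v w]|%:R)%R ->
  (sigma <= eta * (h.+1 ^ d)%:R)%R ->
  (40 / eps <= mu * (h.+1 ^ d)%:R)%R ->
  ((1 + eta) * (d * (2 * W))%:R <= eps / 40 * T%:R)%R ->
  (mu <= 2 * eps * ((1 - eta) * mu * (h.+1 ^ d)%:R - 1) - 2 * ((1 + eta) * mu * sigma + 1))%R ->
  (0 <= t <= 1)%R -> (t <= eps ^+ 2 / (16 * (1000 * M%:R)))%R ->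
  (t * (W.*2.+1 ^ d)%:R <= 1 / 8)%R ->
  ((2 * n + n ^+ 2 + ((Bn * T) ^ d)%:R) * M%:R *
     (2 * expR (- (t ^+ 2 * (mu / M%:R) / 8))) < 1)%R ->
  (cap%:R < r0%:R / M%:R * (mu / 4))%R ->
  ((3 ^ d + 2)%:R <= mu / (4 * M%:R))%R ->
  (2 * mu * (T ^ d)%:R <= K%:R * q0%:R)%R ->
  17 ^ d * (q0 + (3 ^ d).+1) * N + (N + E).+1 + (N + E) <= cap ->
  (p%:R * M%:R <= (2 / 3 + eps / 16) * n)%R ->
  (2 / 3 * n + K%:R <= p%:R * K%:R)%R ->
  (40 / eps <= n)%R ->
  forall (L : nat) (v : V), N < L -> (L%:R <= 2 * n / 3)%R ->
  exists c : seq V, [/\ cycle H c, uniq c, size c = L & v \in c].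
Proof.
move=> n M N E eps01 eta01 mu0 B0 T0 WT K1 muV cellP Gnear Gfar XY YW X'X shellP ballP
  Hsym HG Hdeg sigmaP bigball shallowP commonP t01 tM tW unionP capP availP q0P f0P
  pM pK nbig L v NL Ln.
have /andP[e0 e1] := eps01; have /andP[eta0 eta1] := eta01.
have eta01' : (0 <= eta <= 1)%R.
  by rewrite eta0 /=; move: e1 eta1; clear; lra.
have /andP[t0 t1] := t01.
have mu0' := ltW mu0.
pose bm := @ball_max d Bn T Y.
pose D : R := ((1 + eta) * mu * bm%:R)%R.
have S0 : 0 < Bn * T by rewrite muln_gt0 B0.
pose c0 : {ffun 'I_d -> 'I_(Bn * T)} := [ffun=> Ordinal S0].
have bm_ge : h.+1 ^ d <= bm.
  apply: leq_trans (ballP c0) _; apply: leq_trans (_ : #|[set c | qdist c0 c <= Y]| <= _).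
    by apply: subset_leq_card; apply/subsetP => c; rewrite !inE => /leq_trans; apply.
  exact: (leq_bigmax (F := fun a : {ffun 'I_d -> 'I_(Bn * T)} => #|[set c | qdist a c <= Y]|)).
have bm_le : bm <= W.*2.+1 ^ d.
  apply/bigmax_leqP => a _; apply: leq_trans (card_close W a).
  apply: subset_leq_card; apply/subsetP => c; rewrite !inE; exact: qdist_close.
have bm1 : (1 <= bm%:R :> R)%R.
  by rewrite ler1n; apply: leq_trans bm_ge; rewrite expn_gt0.
have D_ge : (mu * bm%:R <= D)%R.
  by rewrite /D ler_wpM2r // ler_peMl // lerDl.
have D_mu : (mu <= D)%R.
  by apply: le_trans D_ge; rewrite ler_peMr.
have D0 : (0 < D)%R by apply: lt_le_trans D_mu.
have Dbig : (40 / eps <= D)%R.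
  apply: le_trans bigball _; apply: le_trans D_ge.
  by rewrite ler_pM2l // ler_nat.
have epsD : (40 <= eps * D)%R by move: Dbig; rewrite ler_pdivrMr // mulrC.
(* So [Delta] rounds remove at most [eps * D / 4] edges at a vertex, and deep vertices stay above
   half of [D]. *)
have [Delta [Delta_le Delta_gt]] : exists k : nat, (k%:R <= eps * D / 8 /\ eps * D / 8 < k%:R + 1)%R.
  by apply: exists_nat_floor; move: epsD; clear; lra.
have Delta_ge : (eps * D / 16 <= Delta%:R)%R.
  by move: Delta_gt epsD; clear; lra.
have Delta0 : 0 < Delta.
  by rewrite -(ltr0n R); apply: lt_le_trans Delta_ge; move: epsD; clear; lra.
pose beta v := block (cell v).
(* Only edges inside blocks, so that every coloured path stays in one block. *)
pose H1 : rel V := fun u v => H u v && (beta u == beta v).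
have H1sym : symmetric H1 by move=> x y; rewrite /H1 Hsym [beta x == _]eq_sym.
pose Gd : {set V} := [set v | deep W (cell v)].
have degD u : (#|[set w | G u w]|%:R <= D)%R.
  exact: (@cell_deg_le R d Bn T Y V cell G mu eta eta01' mu0' cellP Gfar).
have degHD u : (#|[set w | H u w]|%:R <= D)%R.
  apply: le_trans (degD u); rewrite ler_nat; apply: subset_leq_card.
  by apply/subsetP => w; rewrite !inE => /HG.
have degH1 u : (#|[set w | H1 u w]|%:R <= D)%R.
  apply: le_trans (degHD u); rewrite ler_nat; apply: subset_leq_card.
  by apply/subsetP => w; rewrite !inE => /andP[].
have degGd u : u \in Gd ->
   ((1 / 2 + eps / 4) * D + 2 * Delta%:R <= #|[set w | H1 u w]|%:R)%R.
  rewrite inE => du.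
  have -> : [set w | H1 u w] = [set w | H u w].
    apply/setP => w; rewrite !inE /H1; case Huw: (H u w) => //=; apply/eqP.
    by apply: (deep_block du); apply: qdist_close YW _; apply: Gfar; apply: HG.
  have h1 : ((1 - eta) * mu * (bm%:R - sigma) - 1 <= #|[set w | G u w]|%:R)%R.
    exact: (@cell_deg_deep R d Bn T W X X' Y V cell G mu eta sigma eta01' mu0' cellP Gnear YW X'X shellP).
  have h2 := Hdeg u.
  apply: (deep_degree_bound e0 e1 eta0 eta1 mu0' bm1 _ _ h1 h2 Delta_le).
    by apply: le_trans sigmaP _; apply: ler_wpM2l => //; rewrite ler_nat.
  by apply: (le_trans bigball); apply: ler_wpM2l => //; rewrite ler_nat.
have badGd : (#|~: Gd|%:R <= eps / 40 * #|V|%:R)%R.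
  have := card_shallow W eta01' mu0' cellP B0 T0 muV.
  have -> : [set v | ~~ deep W (cell v)] = ~: Gd by apply/setP => x; rewrite !inE.
  move=> h1; rewrite -(@ler_pM2r _ T%:R) ?ltr0n //; apply: le_trans h1 _.
  by rewrite [(eps / 40 * #|V|%:R * _)%R]mulrAC; apply: ler_wpM2r.
have n0 : (0 <= n)%R by [].
have [kd [kd_ge kd_le]] : exists k : nat, (n * (1 / 3 - 3 * eps / 20) <= k%:R /\
    k%:R <= n * (1 / 3 - 3 * eps / 20) + 1)%R.
  have [|k [k1 k2]] := @exists_nat_floor R (n * (1 / 3 - 3 * eps / 20))%R.
    by apply: mulr_ge0 => //; move: e1; clear; lra.
  by exists k.+1; rewrite -[(k.+1%:R)%R]natr1; move: k1 k2; clear; split; lra.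
have [W0 [WH1 Wo Wi Ws]] := matching_rounds e0 e1 D0 badGd kd_ge H1sym degH1 degGd (leqnn Delta).
have M0 : (0 < M%:R :> R)%R by rewrite ltr0n.
have tDelta : (t * D <= eps / (1000 * M%:R) * Delta%:R)%R.
  apply: (@le_trans _ _ (eps ^+ 2 / (16 * (1000 * M%:R)) * D)%R).
    by rewrite ler_wpM2r // ltW.
  have -> : (eps ^+ 2 / (16 * (1000 * M%:R)) * D = eps / (1000 * M%:R) * (eps * D / 16))%R.
    by field; rewrite lt0r_neq0.
  by rewrite ler_wpM2l // divr_ge0 ?mulr_ge0 // ltW.
have tDmu : (t * D <= mu / 4)%R.
  have h1 : (t * bm%:R <= 1 / 8)%R.
    by apply: le_trans tW; rewrite ler_wpM2l // ler_nat.
  have -> : (t * D = (1 + eta) * mu * (t * bm%:R))%R by rewrite /D; ring.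
  apply: (@le_trans _ _ ((1 + eta) * mu * (1 / 8))%R).
    by rewrite ler_wpM2l // mulr_ge0 // addr_ge0.
  have : ((1 + eta) * mu <= 2 * mu)%R by apply: ler_wpM2r => //; move: e1 eta1; clear; lra.
  by clear; lra.
(* The sets to be split evenly: both neighbourhoods in [W0] for the flow, common neighbourhoods and
   cells for the reserve and the anchors. *)
pose As (j : (V + V) + (V * V + {ffun 'I_d -> 'I_(Bn * T)})) : {set V} :=
  match j with
  | inl (inl u) => [set v | W0 u v]
  | inl (inr u) => [set v | W0 v u]
  | inr (inl uu) => [set x | H uu.1 x && H uu.2 x]
  | inr (inr c) => [set v | cell v == c]
  end.
have AsD j : (#|As j|%:R <= D)%R.
  case: j => [[u|u]|[[u u']|c]] /=.
  - apply: le_trans (degH1 u); rewrite ler_nat; apply: subset_leq_card.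
    by apply/subsetP => w; rewrite !inE => /WH1.
  - apply: le_trans (degH1 u); rewrite ler_nat; apply: subset_leq_card.
    by apply/subsetP => w; rewrite !inE H1sym => /WH1.
  - apply: le_trans (degHD u); rewrite ler_nat; apply: subset_leq_card.
    by apply/subsetP => w; rewrite !inE => /andP[].
  - have /andP[_ h1] := cellP c; apply: le_trans h1 _.
    by rewrite /D ler_peMr // mulr_ge0 // addr_ge0.
have cM : #|'I_M| = M by rewrite card_ord.
have [||g gP] := @exists_coloring R V 'I_M _ _ As D t AsD t0 t1.
- by rewrite cM.
- apply: le_lt_trans unionP; rewrite cM.
  have cJ : (#|{: (V + V) + (V * V + {ffun 'I_d -> 'I_(Bn * T)})}|%:R =
      2 * n + n ^+ 2 + ((Bn * T) ^ d)%:R)%R.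
    by rewrite !card_sum card_prod card_ffun !card_ord !natrD natrM -/n; ring.
  rewrite cJ; apply: ler_wpM2l.
    by rewrite mulr_ge0 // addr_ge0 // addr_ge0 ?sqr_ge0 // mulr_ge0.
  rewrite ler_pM2l // ler_expR lerN2; apply: ler_wpM2r; first by rewrite invr_ge0.
  apply: ler_wpM2l; first exact: sqr_ge0.
  by apply: ler_wpM2r => //; rewrite invr_ge0 ltW.
rewrite cM in gP.
have [Ps [sPs PsP uPs]] := @colored_paths R V H1 W0 M K Delta kd p g eps D t eps01 H1sym WH1
   (introT andP (conj K1 (leqW (leq_addr r0 K)))) Delta0 Wo Wi Ws kd_le nbig (ltW D0) t0 tDelta pM
   (fun u c => gP (inl (inl u)) c) (fun u c => gP (inl (inr u)) c).
(* The deviation is at most [mu / 4 / M], half of the smallest mean considered. *)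
have half j c : (mu / 2 <= #|As j|%:R)%R ->
    (mu / 4 / M%:R <= #|[set i in As j | g i == c]|%:R)%R.
  move=> hj; have := gP j c; rewrite ler_norml => /andP[h1 _].
  have : (mu / 2 / M%:R <= #|As j|%:R / M%:R)%R by rewrite ler_pM2r ?invr_gt0.
  have : (t * D / M%:R <= mu / 4 / M%:R)%R by rewrite ler_pM2r ?invr_gt0.
  move: h1; rewrite mulrA; clear; lra.
have cell_half c : (mu / 2 <= #|As (inr (inr c))|%:R)%R.
  have /andP[h1 _] := cellP c; apply: le_trans h1.
  rewrite mulrC; apply: ler_wpM2r => //; move: e1 eta1; clear; lra.
have common_half u u' : close 1 (cell u) (cell u') ->
    (mu / 2 <= #|As (inr (inl (u, u')))|%:R)%R.
  move=> cl; have := cell_common eta01' mu0' cellP Gnear Gfar YW X'X shellP ballP HG Hdeg eps01 cl.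
  move=> /(le_trans commonP) h1; apply: le_trans h1; move: mu0'; clear; lra.
pose Z : {set V} := [set x | K < g x].
have cardZ (P : pred V) : #|[set x in Z | P x]| =
    \sum_(c : 'I_M | K < c) #|[set i in [set y | P y] | g i == c]|.
  rewrite -sum1_card (partition_big g (fun c : 'I_M => K < c)) /=; last first.
    by move=> x; rewrite !inE => /andP[].
  apply: eq_bigr => c Kc; rewrite -sum1_card; apply: eq_bigl => x; rewrite !inE.
  by case: eqP => [->|]; rewrite ?Kc ?andbF ?andbT.
have colZ : r0 <= #|[pred c : 'I_M | K < c]|.
  pose f (i : 'I_r0) : 'I_M := inord (K.+1 + i).
  have fE i : f i = K.+1 + i :> nat by rewrite inordK // /M ltnS addSnnS leq_add2l.
  have finj : injective f.
    by move=> i j /(congr1 (@nat_of_ord _)); rewrite !fE => /addnI /val_inj.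
  rewrite -[r0 in r0 <= _]card_ord -(card_imset _ finj); apply: subset_leq_card.
  by apply/subsetP => _ /imsetP[i _ ->]; rewrite inE fE leq_addr.
have inZ j (P : pred V) : As j = [set y | P y] -> (mu / 2 <= #|As j|%:R)%R ->
    cap < #|[set x in Z | P x]|.
  move=> eP hj; rewrite cardZ -(ltr_nat R) natr_sum; apply: (lt_le_trans capP).
  apply: (@le_trans _ _ (\sum_(c : 'I_M | (K < c)%N) (mu / 4 / M%:R))%R); last first.
    by apply: ler_sum => c _; rewrite -eP; exact: half.
  rewrite sumr_const; have -> : (r0%:R / M%:R * (mu / 4) = mu / 4 / M%:R *+ r0)%R.
    by rewrite -mulr_natr; ring.
  by apply: ler_wpMn2l => //; rewrite divr_ge0 // divr_ge0.
have cell_Z c : cap < #|[set x in Z | cell x == c]|.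
  exact: (inZ (inr (inr c)) (fun x => cell x == c) erefl (cell_half c)).
have common_Z u u' : close 1 (cell u) (cell u') -> cap < #|[set x in Z | H u x && H u' x]|.
  move=> cl; exact: (inZ (inr (inl (u, u'))) (fun x => H u x && H u' x) erefl (common_half _ _ cl)).
have Hclose x y : H x y -> close W (cell x) (cell y).
  by move=> /HG/Gfar; exact: qdist_close.
(* The remaining [N + E] let a link avoid its own earlier vertices. *)
pose f0 := cap - (N + E).
have f0E : f0 + (N + E) = cap by rewrite subnK //; apply: leq_trans f0P; exact: leq_addl.
have near2T u u' : close 1 (beta u) (beta u') -> close T.*2 (cell u) (cell u').
  by move=> /block_near; rewrite mul2n.
(* An ordinary link stays within [4 * T] cells of its start, hence within 4 blocks; two of them can
   meet only if they start within 8 blocks, which gives [17 ^ d]. *)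
pose reg (b : {ffun 'I_d -> 'I_Bn}) : {set V} := [set x | close 4 b (beta x)].
pose avail (b : {ffun 'I_d -> 'I_Bn}) : {set V} := [set x | (g x == K :> nat) && (beta x == b)].
have Ps' P : P \in Ps -> [/\ size P = K, sorted H P,
      forall x y, x \in P -> y \in P -> beta x = beta y &
      forall x, x \in P -> x \notin Z /\ forall b, x \notin avail b].
  move=> /PsP[sP soP chP]; split=> //.
  - by apply: sub_sorted soP => x y /andP[].
  - case: P soP {sP chP} => // a s /= pa x y xs ys.
    have H1b u w : H1 u w -> beta u = beta w by move=> /andP[_ /eqP].
    by rewrite (path_const H1b pa xs) (path_const H1b pa ys).
  - move=> x /chP xK; split; first by rewrite inE -leqNgt ltnW.
    by move=> b; rewrite inE negb_and; apply/orP; left; rewrite neq_ltn xK.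
(* The paths in a block are disjoint and the block has at most [2 * mu * T ^ d] vertices. *)
have cPs b : count (fun P => has (fun x => beta x == b) P) Ps <= q0.
  pose Qs := [seq P <- Ps | has (fun x => beta x == b) P].
  have K0 : 0 < K := ltnW K1.
  have QP P : P \in Qs -> size P = K /\ forall x, x \in P -> beta x = b.
    rewrite mem_filter => /andP[/hasP[y yP /eqP yb] /Ps'[sP _ cP _]]; split=> // x xP.
    by rewrite (cP x y).
  have uQ : uniq (flatten Qs).
    by apply: subseq_uniq uPs; apply: subseq_flatten; exact: filter_subseq.
  have szQ : size (flatten Qs) = K * size Qs.
    elim: (Qs) QP => [|P l IH] hP /=; first by rewrite muln0.
    rewrite size_cat IH ?mulnS; last by move=> P' P'l; apply: hP; rewrite inE P'l orbT.
    by have [-> _] := hP P (mem_head _ _).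
  have sub : size (flatten Qs) <= #|[set x | beta x == b]|.
    rewrite -(card_uniqP uQ); apply: subset_leq_card; apply/subsetP => x.
    by move=> /flattenP[P /QP[_ hP] /hP xb]; rewrite inE xb.
  rewrite -size_filter -/Qs -(leq_pmul2l K0) -szQ -(ler_nat R) natrM.
  apply: le_trans q0P; apply: (@le_trans _ _ (#|[set x | beta x == b]|%:R)%R).
    by rewrite ler_nat.
  have -> : [set x | beta x == b] =
     [set x | cell x \in [set a : {ffun 'I_d -> 'I_(Bn * T)} | block a == b]].
    by apply/setP => x; rewrite !inE.
  have /andP[_ up] := card_preim_cells cellP
    [set a : {ffun 'I_d -> 'I_(Bn * T)} | block a == b].
  apply: (le_trans up); apply: ler_pM.
  - by rewrite mulr_ge0 // addr_ge0.
  - by [].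
  - by apply: ler_wpM2r => //; move: e1 eta1; clear; lra.
  - by rewrite ler_nat card_block.
have avail_card b : (3 ^ d).+1 < #|avail b|.
  have [a ab] := block_surj T0 b.
  have KM : K < M by rewrite ltnS leq_addr.
  have := half (inr (inr a)) (Ordinal KM) (cell_half a); set A := [set i in _ | _] => hA.
  have AA : #|A| <= #|avail b|.
    apply: subset_leq_card; apply/subsetP => x; rewrite !inE => /andP[/eqP xa /eqP xK].
    by rewrite xK eqxx /beta xa ab eqxx.
  apply: leq_trans AA; rewrite -(ler_nat R); apply: le_trans hA.
  apply: le_trans (le_trans _ availP) _; first by rewrite ler_nat addn2.
  by rewrite invfM mulrA.
have Bpos : 0 < #|{ffun 'I_d -> 'I_Bn}| by rewrite card_ffun !card_ord expn_gt0 B0.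
(* The paths alone, with one lost to [v], already reach [2 * n / 3]. *)
have Lbound : L <= (#|{ffun 'I_d -> 'I_Bn}|.*2.-1) * N.+1 + (size Ps).-1 * (K + N).
  rewrite -(ler_nat R); apply: (le_trans Ln).
  apply: (@le_trans _ _ (p.-1 * K)%:R%R); last first.
    rewrite ler_nat; apply: leq_trans (leq_addl _ _).
    by apply: leq_mul; [move: sPs; clear; lia|exact: leq_addr].
  have p0 : 0 < p.
    rewrite lt0n; apply: contraTneq pK => ->; rewrite mul0r -ltNge.
    by apply: ltr_wpDl; [apply: mulr_ge0 => //; apply: divr_ge0|rewrite ltr0n; exact: ltnW].
  rewrite -subn1 natrM natrB // mulrBl mul1r; move: pK; clear; lra.
apply: (@cycle_of_length V {ffun 'I_d -> 'I_Bn} H beta (close 1) (close 8) Z reg avail N f0 E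
  (3 ^ d) (17 ^ d) q0 K) Ps' uPs cPs NL Lbound.
- by move=> b; exact: close_refl.
- by move=> b b'; exact: close_sym.
- by move=> b; exact: card_close.
- exact: close_connected.
- move=> b b' x; rewrite !inE => h1 h2; apply: (@close_trans _ _ 4 4) h1 _.
  by rewrite close_sym.
- by move=> b; exact: card_close.
- move=> u u' F near cF.
  have [|q [q1 q2 q3 q4]] := @link_any V H d (Bn * T) cell Z cap W Hsym cell_Z common_Z Hclose
     T 0 u u' F T0 WT (near2T _ _ near).
    by rewrite addn0 -f0E -/N leq_add // leq_addr.
  exists q; split=> //; first by rewrite q1 addn0.
  move=> x /q4[xZ xF xc]; split=> //; rewrite inE; exact: block_close (xc erefl).
- move=> u u' F e near cF eE.
  have [|q [q1 q2 q3 q4]] := @link_any V H d (Bn * T) cell Z cap W Hsym cell_Z common_Z Hclose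
     T e u u' F T0 WT (near2T _ _ near).
    by rewrite -f0E -/N leq_add // leq_add2l.
  by exists q; split=> // x /q4[].
- by move=> b x; rewrite inE => /andP[_ /eqP].
- by move=> b x; rewrite !inE => /andP[/eqP -> _]; rewrite ltnn.
- exact: avail_card.
- exact: ltnW.
- rewrite /E; split; first by rewrite leq_add2l -addnn; apply: leq_trans (leqnSn _) (leq_addr _ _).
  exact: leq_addl.
- by rewrite -(leq_add2r (N + E)) f0E.
Qed.

(** * Lattice radii and shell width *)

Lemma lattice_params (R : realType) (d h : nat) (rho : R) :
  0 < d -> 5 <= h -> ((2 * d * h)%:R <= rho)%R -> (rho <= (4 * d * h)%:R)%R ->
  let W := 4 * d * h + d in
  exists X X' Y : nat,
   [/\ forall m : nat, m <= X -> (m%:R <= rho ^+ 2 - d%:R * (2 * rho + 1))%R,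
       forall m : nat, (m%:R <= rho ^+ 2 + d%:R * (2 * rho + 1))%R -> m <= Y,
       X <= Y & Y <= W ^ 2] /\
   [/\ X' + d * (2 * W + 1) <= X.+1, d * h ^ 2 <= X', d * h ^ 2 <= X &
       Y <= X' + 2 * h * (15 * d ^ 2)].
Proof.
move=> d0 h5 rlo rhi W.
have dd1 : (1 <= d%:R :> R)%R by rewrite ler1n.
have hh5 : (5 <= h%:R :> R)%R by rewrite ler_nat.
move: rlo rhi; rewrite !natrM => rlo rhi.
set D : R := (d%:R)%R in dd1 rlo rhi *; set h' : R := (h%:R)%R in hh5 rlo rhi *.
have dh : (D <= D * h')%R by rewrite ler_peMr //; move: hh5; clear; lra.
have r0 : (0 <= rho)%R by move: rlo dh dd1; clear; lra.
(* Squared radius minus and plus the error of rounding points to cells; [X] and [Y] are the integer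
   parts. As [rho] and [W] are of order [d * h], this error and the shift [d * (2 * W + 1)] of the
   centre are of order [d ^ 2 * h], whence the width [15 * d ^ 2]. *)
set A := (rho ^+ 2 - D * (2 * rho + 1))%R; set B := (rho ^+ 2 + D * (2 * rho + 1))%R.
have WR : (W%:R = 4 * D * h' + D :> R)%R by rewrite natrD !natrM.
have p1 : (4 * (D * D * h' * h') - 4 * (D * D * h') <= rho ^+ 2 - 2 * D * rho)%R.
  have : (0 <= (rho - 2 * D * h') * (rho + 2 * D * h' - 2 * D))%R.
    by apply: mulr_ge0; [move: rlo|move: r0 dh]; clear; lra.
  clear; lra.
have DD : (0 <= D * (D - 1))%R by apply: mulr_ge0; move: dd1; clear; lra.
have DDh : (0 <= D * (D - 1) * (h' * h'))%R.
  by apply: mulr_ge0 => //; apply: mulr_ge0; move: hh5; clear; lra.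
(* From [h = 5] on the quadratic term outweighs the linear errors. *)
have DDhh : (0 <= D * D * (3 * h' * h' - 12 * h' - 4))%R.
  apply: mulr_ge0; first by apply: mulr_ge0; move: dd1; clear; lra.
  have : (0 <= (h' - 5) * (3 * h' + 3))%R by apply: mulr_ge0; move: hh5; clear; lra.
  by move: hh5; clear; lra.
have Alow : (D * h' ^+ 2 + D * (2 * (4 * D * h' + D) + 1) <= A)%R.
  by move: p1 DD DDh DDhh; rewrite /A; clear; lra.
have Apos : (0 <= A)%R.
  apply: le_trans Alow; apply: addr_ge0; first by apply: mulr_ge0 => //; exact: sqr_ge0.
  by apply: mulr_ge0; move: dh dd1; clear; lra.
have Bpos : (0 <= B)%R.
  by apply: addr_ge0; [exact: sqr_ge0|apply: mulr_ge0; move: r0 dd1; clear; lra].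
have [X [XA AX]] := exists_nat_floor Apos; have [Y [YB BY]] := exists_nat_floor Bpos.
have natX (m : nat) : (m%:R <= A)%R -> m <= X.
  by move=> mA; rewrite -ltnS -(ltr_nat R) -natr1; apply: le_lt_trans mA AX.
have bigX : d * h ^ 2 + d * (2 * W + 1) <= X.
  by apply: natX; rewrite natrD !natrM natrD natrM WR; exact: Alow.
exists X, (X.+1 - d * (2 * W + 1)), Y; split; split.
- by move=> m mX; apply: le_trans XA; rewrite ler_nat.
- by move=> m mB; rewrite -ltnS -(ltr_nat R) -natr1; apply: le_lt_trans mB BY.
- rewrite -ltnS -(ltr_nat R) -natr1; apply: le_lt_trans XA _; apply: le_lt_trans BY.
  have : (0 <= D * (2 * rho + 1))%R by apply: mulr_ge0; move: dd1 r0; clear; lra.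
  by rewrite /A /B; clear; lra.
- rewrite -(ler_nat R) natrX WR; apply: le_trans YB _.
  have : ((rho + D) ^+ 2 <= (4 * D * h' + D) ^+ 2)%R.
    by rewrite ler_sqr ?nnegrE; move: rhi r0 dd1 dh; clear; lra.
  by move: DD; rewrite /B; clear; lra.
- by rewrite subnK // leqW //; apply: leq_trans bigX; exact: leq_addl.
- by move: bigX; clear; lia.
- by apply: leq_trans bigX; exact: leq_addr.
- rewrite -(ler_nat R) natrD natrB; last first.
    by rewrite leqW //; apply: leq_trans bigX; exact: leq_addl.
  rewrite -[(X.+1%:R)%R]natr1 !natrM natrD natrM WR -/D -/h'.
  have q1 : (D * rho <= D * (4 * D * h'))%R by apply: ler_wpM2l => //; move: dd1; clear; lra.
  have D2 : (0 <= D * D)%R by apply: mulr_ge0.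
  have q2 : (0 <= D * D * (h' - 5))%R by apply: mulr_ge0 => //; move: hh5; clear; lra.
  by move: YB AX DD q1 D2 q2; rewrite /A /B; clear; lra.
Qed.

(** Up to constants in [d] a shell has [h ^ d.-1] cells, so its share of [h.+1 ^ d] is of order
    [1 / h], which a large [h] pushes below [eta]. *)
Lemma shell_bound (R : realFieldType) (d h w : nat) (eta : R) (W Sh : nat) :
  0 < d -> 0 < h -> (0 <= eta)%R -> W = 4 * d * h + d ->
  ((2 * d * w.+1 * (11 * d) ^ d)%:R <= eta * h%:R)%R ->
  Sh * (2 * W).+1 <= d * (2 * w.+1) * (2 * W).+1 ^ d ->
  (Sh%:R <= eta * (h.+1 ^ d)%:R)%R.
Proof.
move=> d0 h0 eta0 WE etah ShP.
have W11 : (2 * W).+1 <= 11 * d * h.+1 by rewrite WE; move: d0 h0; clear; nia.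
have hW : h <= (2 * W).+1 by rewrite WE; move: d0; clear; nia.
have ShP' : Sh * (2 * W).+1 <= 2 * d * w.+1 * (11 * d) ^ d * h.+1 ^ d.
  apply: leq_trans ShP _; rewrite -[leqRHS]mulnA -expnMn.
  have -> : d * (2 * w.+1) = 2 * d * w.+1 by rewrite mulnCA mulnA.
  by rewrite leq_mul2l leq_exp2r // W11 orbT.
have Wpos : (0 < (2 * W).+1%:R :> R)%R by rewrite ltr0n.
rewrite -(ler_pM2r Wpos); apply: (@le_trans _ _ ((2 * d * w.+1 * (11 * d) ^ d * h.+1 ^ d)%:R)%R).
  by rewrite -natrM ler_nat.
rewrite [X in (X <= _)%R]natrM; apply: le_trans (ler_wpM2r _ etah) _ => //.
rewrite -!mulrA ler_wpM2l // mulrC ler_wpM2l // ler_nat //.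
Qed.

From mathcomp Require Import all_classical all_reals all_analysis measurable_realfun.
Import numFieldNormedType.Exports.

(** * From Euclidean to lattice distance *)

(** [degree] is stated with a classical set, the combinatorial part with finite sets. *)
Lemma degreeE (V : finType) (G : rel V) (v : V) :
  degree G v = #|[set u | G v u]%SET|.
Proof. by rewrite /degree; apply: eq_card => u; rewrite inE unfold_in /= asboolb. Qed.

Section LatticeDistance.
Variable R : realType.
Local Open Scope ring_scope.

Lemma absdiff_approx (a b : nat) (s t : R) :
  a%:R <= s < a%:R + 1 -> b%:R <= t < b%:R + 1 ->
  (absdiff a b)%:R <= `|s - t| + 1 /\ `|s - t| <= (absdiff a b)%:R + 1.
Proof.
move=> /andP[a1 a2] /andP[b1 b2]; rewrite /absdiff.
have [ab|/ltnW ba] := leqP a b.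
  have -> : (a - b + (b - a) = b - a)%N by move: ab; clear; lia.
  by rewrite natrB //; split; [have := ler_norm (- (s - t)); rewrite normrN; lra|
    rewrite ler_norml; apply/andP; split; have : a%:R <= b%:R :> R by rewrite ler_nat]; lra.
have -> : (a - b + (b - a) = a - b)%N by move: ba; clear; lia.
by rewrite natrB //; split; [have := ler_norm (s - t); lra|
  rewrite ler_norml; apply/andP; split; have : b%:R <= a%:R :> R by rewrite ler_nat]; lra.
Qed.

(** Each [z k] is at most [rho], so a square grows by at most [2 * rho + 1]. Exact and rounded
    differences exchange roles between the two directions of the comparison. *)
Lemma sum_sqr_shift (d : nat) (u z : 'I_d -> R) (rho : R) : 0 <= rho ->
  (forall k, 0 <= u k) -> (forall k, 0 <= z k) -> (forall k, u k <= z k + 1) ->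
  \sum_k z k ^+ 2 <= rho ^+ 2 ->
  \sum_k u k ^+ 2 <= \sum_k z k ^+ 2 + d%:R * (2 * rho + 1).
Proof.
move=> r0 u0 z0 uz sz.
have zr k : z k <= rho.
  rewrite -ler_sqr ?nnegrE //; apply: le_trans sz.
  by rewrite (bigD1 k) //= lerDl sumr_ge0 // => i _; exact: sqr_ge0.
have -> : d%:R * (2 * rho + 1) = \sum_(k < d) (2 * rho + 1).
  by rewrite sumr_const card_ord mulr_natl.
rewrite -big_split /=; apply: ler_sum => k _.
have : u k ^+ 2 <= (z k + 1) ^+ 2 by rewrite ler_sqr ?nnegrE // addr_ge0.
have := zr k; lra.
Qed.

Variables (d S : nat) (r : R).
Hypotheses (S0 : (0 < S)%N) (r0 : 0 <= r).
Variables (x y : rpoint R d) (a b : {ffun 'I_d -> 'I_S}).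
Hypothesis xa : forall k, (a k)%:R <= (tnth x k : R) * S%:R < (a k)%:R + 1.
Hypothesis yb : forall k, (b k)%:R <= (tnth y k : R) * S%:R < (b k)%:R + 1.
Let rho := r * S%:R.
Let u k : R := `|(tnth x k : R) * S%:R - (tnth y k : R) * S%:R|.
Let z k : R := (absdiff (a k) (b k))%:R.

Lemma dist_scaled : (euclidean_dist x y <= r) = (\sum_k u k ^+ 2 <= rho ^+ 2).
Proof.
have Sp : 0 < S%:R ^+ 2 :> R by rewrite exprn_gt0 // ltr0n.
have -> : \sum_k u k ^+ 2 = (\sum_(k < d) ((tnth x k : R) - (tnth y k : R)) ^+ 2) * S%:R ^+ 2.
  rewrite mulr_suml; apply: eq_bigr => k _.
  by rewrite /u -mulrBl real_normK ?num_real // exprMn.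
rewrite /rho exprMn ler_pM2r // /euclidean_dist.
rewrite -{1}(ger0_norm r0) -sqrtr_sqr ler_sqrt //.
exact: sqr_ge0.
Qed.

Lemma qdistR : (qdist a b)%:R = \sum_k z k ^+ 2.
Proof. by rewrite /qdist natr_sum; apply: eq_bigr => k _; rewrite natrX. Qed.

Lemma dist_le_of_qdist :
  (qdist a b)%:R <= rho ^+ 2 - d%:R * (2 * rho + 1) -> euclidean_dist x y <= r.
Proof.
have rho0 : 0 <= rho by rewrite mulr_ge0.
have dr0 : 0 <= d%:R * (2 * rho + 1) by rewrite mulr_ge0 // addr_ge0 // mulr_ge0.
rewrite dist_scaled qdistR => h.
have uz k : u k <= z k + 1 by have [_] := absdiff_approx (xa k) (yb k).
have h' : \sum_k z k ^+ 2 <= rho ^+ 2 by move: h dr0; lra.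
apply: le_trans (sum_sqr_shift rho0 (fun k => normr_ge0 _) (fun k => ler0n _ _) uz h') _.
by move: h; lra.
Qed.

Lemma qdist_le_of_dist :
  euclidean_dist x y <= r -> (qdist a b)%:R <= rho ^+ 2 + d%:R * (2 * rho + 1).
Proof.
have rho0 : 0 <= rho by rewrite mulr_ge0.
rewrite dist_scaled qdistR => h.
have zu k : z k <= u k + 1 by have [] := absdiff_approx (xa k) (yb k).
apply: le_trans (sum_sqr_shift rho0 (fun k => ler0n _ _) (fun k => normr_ge0 _) zu h) _.
by rewrite lerD2r.
Qed.
End LatticeDistance.

(** * Choice of the constants *)

Lemma sum3_le (R : realDomainType) (a b c m : R) :
  (a + b + c <= m)%R -> (0 <= a)%R -> (0 <= b)%R -> (0 <= c)%R ->
  [/\ a <= m, b <= m & c <= m]%R.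
Proof. by move=> *; split; lra. Qed.

Lemma exists_nat_ge (R : realType) (x : R) : exists2 k : nat, 0 < k & (x <= k%:R)%R.
Proof.
exists (Num.bound `|x|%R).+1 => //; apply: le_trans (ler_norm _) _.
apply: ltW; apply: lt_trans (archi_boundP (normr_ge0 x)) _.
by rewrite ltr_nat.
Qed.

(** The factor 24 makes the exponential at most the inverse cube of [n], against at most
    [4 * n ^ 2 * M] pairs of a set and a colour. *)
Lemma union_bound_small (R : realType) (n s M : nat) (mu t C : R) :
  0 < n -> 0 < M -> (0 < t)%R -> (1 <= mu)%R -> (mu * s%:R = n%:R)%R ->
  (24 * M%:R / t ^+ 2 <= C)%R -> (C * ln n%:R <= mu)%R -> 8 * M < n ->
  ((2 * n%:R + n%:R ^+ 2 + s%:R) * M%:R * (2 * expR (- (t ^+ 2 * (mu / M%:R) / 8))) < 1)%R.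
Proof.
move=> n0 M0 t0 mu1 mus CM Cmu nM.
have n0' : (0 < n%:R :> R)%R by rewrite ltr0n.
have n1 : (1 <= n%:R :> R)%R by rewrite ler1n.
have M0' : (0 < M%:R :> R)%R by rewrite ltr0n.
have t2 : (0 < t ^+ 2)%R by rewrite exprn_gt0.
have ln0 : (0 <= ln n%:R :> R)%R by rewrite ln_ge0.
have sn : (s%:R <= n%:R :> R)%R by rewrite -mus ler_peMl.
have e3 : (expR (- (t ^+ 2 * (mu / M%:R) / 8)) <= (n%:R ^+ 3)^-1)%R.
  have -> : ((n%:R ^+ 3)^-1 = expR (- (3 * ln n%:R)) :> R)%R.
    by rewrite expRN expRM_natl lnK ?posrE.
  rewrite ler_expR lerN2.
  have h1 : (24 * M%:R / t ^+ 2 * ln n%:R <= mu)%R.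
    by apply: le_trans Cmu; apply: ler_wpM2r.
  have -> : (t ^+ 2 * (mu / M%:R) / 8 = (t ^+ 2 / (8 * M%:R)) * mu)%R by field; rewrite lt0r_neq0.
  apply: le_trans (ler_wpM2l _ h1); last by rewrite divr_ge0 // ltW // mulr_gt0.
  by rewrite le_eqVlt; apply/orP; left; apply/eqP; field; rewrite !lt0r_neq0.
have s1 : (2 * n%:R + n%:R ^+ 2 + s%:R <= 4 * n%:R ^+ 2 :> R)%R.
  have : (n%:R <= n%:R * n%:R :> R)%R by rewrite ler_peMr // ltW.
  by move: sn; clear; lra.
apply: le_lt_trans (_ : (4 * n%:R ^+ 2 * M%:R * (2 * (n%:R ^+ 3)^-1) < 1)%R).
  apply: ler_pM.
  - by rewrite mulr_ge0 // !addr_ge0 // ?sqr_ge0 // mulr_ge0.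
  - by rewrite mulr_ge0 // expR_ge0.
  - by rewrite ler_wpM2r.
  - by rewrite ler_wpM2l.
have -> : (4 * n%:R ^+ 2 * M%:R * (2 * (n%:R ^+ 3)^-1) = (8 * M)%:R / n%:R :> R)%R.
  by rewrite natrM; field; rewrite lt0r_neq0.
by rewrite ltr_pdivrMr // mul1r ltr_nat.
Qed.

(** The gain [2 * eps * mu * q] dominates the shell term, about [eps / 20] of [mu * q], and
    [40 / eps <= q] absorbs the constants. *)
Lemma common_bound (R : realFieldType) (eps eta mu sigma q : R) :
  (0 < eps)%R -> (eps <= 1 / 2)%R -> eta = (eps / 40)%R -> (1 <= mu)%R ->
  (sigma <= eta * q)%R -> (40 / eps <= q)%R ->
  (mu <= 2 * eps * ((1 - eta) * mu * q - 1) - 2 * ((1 + eta) * mu * sigma + 1))%R.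
Proof.
move=> e0 e1 etaE mu1 sq bigq.
have eq40 : (40 <= q * eps)%R by rewrite -ler_pdivrMr.
have h1 : ((1 + eta) * mu * sigma <= (1 + eta) * mu * (eta * q))%R.
  by apply: ler_wpM2l => //; apply: mulr_ge0; rewrite ?etaE; move: e0 mu1; clear; lra.
have h2 : (40 * mu <= mu * (q * eps))%R by rewrite mulrC; apply: ler_wpM2l; move: mu1 eq40; clear; lra.
have h3 : (0 <= mu * (q * eps) * (1 / 2 - eps))%R.
  by apply: mulr_ge0; [apply: mulr_ge0|]; move: mu1 eq40 e1; clear; lra.
have h4 : (0 <= mu * (q * eps) * eps)%R.
  by apply: mulr_ge0; [apply: mulr_ge0|]; move: mu1 eq40 e0; clear; lra.
move: h1 h2 h3 h4 e0 e1 mu1; rewrite etaE; clear; lra.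
Qed.

Lemma exists_tolerance (R : realFieldType) (eps m q : R) :
  (0 < eps)%R -> (0 < m)%R -> (1 <= q)%R ->
  exists t : R, [/\ 0 < t, t <= 1, t <= eps ^+ 2 / (16 * (1000 * m)) & t * q <= 1 / 8]%R.
Proof.
move=> e0 m0 q1; have q0 : (0 < q)%R by apply: lt_le_trans q1.
exists (Num.min (eps ^+ 2 / (16 * (1000 * m))) (1 / (8 * q)))%R.
have h1 : (0 < eps ^+ 2 / (16 * (1000 * m)))%R.
  apply: divr_gt0; first exact: exprn_gt0.
  by move: m0; clear; lra.
have h2 : (0 < 1 / (8 * q))%R by apply: divr_gt0 => //; apply: mulr_gt0.
have h3 : (1 / (8 * q) <= 1 / 8)%R by rewrite !div1r lef_pV2 ?posrE ?mulr_gt0 // ler_peMr.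
split.
- by rewrite lt_min h1.
- by rewrite ge_min; apply/orP; right; apply: (le_trans h3); lra.
- by rewrite ge_min lexx.
- rewrite -ler_pdivlMr // ge_min; apply/orP; right.
  by rewrite le_eqVlt; apply/orP; left; apply/eqP; field; rewrite lt0r_neq0.
Qed.

(** Order of choice: [h] makes shells thin against balls, [T] makes shallow cells rare, then come
    the numbers of colours, the tolerance [t], and last the density [C] and [n0]; nothing depends on
    a later choice. *)
Lemma cycles_in_lattice_graphs (R : realType) (eps : R) (d : nat) :
  (0 < eps)%R -> (eps <= 1 / 2)%R -> 0 < d ->
  exists (T h N n0 : nat) (eta C : R), [/\ 0 < T, 0 < h, (0 < eta < 1)%R & (0 < C)%R] /\
  forall (n Bn : nat) (r : R) (x : 'I_n -> rpoint R d)
    (cell : 'I_n -> {ffun 'I_d -> 'I_(Bn * T)}) (H : rel 'I_n),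
  n0 <= n -> 0 < Bn -> (0 <= r)%R ->
  ((2 * d * h)%:R <= r * (Bn * T)%:R)%R -> (r * (Bn * T)%:R <= (4 * d * h)%:R)%R ->
  let mu : R := (n%:R / ((Bn * T) ^ d)%:R)%R in
  (C * ln n%:R <= mu)%R ->
  (forall i k, (cell i k)%:R <= (tnth (x i) k : R) * (Bn * T)%:R < (cell i k)%:R + 1)%R ->
  (forall c, (1 - eta) * mu <= #|[set i | cell i == c]|%:R <= (1 + eta) * mu)%R ->
  alpha_subgraph (1 / 2 + eps)%R (geometric_graph x r) H ->
  forall (L : nat) (v : 'I_n), N < L -> (L%:R <= 2 * n%:R / 3 :> R)%R ->
  exists c : seq 'I_n, [/\ is_cycle H c, size c = L & v \in c].
Proof.
move=> e0 e1 d0.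
have [eta etaE] : exists x, x = (eps / 40)%R by eexists.
have eta0 : (0 < eta)%R by rewrite etaE divr_gt0.
pose w := 15 * d ^ 2.
have [h1 h1_gt0 h1P] := exists_nat_ge (40 / eps)%R.
have [h2 h2_gt0 h2P] := exists_nat_ge ((2 * d * w.+1 * (11 * d) ^ d)%:R / eta)%R.
pose h := h1 + h2 + 5.
have h5 : 5 <= h by exact: leq_addl.
have [t0 t0_gt0 t0P] := exists_nat_ge (800 * d%:R ^+ 2 / eps)%R.
pose T := t0 * h; pose W := 4 * d * h + d; pose N := 6 * T + 1.
have T0 : 0 < T by rewrite muln_gt0 t0_gt0; apply: leq_trans h5.
have [e' e'_gt0 e'P] := exists_nat_ge (40 / eps)%R.
(* Conflicting links use about [17 ^ d * q0 * N] reserve vertices, with [q0] near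
   [2 * mu * T ^ d / K], while a cell offers of order [r0 * mu / M]. As [K] is comparable to [M],
   both scale with [mu / M], so [r0] is fixed before [K] and [mu]. *)
have [r0 r0E] : exists k, k = 128 * 17 ^ d * N * T ^ d by eexists.
(* Then [K / M = e' / e'.+1] is at least [1 - eps / 40]: the colours without paths cost less than
   the gain [eps / 16]. *)
have [K KE] : exists k, k = e' * r0.+1 by eexists.
have [M MK] : exists k, k = (K + r0).+1 by eexists.
have ME : M = e'.+1 * r0.+1 by rewrite MK KE mulSn addSn addnC.
pose E := K + N.+1.*2.
have [c1 c1E] : exists k, k = 17 ^ d * (3 ^ d + 2) * N + (N + E).+1 + (N + E) + 1.
  by eexists.
have M0 : (0 < M%:R :> R)%R by rewrite MK ltr0n.
have W1 : (1 <= (W.*2.+1 ^ d)%:R :> R)%R by rewrite ler1n expn_gt0.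
have [t [tpos t1 tM tW]] := exists_tolerance e0 M0 W1.
have [mu0 [mu01 mu0c mu0a]] : exists m : R,
   [/\ 1 <= m, (32 * e'.+1 * c1)%:R <= m & (4 * M * (3 ^ d + 2))%:R <= m]%R.
  exists (1 + (32 * e'.+1 * c1)%:R + (4 * M * (3 ^ d + 2))%:R)%R.
  move: (ler0n R (32 * e'.+1 * c1)) (ler0n R (4 * M * (3 ^ d + 2))); clear.
  by move: (_%:R)%R (_%:R)%R => x y x0 y0; split; lra.
have [C [Cmu0 Ct]] : exists C : R, (mu0 <= C /\ 24 * M%:R / t ^+ 2 <= C)%R.
  exists (mu0 + 24 * M%:R / t ^+ 2)%R; rewrite lerDl lerDr; split.
    by rewrite divr_ge0 ?sqr_ge0 // mulr_ge0.
  exact: le_trans ler01 mu01.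
(* The three terms give [ln n >= 1], absorb the rounding of [kd], and absorb the errors of size [K]
   in [p * K]. *)
have [n1 n1_gt0 n1P] := exists_nat_ge (expR 1 + 40 / eps + 60 * K%:R / eps)%R.
pose n0 := n1 + (8 * M).+1.
have C0 : (0 < C)%R by apply: lt_le_trans Cmu0; apply: lt_le_trans mu01.
exists T, h, N, n0, eta, C; split.
  split=> //; first by rewrite addn_gt0 addn_gt0 h1_gt0.
  by rewrite eta0 /= etaE; move: e1; clear; lra.
move=> n Bn r x cell H n0n B0 r_ge0 rlo rhi mu Cmu boxes counts [Hsym HG Hdeg] L v NL Ln.
have S0 : 0 < Bn * T by rewrite muln_gt0 B0.
have nbig : (expR 1 + 40 / eps + 60 * K%:R / eps <= n%:R)%R.
  apply: (le_trans n1P); rewrite ler_nat; apply: leq_trans n0n; exact: leq_addr.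
have eps40 : (0 <= 40 / eps)%R by rewrite divr_ge0 // ltW.
have K60 : (0 <= 60 * K%:R / eps)%R by rewrite divr_ge0 ?mulr_ge0 // ltW.
have [nexp n40 nK] := sum3_le nbig (expR_ge0 1) eps40 K60.
have nM : 8 * M < n by apply: leq_trans n0n; exact: leq_addl.
have n_gt0 : 0 < n by apply: leq_ltn_trans nM.
have lnn : (1 <= ln n%:R :> R)%R.
  by rewrite -[leLHS](expRK 1%R) ler_ln ?posrE ?expR_gt0 ?ltr0n.
have mumu0 : (mu0 <= mu)%R.
  apply: le_trans Cmu; apply: (@le_trans _ _ (C * 1)%R); first by rewrite mulr1.
  by apply: ler_wpM2l => //; exact: ltW.
have mu1 : (1 <= mu)%R := le_trans mu01 mumu0.
have mupos : (0 < mu)%R by apply: lt_le_trans mu1.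
have muS : (mu * ((Bn * T) ^ d)%:R = n%:R)%R.
  by rewrite /mu mulfVK // pnatr_eq0 -lt0n expn_gt0 S0.
pose rho := (r * (Bn * T)%:R)%R.
have [X [X' [Y [[XP YP XY YW] [X'X X'h Xh YX']]]]] := lattice_params d0 h5 rlo rhi.
have T5 : 5 * d <= t0.
  rewrite -(ler_nat R) natrM; apply: le_trans t0P.
  rewrite ler_pdivlMr //.
  have d1 : (1 <= d%:R :> R)%R by rewrite ler1n.
  have : (0 <= d%:R * (d%:R - 1) :> R)%R by apply: mulr_ge0 => //; move: d1; clear; lra.
  have : (d%:R * eps <= d%:R * (1 / 2))%R by apply: ler_wpM2l.
  move: d1; clear; lra.
have WT : W <= T.
  apply: leq_trans (_ : 5 * d * h <= _); last by rewrite leq_mul2r T5 orbT.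
  by rewrite /W; move: h5; clear; nia.
have W0' : 0 < h by apply: leq_trans h5.
have Wlt2 : 2 * h < Bn * T.
  apply: leq_trans (_ : T <= _); last by rewrite leq_pmull.
  apply: leq_trans (_ : 5 * d * h <= _); last by rewrite leq_mul2r T5 orbT.
  by move: W0' d0; clear; nia.
have etah : ((2 * d * w.+1 * (11 * d) ^ d)%:R <= eta * h%:R)%R.
  move: h2P; rewrite ler_pdivrMr // mulrC => /le_trans; apply.
  by apply: ler_wpM2l; [exact: ltW|rewrite ler_nat /h; clear; lia].
have qh : (40 / eps <= (h.+1 ^ d)%:R)%R.
  apply: (le_trans h1P); rewrite ler_nat; apply: leq_trans (_ : h.+1 ^ 1 <= _).
    by rewrite expn1 /h; clear; lia.
  by rewrite leq_pexp2l.
have shell (a : {ffun 'I_d -> 'I_(Bn * T)}) :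
   (#|[set c | X' <= qdist a c <= Y]%N|%:R <= eta * (h.+1 ^ d)%:R)%R.
  apply: (shell_bound (w := w) (W := W) d0 W0' (ltW eta0)) => //.
  exact: (shell_card a d0 YW X'h W0' YX').
have sigma_eta := lexx (eta * (h.+1 ^ d)%:R)%R.
have Kpos : 0 < K by rewrite KE muln_gt0 e'_gt0.
have K1 : 1 < K.
  rewrite KE -(ltr_nat R) natrM; apply: (@lt_le_trans _ _ (40 / eps)%R).
    by rewrite ltr_pdivlMr //; move: e1; clear; lra.
  by apply: (le_trans e'P); rewrite ler_peMr // ler1n.
have [q0 [q0lo q0hi]] : exists k : nat, ((2 * mu * (T ^ d)%:R <= K%:R * k%:R) /\
    K%:R * k%:R <= 2 * mu * (T ^ d)%:R + K%:R)%R.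
  have K0' : (0 < K%:R :> R)%R by rewrite ltr0n.
  have [|k [k1 k2]] := @exists_nat_floor R (2 * mu * (T ^ d)%:R / K%:R)%R.
    by rewrite divr_ge0 // mulr_ge0 // mulr_ge0 // ltW.
  exists k.+1; rewrite -[(k.+1%:R)%R]natr1 mulrDr mulr1; split.
    by move: k2; rewrite ltr_pdivrMr //; clear; lra.
  by move: k1; rewrite ler_pdivlMr //; clear; lra.
have [cap [capl caph]] : exists k : nat, (k%:R <= r0%:R / M%:R * (mu / 8) /\
   r0%:R / M%:R * (mu / 8) < k%:R + 1)%R.
  by apply: exists_nat_floor; rewrite mulr_ge0 // divr_ge0 // ltW.
have [p [pl ph]] : exists k : nat, (k%:R <= (2 / 3 + eps / 16) * n%:R / M%:R /\
   (2 / 3 + eps / 16) * n%:R / M%:R < k%:R + 1)%R.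
  apply: exists_nat_floor; rewrite divr_ge0 // mulr_ge0 //.
  by move: e0; clear; lra.
have Tpos : (0 < T%:R :> R)%R by rewrite ltr0n.
have Gnear u v' : u != v' -> qdist (cell u) (cell v') <= X -> geometric_graph x r u v'.
  move=> uv quv; rewrite /geometric_graph uv /=.
  exact: (dist_le_of_qdist S0 r_ge0 (boxes u) (boxes v') (XP _ quv)).
have Gfar u v' : geometric_graph x r u v' -> qdist (cell u) (cell v') <= Y.
  move=> /andP[_ duv]; apply: YP.
  exact: (qdist_le_of_dist S0 r_ge0 (boxes u) (boxes v') duv).
have Hdeg' u : ((1 / 2 + eps) * #|[set w | geometric_graph x r u w]%SET|%:R <=
     #|[set w | H u w]%SET|%:R)%R.
  by have := Hdeg u; rewrite !degreeE.
have bigball : (40 / eps <= mu * (h.+1 ^ d)%:R)%R.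
  by apply: (le_trans qh); apply: ler_peMl.
have shallow : ((1 + eta) * (d * (2 * W))%:R <= eps / 40 * T%:R)%R.
  have dW : ((d * (2 * W))%:R <= (10 * d ^ 2 * h)%:R :> R)%R.
    by rewrite ler_nat /W; move: d0 h5; clear; nia.
  apply: (@le_trans _ _ (2 * (10 * d ^ 2 * h)%:R)%R).
    by apply: ler_pM => //; rewrite etaE; move: e0 e1; clear; lra.
  rewrite !natrM; have := t0P; rewrite ler_pdivrMr // => t0P'.
  have : (800 * d%:R ^+ 2 * h%:R <= t0%:R * eps * h%:R)%R by apply: ler_wpM2r.
  by clear; lra.
have common := common_bound e0 e1 etaE mu1 sigma_eta qh.
have union : ((2 * #|'I_n|%:R + #|'I_n|%:R ^+ 2 + ((Bn * T) ^ d)%:R) * M%:R *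
     (2 * expR (- (t ^+ 2 * (mu / M%:R) / 8))) < 1)%R.
  by rewrite card_ord; apply: (union_bound_small n_gt0 _ tpos mu1 muS Ct Cmu nM); rewrite MK.
have r0_gt0 : 0 < r0 by rewrite r0E !muln_gt0 !expn_gt0 T0 /N addn1.
have r01 : (1 <= r0%:R :> R)%R by rewrite ler1n.
have a0 : (0 < e'.+1%:R :> R)%R by rewrite ltr0n.
have MR : (M%:R = e'.+1%:R * (r0%:R + 1) :> R)%R by rewrite ME natrM natr1.
have KR : (K%:R = e'%:R * (r0%:R + 1) :> R)%R by rewrite KE natrM natr1.
have e'1 : (1 <= e'%:R :> R)%R by rewrite ler1n.
have aE : (e'.+1%:R = e'%:R + 1 :> R)%R by rewrite natr1.
have K0 : (0 < K%:R :> R)%R by rewrite ltr0n.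
have r0M : (1 / (2 * e'.+1%:R) <= r0%:R / M%:R :> R)%R.
  rewrite ler_pdivlMr // MR.
  have -> : (1 / (2 * e'.+1%:R) * (e'.+1%:R * (r0%:R + 1)) = (r0%:R + 1) / 2 :> R)%R.
    by field; rewrite lt0r_neq0.
  by move: r01; clear; lra.
have capP : (cap%:R < r0%:R / M%:R * (mu / 4))%R.
  apply: (le_lt_trans capl); rewrite ltr_pM2l; last by rewrite divr_gt0 // ltr0n.
  by move: mupos; clear; lra.
have availP : ((3 ^ d + 2)%:R <= mu / (4 * M%:R))%R.
  rewrite ler_pdivlMr ?mulr_gt0 //; apply: le_trans (le_trans mu0a mumu0).
  by rewrite !natrM mulrC.
(* One half of [mu / (16 * e'.+1)] covers the term with [q0], the other the constant [c1], which
   includes the rounding of [q0] and [cap]. *)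
have f0P : 17 ^ d * (q0 + (3 ^ d).+1) * N + (N + E).+1 + (N + E) <= cap.
  pose P := 17 ^ d * N.
  have PR : (128 * P%:R * (T ^ d)%:R = r0%:R :> R)%R.
    by rewrite r0E -!natrM /P; congr (_%:R)%R; clear; lia.
  have Pq : (P%:R * q0%:R <= mu / (32 * e'.+1%:R) + P%:R)%R.
    rewrite -(ler_pM2r K0).
    have q1 : (P%:R * (K%:R * q0%:R) <= P%:R * (2 * mu * (T ^ d)%:R + K%:R))%R.
      by apply: ler_wpM2l.
    have q2 : (mu * r0%:R / 64 <= mu / (32 * e'.+1%:R) * K%:R)%R.
      have -> : (mu / (32 * e'.+1%:R) * K%:R = mu * (K%:R / e'.+1%:R) / 32)%R.
        by field; rewrite lt0r_neq0.
      have : (r0%:R / 2 <= K%:R / e'.+1%:R :> R)%R.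
        rewrite ler_pdivlMr // KR aE.
        have : (r0%:R * 1 <= r0%:R * e'%:R :> R)%R by apply: ler_wpM2l.
        by move: e'1; clear; lra.
      move: (K%:R / e'.+1%:R)%R => z /(ler_wpM2l (ltW mupos)).
      by clear; lra.
    move: q1 q2; rewrite -PR; move: (mu / (32 * e'.+1%:R))%R => y.
    move: (P%:R : R)%R ((T ^ d)%:R : R)%R (q0%:R : R)%R (K%:R : R)%R; clear.
    by move=> P' T' q' K' q1 q2; lra.
  have mu16 : (mu / (16 * e'.+1%:R) <= r0%:R / M%:R * (mu / 8))%R.
    have -> : (mu / (16 * e'.+1%:R) = 1 / (2 * e'.+1%:R) * (mu / 8))%R.
      by field; rewrite lt0r_neq0.
    by apply: ler_wpM2r => //; apply: divr_ge0 => //; exact: ltW.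
  have c1mu : (c1%:R <= mu / (32 * e'.+1%:R))%R.
    rewrite ler_pdivlMr ?mulr_gt0 //; apply: le_trans (le_trans mu0c mumu0).
    by rewrite natrM natrM mulrC.
  rewrite -ltnS -(ltr_nat R) -[(cap.+1%:R)%R]natr1; apply: le_lt_trans caph.
  apply: le_trans mu16.
  have -> : (mu / (16 * e'.+1%:R) = mu / (32 * e'.+1%:R) + mu / (32 * e'.+1%:R))%R.
    by field; rewrite lt0r_neq0.
  apply: le_trans (lerD (lexx _) c1mu); rewrite c1E.
  have -> : 17 ^ d * (q0 + (3 ^ d).+1) * N + (N + E).+1 + (N + E) =
     P * q0 + (P * (3 ^ d).+1 + (N + E).+1 + (N + E)).
    by rewrite /P; clear; lia.
  have -> : 17 ^ d * (3 ^ d + 2) * N + (N + E).+1 + (N + E) + 1 =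
     P + (P * (3 ^ d).+1 + (N + E).+1 + (N + E)) + 1.
    by rewrite /P; clear; lia.
  move: (P * (3 ^ d).+1 + (N + E).+1 + (N + E)) Pq => z.
  move: (mu / (32 * e'.+1%:R))%R => y; rewrite !natrD natrM.
  move=> Pq; apply: le_trans (lerD Pq (lexx (z%:R)%R)) _.
  by rewrite !addrA lerDl.
have pM : (p%:R * M%:R <= (2 / 3 + eps / 16) * #|'I_n|%:R)%R.
  by rewrite card_ord -ler_pdivlMr.
have pK : (2 / 3 * #|'I_n|%:R + K%:R <= p%:R * K%:R :> R)%R.
  rewrite card_ord.
  have h3 : (((2 / 3 + eps / 16) * n%:R / M%:R) * K%:R <= (p%:R + 1) * K%:R)%R.
    by apply: ler_wpM2r => //; exact: ltW.
  have h4 : ((2 / 3 + eps / 16) * n%:R * (1 - eps / 40) <=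
             ((2 / 3 + eps / 16) * n%:R / M%:R) * K%:R)%R.
    rewrite -[leRHS]mulrA; apply: ler_wpM2l.
      by apply: mulr_ge0 => //; move: e0; clear; lra.
    have -> : (M%:R^-1 * K%:R = 1 - 1 / e'.+1%:R :> R)%R.
      rewrite MR KR aE; field; apply/andP; split; apply: lt0r_neq0;
        by move: r01 e'1; clear; lra.
    have : (1 / e'.+1%:R <= eps / 40)%R.
      rewrite ler_pdivrMr // aE.
      have : (40 <= e'%:R * eps)%R by rewrite -ler_pdivrMr.
      by move: e0; clear; lra.
    by move=> le_e; apply: lerB.
  have h6 : (60 * K%:R <= n%:R * eps)%R by rewrite -ler_pdivrMr.
  have h7 : (0 <= n%:R * eps * (1 / 2 - eps))%R.
    by apply: mulr_ge0; [apply: mulr_ge0 => //; exact: ltW|move: e1; clear; lra].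
  have h8 := le_trans h4 h3; move: h8 h6 h7 K0.
  by move: (n%:R : R)%R (K%:R : R)%R (p%:R : R)%R; clear => m k' p' h8 h6 h7 K0; lra.
have := @cycles_from_cells R d Bn T W X X' Y h K r0 cap q0 p 'I_n cell (geometric_graph x r) H
  mu eta eps (eta * (h.+1 ^ d)%:R)%R t.
rewrite /= -MK -/N -/E => NL'.
have [||||||c [c1' c2' c3' c4']] := NL' _ _ mupos B0 T0 WT K1 _ counts Gnear Gfar XY YW X'X shell
  (fun a => ball_card_lower a Wlt2 Xh) Hsym HG Hdeg' sigma_eta bigball shallow common
  _ tM tW union capP availP q0lo f0P pM pK _ L v NL _.
- by rewrite e0.
- by rewrite (ltW eta0) etaE lexx.
- by rewrite card_ord.
- by rewrite (ltW tpos).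
- by rewrite card_ord.
- by rewrite card_ord.
exists c; split=> //; rewrite /is_cycle c1' c2' c3' !andbT.
apply: (leq_ltn_trans _ NL); rewrite /N; move: T0; clear; lia.
Qed.
(** * Probability of the cell patterns *)

Section CubeMeasure.
Variable R : realType.
Local Open Scope classical_set_scope.
Local Open Scope ring_scope.

(** Half-open, so that boxes of different cells are disjoint. Points with a coordinate 1 lie in no
    cell, which is harmless since patterns only serve for lower bounds on probabilities. *)
Definition cube_box (d S : nat) (a : 'I_d -> nat) : set (rpoint R d) :=
  [set x | forall k, (a k)%:R <= (tnth x k : R) * S%:R < (a k)%:R + 1].

Lemma measurable_cube_box (d S : nat) (a : 'I_d -> nat) : (0 < S)%N ->
  measurable (@cube_box d S a).
Proof.
move=> S0; have S0' : 0 < S%:R :> R by rewrite ltr0n.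
have -> : @cube_box d S a = \bigcap_(k in [set: 'I_d])
   ((fun x : rpoint R d => tnth x k) @^-1` `[(a k)%:R / S%:R, ((a k)%:R + 1) / S%:R[).
  apply/seteqP; split => x /= h k.
    by move=> _ /=; rewrite in_itv /= ler_pdivrMr // ltr_pdivlMr //; exact: h.
  by have := h k I; rewrite /= in_itv /= ler_pdivrMr // ltr_pdivlMr.
apply: fin_bigcap_measurable; first exact: finite_finset.
move=> k _; rewrite -[X in measurable X]setTI; apply: measurable_tnth => //.
Qed.

Lemma uniform_prob_cell (S i : nat) : (i < S)%N ->
  uniform_prob (@ltr01 R) `[i%:R / S%:R, (i%:R + 1) / S%:R[ = (S%:R^-1)%:E.
Proof.
move=> iS; have S0' : 0 < S%:R :> R by rewrite ltr0n; apply: leq_ltn_trans iS.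
rewrite /uniform_prob (eq_integral (fun=> 1%:E)); last first.
  move=> x; rewrite inE /= in_itv /= => /andP[x1 x2].
  rewrite /uniform_pdf subr0 invr1.
  have -> // : 0 <= x <= 1.
  apply/andP; split; first by apply: le_trans x1; rewrite divr_ge0.
  apply: ltW; apply: lt_le_trans x2 _; rewrite ler_pdivrMr // mul1r natr1 ler_nat //.
rewrite integral_cst //= mul1e lebesgue_measure_itv /= lte_fin.
rewrite ltr_pM2r ?invr_gt0 // ltrDl ltr01 -EFinB; congr EFin.
by rewrite -mulrBl addrAC subrr add0r mul1r.
Qed.

Lemma uniform_cube_box (d S : nat) (a : 'I_d -> nat) : (forall k, (a k < S)%N) ->
  (0 < S)%N -> uniform_cube R d (@cube_box d S a) = ((S%:R ^+ d)^-1)%:E.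
Proof.
move=> + S0; elim: d a => [|d IH] a aS.
  rewrite /= expr0 invr1 diracE; have -> // : [tuple] \in @cube_box 0 S a.
  by rewrite inE => -[].
have mtail : measurable (@cube_box d S (fun k => a (lift ord0 k))).
  exact: measurable_cube_box.
have S0' : 0 < S%:R :> R by rewrite ltr0n.
pose I0 : set (measurableTypeR R) :=
  `[(a ord0)%:R / S%:R, ((a ord0)%:R + 1) / S%:R[%classic.
have mI0 : measurable I0 by exact: measurable_itv.
have e : (uniform_prob (@ltr01 R) \x uniform_cube R d)%E
    (I0 `*` @cube_box d S (fun k => a (lift ord0 k))) =
    ((S%:R ^+ d.+1)^-1)%:E.
  apply: (etrans (product_measure1E _ _ mI0 mtail)).
  rewrite exprS invfM EFinM; congr (_ * _)%E; first exact: uniform_prob_cell.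
  exact: IH.
rewrite -e /= /distribution /pushforward; congr (product_measure1 _ _ _); rewrite /I0.
apply/seteqP; split => -[x y] /= h.
  split; first by have := h ord0; rewrite /cons_point tnth0 in_itv /= ler_pdivrMr // ltr_pdivlMr.
  by move=> k; have := h (lift ord0 k); rewrite tnthS.
move: h; rewrite /= in_itv /= ler_pdivrMr // ltr_pdivlMr // => -[h0 h] k.
by case: (unliftP ord0 k) => [j|] ->; rewrite ?tnthS ?tnth0.
Qed.
End CubeMeasure.

Section Patterns.
Variables (R : realType) (disp : measure_display) (T : measurableType disp).
Variables (P : probability T R) (n d S : nat) (X : 'I_n -> {RV P >-> rpoint R d}).
Local Open Scope classical_set_scope.
Local Open Scope ring_scope.
Hypothesis S0 : (0 < S)%N.
Hypothesis Xunif : independent_uniform_points X.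
Local Notation cellT := {ffun 'I_d -> 'I_S}.

Definition pattern_event (g : {ffun 'I_n -> cellT}) : set T :=
  [set w | forall i, cube_box S (fun k => g i k) (X i w)].

Lemma pattern_eventE g : pattern_event g =
  \bigcap_(i in [set` [set: 'I_n]%SET]) (X i @^-1` cube_box S (fun k => g i k)).
Proof.
apply/seteqP; split => w /= h i; first by move=> _; exact: h.
by apply: h => /=; rewrite finset.in_setT.
Qed.

Lemma measurable_pattern_event g : measurable (pattern_event g).
Proof.
rewrite pattern_eventE; apply: fin_bigcap_measurable; first exact: finite_finset.
move=> i _; rewrite -[X in measurable X]setTI; apply: measurable_funP => //.
exact: measurable_cube_box.
Qed.

(** Equally likely patterns turn probabilities into counts of colourings of the points by cells. *)
Lemma pattern_event_prob g : P (pattern_event g) = (((S%:R ^+ d) ^+ n)^-1)%:E.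
Proof.
have [indep unif] := Xunif.
have mbox i : measurable (cube_box S (fun k => g i k) : set (rpoint R d)).
  exact: measurable_cube_box.
rewrite pattern_eventE (indep _ (fun i => cube_box S (fun k => g i k))) //.
rewrite (eq_bigr (fun=> ((S%:R ^+ d)^-1)%:E)); last first.
  move=> i _.
  exact: (etrans (unif i _ (mbox i)) (uniform_cube_box R (fun k => ltn_ord (g i k)) S0)).
rewrite (eq_bigl xpredT); last by move=> i; rewrite finset.in_setT.
rewrite prodEFin prodr_const card_ord exprVn //.
Qed.

Lemma pattern_event_disjoint g g' w :
  pattern_event g w -> pattern_event g' w -> g = g'.
Proof.
move=> h h'; apply/ffunP => i; apply/ffunP => k; apply: val_inj => /=.
have /andP[a1 a2] := h i k; have /andP[b1 b2] := h' i k.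
have := le_lt_trans a1 b2; rewrite natr1 ltr_nat ltnS => le1.
have := le_lt_trans b1 a2; rewrite natr1 ltr_nat ltnS => le2.
by apply/eqP; rewrite eqn_leq le1.
Qed.

Lemma prob_ge_patterns (A : set T) (Gs : {set {ffun 'I_n -> cellT}}) :
  measurable A -> (forall g, g \in Gs -> pattern_event g `<=` A) ->
  ((#|Gs|%:R / (S%:R ^+ d) ^+ n)%:E <= P A)%E.
Proof.
move=> mA GsA.
have sub : \bigcup_(g in [set` enum Gs]) pattern_event g `<=` A.
  by move=> w [g /= gG]; apply: GsA; rewrite -mem_enum.
apply: (le_trans _ (le_measure P _ _ sub)); last 2 first.
- rewrite inE; apply: fin_bigcup_measurable; first exact: finite_seq.
  by move=> g _; exact: measurable_pattern_event.
- by rewrite inE.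
rewrite measure_fin_bigcup //=.
- rewrite -fsbig_seq ?enum_uniq //.
  rewrite (eq_bigr (fun=> (((S%:R ^+ d) ^+ n)^-1)%:E)); last first.
    by move=> g _; exact: pattern_event_prob.
  by rewrite sumEFin big_const_seq count_predT -cardE iter_addr_0 -[X in (_ <= X%:E)%E]mulr_natl.
- move=> g g' _ _ [w [h h']]; exact: pattern_event_disjoint h h'.
- by move=> g _; exact: measurable_pattern_event.
Qed.

Lemma measurable_dist_le (r : R) (i j : 'I_n) :
  measurable [set w | euclidean_dist (X i w) (X j w) <= r].
Proof.
have mf : measurable_fun [set: T] (fun w => euclidean_dist (X i w) (X j w)).
  rewrite /euclidean_dist; apply: measurableT_comp; first exact: (continuous_measurable_fun (@sqrt_continuous R)).
  apply: measurable_sum => k.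
  apply: measurable_funX; apply: measurable_funB.
    apply: (measurableT_comp (f := fun x : rpoint R d => tnth x k : R)).
      exact: measurable_tnth.
    exact: measurable_funPT.
  apply: (measurableT_comp (f := fun x : rpoint R d => tnth x k : R)).
    exact: measurable_tnth.
  exact: measurable_funPT.
rewrite -[X in measurable X]setTI.
have -> : [set w | euclidean_dist (X i w) (X j w) <= r] =
  (fun w => euclidean_dist (X i w) (X j w)) @^-1` `]-oo, r].
  by apply/seteqP; split => w /=; rewrite in_itv.
by apply: mf => //; exact: measurable_itv.
Qed.

(** There are finitely many graphs on ['I_n], so any property, even one quantifying over all
    subgraphs, is a finite union of events determined by distances. *)
Lemma measurable_graph_property (r : R) (Q : rel 'I_n -> Prop) :
  measurable [set w | Q (geometric_graph (fun i => X i w) r)].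
Proof.
pose gr w : {ffun 'I_n * 'I_n -> bool} :=
  [ffun ij => geometric_graph (fun i => X i w) r ij.1 ij.2].
pose rel_of (b : {ffun 'I_n * 'I_n -> bool}) : rel 'I_n := fun i j => b (i, j).
have grE w : rel_of (gr w) = geometric_graph (fun i => X i w) r.
  by apply/funext => i; apply/funext => j; rewrite /rel_of ffunE.
have -> : [set w | Q (geometric_graph (fun i => X i w) r)] =
    \bigcup_(b in [set b | Q (rel_of b)])
      \bigcap_(ij in [set: 'I_n * 'I_n]) [set w | gr w ij = b ij].
  apply/seteqP; split => w /=.
    by move=> Qw; exists (gr w) => //=; rewrite grE.
  by move=> [b Qb h]; rewrite -grE; have -> : gr w = b by apply/ffunP => ij; exact: h.
apply: fin_bigcup_measurable; first exact: finite_finset.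
move=> b _; apply: fin_bigcap_measurable; first exact: finite_finset.
move=> [i j] _.
have mE : measurable [set w | geometric_graph (fun i => X i w) r i j].
  rewrite /geometric_graph; case: (i != j) => /=; last first.
    by rewrite [X in measurable X](_ : _ = set0) //; apply/seteqP; split.
  exact: measurable_dist_le.
case: (b (i, j)).
  rewrite [X in measurable X](_ : _ = [set w | geometric_graph (fun i => X i w) r i j]) //.
  by apply/seteqP; split => w /=; rewrite ffunE.
rewrite [X in measurable X](_ : _ = ~` [set w | geometric_graph (fun i => X i w) r i j]).
  exact: measurableC.
by apply/seteqP; split => w /=; rewrite ffunE /=; [move=> ->|move=> /negP/negbTE].
Qed.
End Patterns.

Local Open Scope classical_set_scope.
Local Open Scope ring_scope.

(** A pattern colours the points by cells, so [bad_colorings] applies with a single set, that of all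
    points. *)
Lemma good_pattern_bound (R : realType) (n d S : nat) (eta : R) :
  (0 < S)%N -> 0 < eta -> eta < 1 ->
  let mu : R := n%:R / (S ^ d)%:R in
  let Gs := [set g : {ffun 'I_n -> {ffun 'I_d -> 'I_S}} | [forall c,
     (1 - eta) * mu <= #|[set i | g i == c]%SET|%:R <= (1 + eta) * mu]]%SET in
  1 - (S ^ d)%:R * (2 * expR (- (eta ^+ 2 * mu / 8))) <= #|Gs|%:R / (S%:R ^+ d) ^+ n.
Proof.
move=> S0 eta0 eta1; cbv zeta; set mu : R := n%:R / (S ^ d)%:R.
pose Gs := [set g : {ffun 'I_n -> {ffun 'I_d -> 'I_S}} | [forall c,
     (1 - eta) * mu <= #|[set i | g i == c]%SET|%:R <= (1 + eta) * mu]]%SET.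
rewrite -[X in X%:R / _]/#|Gs|.
have cM : #|{ffun 'I_d -> 'I_S}| = (S ^ d)%N by rewrite card_ffun !card_ord.
have M0 : (0 < #|{ffun 'I_d -> 'I_S}|)%N by rewrite cM expn_gt0 S0.
have cT (j : unit) : #|[set: 'I_n]%SET|%:R <= n%:R :> R by rewrite cardsT card_ord.
have := bad_colorings M0 cT (ltW eta0) (ltW eta1).
rewrite cM card_unit card_ord mul1r -/mu.
pose Bad := [set g : {ffun 'I_n -> {ffun 'I_d -> 'I_S}} | [exists j : unit, [exists c,
  eta * mu < `|#|[set i in [set: 'I_n]%SET | g i == c]%SET|%:R
               - #|[set: 'I_n]%SET|%:R / (S ^ d)%:R|]]]%SET.
rewrite -[X in X%:R <= _]/#|Bad| => bad.
have GB : ~: Bad \subset Gs.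
  apply/fintype.subsetP => g; rewrite !inE negb_exists => /forallP /(_ tt).
  rewrite negb_exists => /forallP h; apply/forallP => c; have := h c.
  rewrite -leNgt cardsT card_ord -/mu ler_norml.
  have -> : [set i in [set: 'I_n]%SET | g i == c]%SET = [set i | g i == c]%SET.
    by apply/finset.setP => i; rewrite !inE.
  move=> /andP[g1 g2]; apply/andP; split; move: g1 g2; clear; lra.
have tot : (#|Bad| + #|~: Bad| = (S ^ d) ^ n)%N by rewrite cardsC card_ffun cM card_ord.
have Mn0 : 0 < (S ^ d)%:R ^+ n :> R by rewrite exprn_gt0 // ltr0n expn_gt0 S0.
have totR : #|Bad|%:R + #|~: Bad|%:R = (S ^ d)%:R ^+ n :> R by rewrite -natrD tot natrX.
have GBR : #|~: Bad|%:R <= #|Gs|%:R :> R by rewrite ler_nat subset_leq_card.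
rewrite -natrX ler_pdivlMr // mulrBl mul1r mulrC.
move: bad totR GBR; clear; lra.
Qed.

Lemma expR_neg_ln (R : realType) (n : nat) (eta mu C : R) :
  (0 < n)%N -> 0 < eta -> 16 / eta ^+ 2 <= C -> C * ln n%:R <= mu ->
  expR (- (eta ^+ 2 * mu / 8)) <= (n%:R ^+ 2)^-1.
Proof.
move=> n0 eta0 C16 Cmu; have n1 : 1 <= n%:R :> R by rewrite ler1n.
have -> : (n%:R ^+ 2)^-1 = expR (- (2 * ln n%:R)) :> R.
  by rewrite expRN expRM_natl lnK ?posrE ?ltr0n.
rewrite ler_expR lerN2.
have e2 : 0 < eta ^+ 2 by rewrite exprn_gt0.
have h1 : 16 / eta ^+ 2 * ln n%:R <= mu.
  by apply: le_trans Cmu; apply: ler_wpM2r => //; rewrite ln_ge0.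
have -> : 2 * ln n%:R = eta ^+ 2 * (16 / eta ^+ 2 * ln n%:R) / 8 :> R.
  by field; rewrite lt0r_neq0.
by rewrite ler_pM2r // ler_pM2l.
Qed.

(** * Scale of the blocks and the final probability bound *)

Lemma powR_root (R : realType) (d : nat) (a : R) : (0 < d)%N -> 0 <= a ->
  (a `^ d%:R^-1) ^+ d = a.
Proof.
move=> d0 a0; rewrite -powR_mulrn ?powR_ge0 // -powRrM mulVf ?powRr1 //.
by rewrite pnatr_eq0 -lt0n.
Qed.

(** The integer part of a number at least 1 exceeds half of it; the upper bound on [r] ensures that
    one block fits. *)
Lemma choose_block_number (R : realType) (a b r : R) :
  0 < r -> 0 < a -> 0 < b -> r <= 2 * a / b ->
  exists B : nat, [/\ (0 < B)%N, a <= r * (B%:R * b) & r * (B%:R * b) <= 2 * a].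
Proof.
move=> r0 a0 b0 rab; have rb : 0 < r * b by rewrite mulr_gt0.
have y1 : 1 <= 2 * a / (r * b).
  by rewrite ler_pdivlMr // mul1r; move: rab; rewrite ler_pdivlMr.
have [|B [B1 B2]] := @exists_nat_floor R (2 * a / (r * b)); first by apply: le_trans y1.
have B0 : (0 < B)%N.
  by rewrite lt0n; apply: contraTneq B2 => ->; rewrite add0r -leNgt.
exists B; split=> //.
  have BR : 1 <= B%:R :> R by rewrite ler1n.
  move: B2; rewrite ltr_pdivrMr //.
  have : 1 * (r * b) <= B%:R * (r * b) by rewrite ler_pM2r.
  by clear; lra.
by move: B1; rewrite ler_pdivlMr //; clear; lra.
Qed.

Definition robust_cycles (R : realType) (n : nat) (alpha c : R) (G : rel 'I_n) : Prop :=
  forall (L : nat) (H : rel 'I_n) (v : 'I_n),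
    c^-1 <= L%:R -> L%:R <= 2 * n%:R / 3 :> R -> alpha_subgraph alpha G H ->
    exists s : seq 'I_n, [/\ is_cycle H s, size s = L & v \in s].

(** There are at most [n] cells, and the Chernoff bound for a wrong count in one of them is at most
    [2 / n ^ 2]. *)
Lemma prob_cycles_ge (R : realType) (eps : R) (d : nat) :
  0 < eps -> eps <= 1 / 2 -> (0 < d)%N ->
  exists (c3 C3 : R) (n0 : nat), [/\ 0 < c3, 0 < C3 &
    forall (n : nat) (r : R) (disp : measure_display) (T : measurableType disp)
      (P : probability T R) (X : 'I_n -> {RV P >-> rpoint R d}),
    (n0 <= n)%N -> C3 * (ln n%:R / n%:R) `^ (d%:R^-1) <= r -> r <= c3 ->
    independent_uniform_points X ->
    ((1 - 2 / n%:R)%:E <=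
      P [set w : T | robust_cycles (1 / 2 + eps) c3 (geometric_graph (fun i => X i w) r)])%E].
Proof.
move=> eps0 eps1 d0.
have [T0 [h [N [n0 [eta [C [[T00 h0 /andP[eta0 eta1] C0] main]]]]]]] :=
  cycles_in_lattice_graphs eps0 eps1 d0.
pose K : R := (4 * d * h)%:R.
have K0 : 0 < K by rewrite ltr0n !muln_gt0 d0 h0.
pose C2 : R := C + 16 / eta ^+ 2 + 1.
have e16 : 0 < 16 / eta ^+ 2 by rewrite divr_gt0 ?ltr0n ?exprn_gt0.
have C21 : 1 <= C2 by rewrite /C2; move: C0 e16; clear; lra.
have T0R : 0 < T0%:R :> R by rewrite ltr0n.
(* The bound [1 / N.+1] turns [L >= 1 / c3] into [L > N], the bound [K / T0] makes room for one
   block, and [K * C2] yields [C2 * ln n <= mu]. *)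
exists (Num.min (N.+1%:R^-1) (K / T0%:R)), (K * C2), (maxn n0 4); split.
- by rewrite lt_min invr_gt0 ltr0n /= divr_gt0.
- by rewrite mulr_gt0 // (lt_le_trans ltr01).
move=> n r disp T P X; rewrite geq_max => /andP[nn0 n4] rlo.
rewrite le_min => /andP[rN rK] Xunif.
have n0R : 0 < n%:R :> R by rewrite ltr0n (leq_trans _ n4).
have ln1 : 1 <= ln n%:R :> R.
  have e4 : expR 1 <= 4 :> R.
    have h1 : 1 / 2 <= expR (- (1 / 2)) :> R.
      by apply: le_trans (expR_ge1Dx _); clear; lra.
    have -> : expR 1 = (expR (- (1 / 2)) ^+ 2)^-1 :> R.
      by rewrite -expRM_natl -expRN; congr expR; clear; lra.
    rewrite -[X in _ <= X]invrK lef_pV2 ?posrE ?exprn_gt0 ?expR_gt0 ?invr_gt0 //.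
    by apply: (le_trans _ (lerXn2r 2 _ _ h1)); rewrite ?nnegrE ?expR_ge0 //; clear; lra.
  rewrite -[X in X <= _](expRK (1 : R)) ler_ln ?posrE ?expR_gt0 //.
  by apply: (le_trans e4); rewrite ler_nat.
pose q : R := ln n%:R / n%:R.
have q0 : 0 < q by rewrite divr_gt0 // (lt_le_trans ltr01).
pose s : R := q `^ d%:R^-1.
have s0 : 0 < s by rewrite powR_gt0.
have sd : s ^+ d = q by apply: powR_root => //; exact: ltW.
rewrite -/q -/s in rlo.
have r0 : 0 < r.
  by apply: lt_le_trans rlo; rewrite !mulr_gt0 // (lt_le_trans ltr01).
have a0 : 0 < (2 * d * h)%:R :> R by rewrite ltr0n !muln_gt0 d0 h0.
have Ka : K = 2 * (2 * d * h)%:R by rewrite -natrM /K !mulnA.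
have rK' : r <= 2 * (2 * d * h)%:R / T0%:R by rewrite -Ka.
have [B [B0 Blo Bhi]] := choose_block_number r0 a0 T0R rK'.
rewrite -natrM in Blo Bhi; rewrite -Ka in Bhi.
have S0 : (0 < B * T0)%N by rewrite muln_gt0 B0.
have S0R : 0 < (B * T0)%:R :> R by rewrite ltr0n.
have Sd0 : 0 < ((B * T0) ^ d)%:R :> R by rewrite ltr0n expn_gt0 S0.
pose mu : R := n%:R / ((B * T0) ^ d)%:R.
have C2mu : C2 * ln n%:R <= mu.
  have SC : C2 * s * (B * T0)%:R <= 1.
    rewrite -(ler_pM2l K0) mulr1 !mulrA; apply: le_trans Bhi.
    by rewrite ler_pM2r.
  have SC0 : 0 <= C2 * s * (B * T0)%:R.
    by rewrite !mulr_ge0 // ltW // (lt_le_trans ltr01).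
  have := exprn_ile1 d SC0 SC.
  rewrite !exprMn sd -natrX => h1.
  rewrite /mu ler_pdivlMr //.
  (* As [C2 >= 1] and [d > 0], the power [C2 ^+ d] may be lowered to [C2]. *)
  have : C2 * q * ((B * T0) ^ d)%:R <= 1.
    apply: le_trans h1; rewrite ler_pM2r // ler_pM2r //.
    by rewrite -[X in X <= _]expr1 ler_weXn2l.
  rewrite -(ler_pM2r n0R) mul1r; apply: le_trans.
  suff -> : C2 * q * ((B * T0) ^ d)%:R * n%:R = C2 * ln n%:R * ((B * T0) ^ d)%:R by [].
  by rewrite /q; field; exact: lt0r_neq0.
have mulb a : a <= C2 -> a * ln n%:R <= mu.
  move=> aC; apply: le_trans C2mu; apply: ler_wpM2r => //.
  exact: le_trans ler01 ln1.
have mu1 : 1 <= mu by apply: (le_trans ln1); rewrite -[X in X <= _]mul1r; exact: mulb.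
have Sn : ((B * T0) ^ d)%:R <= n%:R :> R.
  by move: mu1; rewrite /mu ler_pdivlMr // mul1r.
have CC : C <= C2 by rewrite /C2; move: e16; clear; lra.
have C16 : 16 / eta ^+ 2 <= C2 by rewrite /C2; move: C0; clear; lra.
pose Gs := [set g : {ffun 'I_n -> {ffun 'I_d -> 'I_(B * T0)}} | [forall c,
     (1 - eta) * mu <= #|[set i | g i == c]%SET|%:R <= (1 + eta) * mu]]%SET.
apply: (@le_trans _ _ (#|Gs|%:R / ((B * T0)%:R ^+ d) ^+ n)%:E).
  rewrite lee_fin; apply: le_trans (good_pattern_bound n d S0 eta0 eta1).
  rewrite lerD2l lerN2 -/mu.
  have nn : (0 < n)%N by rewrite -(ltr0n R).
  have := expR_neg_ln nn eta0 C16 C2mu; set E := expR _ => hE.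
  apply: (@le_trans _ _ (n%:R * (2 * (n%:R ^+ 2)^-1))).
    by apply: ler_pM => //; rewrite ?ler_pM2l // ?mulr_ge0 ?expR_ge0.
  suff -> : n%:R * (2 * (n%:R ^+ 2)^-1) = 2 / n%:R :> R by [].
  by field; exact: lt0r_neq0.
apply: (prob_ge_patterns S0 Xunif).
  exact: (measurable_graph_property X r (fun G => robust_cycles _ _ G)).
move=> g; rewrite finset.inE => /forallP gG w gw L H v L1 L2 aH.
apply: (main n B r (fun i => X i w) g H nn0 B0 (ltW r0) Blo Bhi (mulb _ CC) _ gG aH L v _ L2).
  by move=> i k; exact: gw.
rewrite -(ltr_nat R).
apply: lt_le_trans L1.
have NN : 0 < N.+1%:R :> R by rewrite ltr0n.
apply: (@lt_le_trans _ _ N.+1%:R); first by rewrite ltr_nat.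
rewrite -[X in X <= _]invrK lef_pV2 ?posrE ?invr_gt0 //.
  by rewrite ge_min lexx.
by rewrite lt_min invr_gt0 NN /= divr_gt0.
Qed.

Theorem theorem1p8 (R : realType) (eps : R) (d : nat)
    (eps_gt0 : 0 < eps) (eps_le : eps <= 1 / 2) (d_gt0 : (0 < d)%N) :
  exists c3 C3 : R, [/\ 0 < c3, 0 < C3 &
    forall (r : nat -> R)
      (disp : nat -> measure_display)
      (T : forall n : nat, measurableType (disp n))
      (P : forall n : nat, probability (T n) R)
      (X : forall n : nat, 'I_n -> {RV (P n) >-> rpoint R d}),
    (\forall n \near \oo,
       C3 * (ln n%:R / n%:R) `^ (d%:R^-1) <= r n /\ r n <= c3) ->
    (forall n : nat, independent_uniform_points (X n)) ->
    P n [set w : T n |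
          forall (L : nat) (H : rel 'I_n) (v : 'I_n),
            c3^-1 <= L%:R -> L%:R <= 2 * n%:R / 3 :> R ->
            alpha_subgraph (1 / 2 + eps)
              (geometric_graph (fun i => X n i w) (r n)) H ->
            exists c : seq 'I_n,
              [/\ is_cycle H c, size c = L & v \in c]]
      @[n --> \oo] --> 1%E].
Proof.
have [c3 [C3 [n0 [c30 C30 main]]]] := prob_cycles_ge eps_gt0 eps_le d_gt0.
exists c3, C3; split => // r disp T P X nearr Xunif.
apply: (@squeeze_cvge _ _ _ _ (fun n => (1 - 2 / n%:R)%:E) _ (fun=> 1%E)).
- near=> n; apply/andP; split; last first.
    apply: probability_le1.
    exact: (measurable_graph_property (X n) (r n) (fun G => robust_cycles _ _ G)).
  have [r1 r2] : C3 * (ln n%:R / n%:R) `^ (d%:R^-1) <= r n /\ r n <= c3 by near: n.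
  by apply: main => //; near: n; exact: nbhs_infty_ge.
- apply: cvg_EFin; first by near=> n.
  rewrite -[X in _ --> X]subr0; apply: cvgB; first exact: cvg_cst.
  rewrite -[X in _ --> X](mulr0 2); apply: cvgMr.
  apply/gtr0_cvgV0; last exact: cvgr_idn.
  by near=> n; rewrite ltr0n; near: n; exact: nbhs_infty_gt.
- exact: cvg_cst.
Unshelve. all: by end_near.
Qed.
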